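(* Under $P_N$, and also under $P_N^{(k)}$ for each $k\ge2$, the random variable $\frac{\log n}{\log p^+(n)}$ converges weakly, as $N\to\infty$, to $D+1$, where $D$ is a random variable with the Dickman distribution; that is, $$D_{\text{log-indep}}(\{n\in\mathbb{N}:p^+(n)\le n^{\frac1s}\})=D_{\text{log-indep}}\Big(\Big\{n\in\mathbb{N}:\frac{\log n}{\log p^+(n)}\ge s\Big\}\Big)=e^{-\gamma}\int_{s-1}^\infty\rho(x)\,dx,\qquad s\ge1;$$ and $$D_{\text{log-indep}}(\{n\in\mathbb{N}:p^+(n)\le n^{\frac1s}\}\,|\,S_k)=D_{\text{log-indep}}\Big(\Big\{n\in\mathbb{N}:\frac{\log n}{\log p^+(n)}\ge s\Big\}\,\Big|\,S_k\Big)=e^{-\gamma}\int_{s-1}^\infty\rho(x)\,dx,\qquad s\ge1,\ k\ge2.$$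
   Context: $\{p_j\}_{j=1}^\infty$ denotes the primes in increasing order. $p^+(n)$ denotes the largest prime divisor of $n$, with the conventions $p^+(1)=1$ and $\frac{\log n}{\log p^+(n)}\big|_{n=1}=0$. $\Omega_N=\{n\in\mathbb{N}: p_j\nmid n \text{ for all } j>N\}$, $C_N=\sum_{n\in\Omega_N}\frac1n<\infty$, and $P_N$ is the probability measure on $\Omega_N$ given by $P_N(\{n\})=\frac1{C_N}\frac1n$, $n\in\Omega_N$. For $k\ge2$, $S_k$ denotes the set of $k$-free positive integers (those $n$ with $p^k\nmid n$ for all primes $p$), and $P_N^{(k)}(\cdot)=P_N(\,\cdot\,|S_k)$. For $A\subset\mathbb{N}$, $D_{\text{log-indep}}(A)=\lim_{N\to\infty}P_N(A\cap\Omega_N)$ whenever the limit exists, and $D_{\text{log-indep}}(A|S_k)=\frac{D_{\text{log-indep}}(A\cap S_k)}{D_{\text{log-indep}}(S_k)}$; the stated equalities include the existence of the limits. The Dickman function $\rho$ is the unique continuous function on $(0,\infty)$ satisfying $\rho(x)=1$ for $x\in(0,1]$ and $x\rho'(x)+\rho(x-1)=0$ for $x>1$. It satisfies $\int_0^\infty\rho(x)\,dx=e^\gamma$, where $\gamma$ is Euler's constant, and the Dickman distribution is the probability distribution on $[0,\infty)$ with density $e^{-\gamma}\rho(x)$. *)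

(* Defs.v *)
From HB Require Import structures.
From mathcomp Require Import all_boot all_order all_algebra.
From mathcomp Require Import all_classical all_reals all_analysis.
From mathcomp Require Import measurable_realfun lra.

Set Implicit Arguments.
Unset Strict Implicit.
Unset Printing Implicit Defensive.

Import Order.TTheory GRing.Theory Num.Theory.
Import numFieldNormedType.Exports.

Local Open Scope classical_set_scope.
Local Open Scope ring_scope.

Lemma exists_prime_gt (n : nat) : exists p, prime p && (n < p)%N.
Proof. by have [p np pp] := prime_above n; exists p; rewrite pp. Qed.

Definition next_prime (n : nat) : nat := ex_minn (exists_prime_gt n).

(* Indexed from 1: nth_prime 1 = 2, nth_prime 2 = 3, and so on; nth_prime 0 = 0
   is a junk value. *)
Definition nth_prime (j : nat) : nat := iter j next_prime 0%N.

Lemma next_primeP (n : nat) :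
  [/\ prime (next_prime n), (n < next_prime n)%N &
      forall p, prime p -> (n < p)%N -> (next_prime n <= p)%N].
Proof.
rewrite /next_prime; case: ex_minnP => m /andP[pm nm] mmin.
by split => // p pp np; apply: mmin; rewrite pp.
Qed.

Lemma nth_primeP (p : nat) : prime p <-> exists2 j, (0 < j)%N & nth_prime j = p.
Proof.
split => [pp|[[|j]// _ <-]]; last by have [] := next_primeP (nth_prime j).
have le_id n : (n <= nth_prime n)%N.
  elim: n => // n IH; have [_ + _] := next_primeP (nth_prime n).
  exact: leq_ltn_trans.
have pex : exists j, (p <= nth_prime j)%N by exists p.
case: (ex_minnP pex) => -[|j] pj jmin.
  by move: pj; rewrite leqn0 => /eqP p0; rewrite p0 in pp.
exists j.+1 => //; apply/eqP; rewrite eqn_leq pj andbT.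
have [_ _ -> //] := next_primeP (nth_prime j).
by rewrite ltnNge; apply/negP => /jmin; rewrite ltnn.
Qed.

Definition Omega (N : nat) : set nat :=
  [set n | (0 < n)%N /\ forall j, (N < j)%N -> ~~ (nth_prime j %| n)%N].

Definition kfree (k : nat) : set nat :=
  [set n | (0 < n)%N /\ forall p, prime p -> ~~ (p ^ k %| n)%N].

Lemma measurable_nat (A : set nat) : measurable A. Proof. by []. Qed.

(* The measure on nat giving mass 1/n to each n >= 1 (and 0 to 0, as 0^-1 = 0). *)
Definition harmonic_measure (R : realType) : {measure set nat -> \bar R} :=
  mseries (fun n => mscale (n%:R^-1 : R)%:nng (dirac n)) 0%N.

Definition C_ (R : realType) (N : nat) : \bar R :=
  (\esum_(n in Omega N) (n%:R^-1)%:E)%E.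

Lemma harmonic_measureE (R : realType) (A : set nat) :
  harmonic_measure R A = (\esum_(n in A) (n%:R^-1)%:E)%E.
Proof.
rewrite /harmonic_measure /= /mseries nneseries_esumT; last by move=> n.
rewrite [RHS]esum_mkcond; apply: eq_esum => n _.
transitivity ((n%:R^-1 : R)%:E * \d_n A)%E => //.
by rewrite diracE; case: (n \in A); rewrite ?mule1 ?mule0.
Qed.

Lemma C_gt0 (R : realType) (N : nat) : (0 < C_ R N)%E.
Proof.
apply: (@lt_le_trans _ _ 1%E) => //; apply: esum_ge; exists [set 1%N].
  split; first exact: finite_set1.
  move=> _ ->; split => // -[//|j] _; have [pp _ _] := next_primeP (nth_prime j).
  by rewrite dvdn1; apply: contraL pp => /eqP /= ->.
by rewrite fsbig_set1 invr1.
Qed.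

Lemma sum_multiples_le (R : realType) (p M : nat) (g : nat -> R) : (0 < p)%N ->
  (forall n, 0 <= g n) ->
  \sum_(n < M | (p %| n)%N) g n <= \sum_(m < M) g (p * m)%N.
Proof.
move=> p0 g0.
apply: (@le_trans _ _ (\sum_(n < M) \sum_(m < M | (p * m)%N == n) g (p * m)%N)).
  rewrite big_mkcond; apply: ler_sum => n _; case: ifP => [/dvdnP[q nq]|_].
    have qM : (q < M)%N.
      by apply: leq_ltn_trans (ltn_ord n); rewrite nq leq_pmulr.
    rewrite (bigD1 (Ordinal qM)) /= -?nq mulnC -?nq //.
    by rewrite lerDl sumr_ge0.
  by rewrite sumr_ge0.
rewrite (exchange_big_dep predT) //=; apply: ler_sum => m _.
have [mM|mM] := ltnP (p * m) M; last first.
  by rewrite big_pred0 // => n; apply/negbTE; rewrite neq_ltn (leq_trans (ltn_ord n)) ?orbT.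
by rewrite (big_pred1 (Ordinal mM)) // => n; rewrite eq_sym.
Qed.

Lemma sum_Omega_bounded (R : realType) (N : nat) : exists B : R, forall M,
  \sum_(n < M | (n : nat) \in Omega N) n%:R^-1 <= B.
Proof.
elim: N => [|N [B BP]].
  exists 1 => M; have Om0 n : n \in Omega 0 -> n = 1%N.
    rewrite inE => -[n0 nP]; apply/eqP; apply: contraT => n1.
    have pn : prime (pdiv n) by rewrite pdiv_prime // ltn_neqAle eq_sym n1.
    have [j j0 jE] := (nth_primeP (pdiv n)).1 pn.
    by have := nP j j0; rewrite jE pdiv_dvd.
  have [M1|M1] := ltnP 1 M.
    rewrite (@le_trans _ _ (\sum_(n < M | n == Ordinal M1) n%:R^-1)) //; last first.
      by rewrite big_pred1_eq invr1.
    rewrite big_mkcond [leRHS]big_mkcond; apply: ler_sum => n _.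
    case: ifP => [/Om0 n1|_]; last by case: ifP.
    by rewrite ifT //; apply/eqP/val_inj.
  rewrite big_pred0 // => n; apply/negP => /Om0 n1.
  by have := ltn_ord n; rewrite n1 ltnNge M1.
exists (B *+ 2) => M; set p := nth_prime N.+1.
have pp : prime p by apply/nth_primeP; exists N.+1.
set S := \sum_(n < M | _) _.
have SE : S = \sum_(n < M | ((n : nat) \in Omega N.+1) && ~~ (p %| n)%N) n%:R^-1
   + \sum_(n < M | ((n : nat) \in Omega N.+1) && (p %| n)%N) n%:R^-1.
  by rewrite /S (bigID (fun n : 'I_M => (p %| n)%N)) /= addrC.
have S1 : \sum_(n < M | ((n : nat) \in Omega N.+1) && ~~ (p %| n)%N) n%:R^-1 <= B :> R.
  apply: le_trans (BP M); rewrite big_mkcond [leRHS]big_mkcond.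
  apply: ler_sum => n _; case: ifP => [/andP[]|_]; last by case: ifP.
  rewrite inE => -[n0 nP] pn; rewrite ifT // inE; split => // j.
  rewrite leq_eqVlt => /orP[/eqP <-//|]; exact: nP.
have S2 : \sum_(n < M | ((n : nat) \in Omega N.+1) && (p %| n)%N) n%:R^-1 <= 2^-1 * S.
  pose g n : R := if n \in Omega N.+1 then n%:R^-1 else 0.
  have g0 n : 0 <= g n by rewrite /g; case: ifP.
  rewrite (eq_bigl (fun n : 'I_M => (p %| n)%N && ((n : nat) \in Omega N.+1))); last first.
    by move=> n; rewrite andbC.
  rewrite big_mkcondr /=; apply: le_trans (sum_multiples_le M (prime_gt0 pp) g0) _.
  rewrite /S mulr_sumr [leRHS]big_mkcond; apply: ler_sum => m _; rewrite /g.
  case: ifPn => [|_]; last by case: ifP => // _; rewrite mulr_ge0.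
  rewrite inE => -[n0 nP]; rewrite ifT; last first.
    rewrite inE; split; first by move: n0; rewrite muln_gt0 => /andP[].
    by move=> j /nP; apply: contra; exact: dvdn_mull.
  rewrite natrM invfM ler_wpM2r // lef_pV2 ?posrE ?ltr0n ?prime_gt0 //.
  by rewrite ler_nat prime_gt1.
by lra.
Qed.

Lemma C_lty (R : realType) (N : nat) : (C_ R N < +oo)%E.
Proof.
have [B BP] := sum_Omega_bounded R N; apply: (@le_lt_trans _ _ B%:E); last exact: ltry.
rewrite /C_ esum_mkcond -(@nneseries_esumT R); last by move=> n; case: ifP.
apply: lime_le; first by apply: is_cvg_nneseries => n _ _; case: ifP.
apply: nearW => M; rewrite big_mkord.
under eq_bigr do rewrite -(fun_if EFin).
by rewrite sumEFin lee_fin -big_mkcond.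
Qed.

Lemma mnormalizeE d (T : measurableType d) (R : realType)
    (mu : {measure set T -> \bar R}) (P : probability T R) (A : set T) :
  (0 < mu setT < +oo)%E ->
  mnormalize mu P A = (mu A * (fine (mu setT))^-1%:E)%E.
Proof. by move=> /andP[mu0 muoo]; rewrite /mnormalize gt_eqF //= lt_eqF. Qed.

Lemma mnormalize_mrestrE d (T : measurableType d) (R : realType)
    (mu : {measure set T -> \bar R}) (P : probability T R)
    (S : set T) (mS : measurable S) (A : set T) :
  (0 < mu S < +oo)%E ->
  mnormalize (mrestr mu mS) P A = (mu (A `&` S) * (fine (mu S))^-1%:E)%E.
Proof.
have E : mu (setT `&` S) = mu S by rewrite setTI.
rewrite -E => muS; exact: (@mnormalizeE _ _ _ (mrestr mu mS)).
Qed.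

(* Carried by Omega N. As C_ N is neither 0 nor
   +oo (C_gt0, C_lty), the second argument of mnormalize plays no role; the
   values of P_N are given by P_E and P_set1. *)
Definition P_ (R : realType) (N : nat) : probability nat R :=
  mnormalize (mrestr (harmonic_measure R) (measurable_nat (Omega N))) (dirac 1%N).

Lemma P_E (R : realType) (N : nat) (A : set nat) :
  P_ R N A = ((\esum_(n in A `&` Omega N) (n%:R^-1)%:E) * (fine (C_ R N))^-1%:E)%E.
Proof.
have CE := harmonic_measureE R (Omega N).
rewrite -harmonic_measureE /C_ -CE; apply: mnormalize_mrestrE.
by rewrite CE C_gt0 C_lty.
Qed.

Lemma P_set1 (R : realType) (N n : nat) : Omega N n ->
  P_ R N [set n] = ((fine (C_ R N))^-1 * n%:R^-1)%:E.
Proof.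
move=> Nn; rewrite P_E (_ : _ `&` _ = [set n]); last first.
  by apply/seteqP; split => [m []//|m ->].
by rewrite esum_set1 // -EFinM mulrC.
Qed.

(* P( . | S) if P S != 0 (cond_probE); the value P when P S = 0 is junk. *)
Definition cond_prob d (T : measurableType d) (R : realType)
    (P : probability T R) (S : set T) (mS : measurable S) : probability T R :=
  mnormalize (mrestr P mS) P.

Lemma cond_probE d (T : measurableType d) (R : realType) (P : probability T R)
    (S : set T) (mS : measurable S) (A : set T) : (0 < P S)%E ->
  cond_prob P mS A = (P (A `&` S) * (fine (P S))^-1%:E)%E.
Proof.
move=> PS; apply: mnormalize_mrestrE; rewrite PS /=.
by rewrite (le_lt_trans (probability_le1 P mS)) // ltry.
Qed.

Lemma P_kfree_gt0 (R : realType) (k N : nat) : (0 < k)%N -> (0 < P_ R N (kfree k))%E.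
Proof.
move=> k0; have O1 : Omega N 1%N.
  split => // j jN; rewrite dvdn1; apply/negP => /eqP pj.
  by have : prime (nth_prime j) by [apply/nth_primeP; exists j => //; exact: leq_ltn_trans jN]; rewrite pj.
apply: (@lt_le_trans _ _ (P_ R N [set 1%N])); last first.
  apply: le_measure; rewrite ?inE // => _ ->; split => // p pp.
  by rewrite gtnNdvd // -(exp1n k) ltn_exp2r // prime_gt1.
rewrite P_set1 // lte_fin mulr_gt0 ?invr_gt0 // fine_gt0 // C_gt0 C_lty //.
Qed.

Definition P_free (R : realType) (k N : nat) : probability nat R :=
  cond_prob (P_ R N) (measurable_nat (kfree k)).

(* max_pdiv 1 = 1, and x / 0 = 0, so that log_ratio R 1 = 0. *)
Definition log_ratio (R : realType) (n : nat) : R :=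
  ln n%:R / ln (max_pdiv n)%:R.

Lemma measurable_log_ratio (R : realType) : measurable_fun setT (@log_ratio R).
Proof. by []. Qed.

HB.instance Definition _ (R : realType) :=
  isMeasurableFun.Build _ _ _ _ (@log_ratio R) (@measurable_log_ratio R).

Definition cvg_log_indep_density (R : realType) (A : set nat) : Prop :=
  cvgn (fun N => fine (P_ R N (A `&` Omega N))).

Definition log_indep_density (R : realType) (A : set nat) : R :=
  limn (fun N => fine (P_ R N (A `&` Omega N))).

Definition cvg_log_indep_density_cond (R : realType) (A S : set nat) : Prop :=
  [/\ cvg_log_indep_density R (A `&` S), cvg_log_indep_density R S &
      log_indep_density R S != 0].

Definition log_indep_density_cond (R : realType) (A S : set nat) : R :=
  log_indep_density R (A `&` S) / log_indep_density R S.

Definition smooth_set (R : realType) (s : R) : set nat :=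
  [set n | (0 < n)%N /\ (max_pdiv n)%:R <= n%:R `^ (1 / s)].

Definition log_ratio_ge (R : realType) (s : R) : set nat :=
  [set n | (0 < n)%N /\ s <= log_ratio R n].

Definition euler_gamma (R : realType) : R :=
  limn (fun n => \sum_(1 <= k < n.+1) (k%:R)^-1 - ln n%:R).

(* Such a rho is unique on ]0, +oo[; its values on ]-oo, 0[ are never used, and
   its value at 0 only on a null set. *)
Definition is_dickman_function (R : realType) (rho : R -> R) : Prop :=
  [/\ {in `]0, +oo[, continuous rho},
      (forall x : R, 0 < x <= 1 -> rho x = 1) &
      (forall x : R, 1 < x -> derivable rho x 1 /\ x * derive1 rho x + rho (x - 1) = 0)].

Definition has_dickman_distribution (R : realType) (rho : R -> R) d
    (T : measurableType d) (P : probability T R) (D : {RV P >-> R}) : Prop :=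
  forall A : set R, measurable A ->
    distribution P D A =
      (\int[lebesgue_measure]_(x in A `&` `[0%R, +oo[)
        (expR (- euler_gamma R) * rho x)%:E)%E.

Definition weak_cvg (R : realType) (mu_ : nat -> probability R R)
    (mu : probability R R) : Prop :=
  forall f : R -> R, continuous f -> (exists M, forall x, `|f x| <= M) ->
    (\int[mu_ N]_x (f x)%:E)%E @[N --> \oo] --> (\int[mu]_x (f x)%:E)%E.

(* Main.v *)
Require Import Defs.
From HB Require Import structures.
From mathcomp Require Import all_boot all_order all_algebra.
From mathcomp Require Import all_classical all_reals all_analysis measurable_realfun.
From mathcomp Require Import ring lra zify.
Import Order.TTheory GRing.Theory Num.Theory.
Import numFieldNormedType.Exports.
Local Open Scope classical_set_scope.
Local Open Scope ring_scope.

(** Write p_1 < p_2 < ... for the primes, D for a Dickman variable and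
    X n = ln n / ln p^+(n).

    Under the law proportional to 1 / n on the integers with primes among
    p_1, ..., p_N, the prime factors act independently. Integers whose largest
    prime factor is p = p_i are p times an integer of the i-th such family, and X
    is then 1 + ln (n / p) / ln p. The law of X is therefore an average over i of
    the laws of 1 + ln m / ln p_i, and by the Stolz-Cesaro theorem (stolz_cesaro)
    only its limit in i matters. The theorem applies because the total
    weight, the Euler product up to p_N, diverges (cvg_euler_prod_oo).

    Laplace transforms at a natural number j decide everything. That of
    ln m / ln p_i is a ratio of Euler products at the exponents 1 + j / ln p_i and
    1. Mertens' estimate for the sum of ln p / p, with Abel's inequality, turns its
    logarithm into a Riemann sum for Ein j, the integral of (1 - exp (- t)) / t
    over [0, j], and the ratio tends to exp (- Ein j) (cvg_euler_ratio). Hence the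
    transform of X tends to exp (- j - Ein j) (cvg_laplace_log_ratio).

    On the other side, x rho'(x) = - rho(x - 1) says that the Laplace transform
    R of rho satisfies l R'(l) = - (1 - exp (- l)) R(l), so that
    R(l) = R(0) exp (- Ein l) (dickman_laplaceE). The value of R(0) follows
    from n R(n) -> 1 and from H_n - Ein n -> 0, where H_n is the harmonic sum:
    R(0) = exp gamma (dickman_laplace0). So D + 1 has exactly the transform found
    above.

    Convergence of Laplace transforms at the natural numbers implies weak
    convergence: after the substitution t = exp (- x) these transforms are the
    moments, and polynomials are dense by Weierstrass' theorem
    (weak_cvg_of_laplace). The density of D being bounded, the tails converge too
    (cvg_log_ratio_tail).

    Requiring n to be k-free only changes the Euler factors from 1 / (1 - x) to
    (1 - x ^ k) / (1 - x), which differ at second order in x = 1 / p; the proof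
    carries k along, k = 0 meaning no requirement and k = 1, which leaves only
    n = 1, being excluded. The density of the k-free integers is the positive
    product of the 1 - p ^ (- k) (cvg_free_density). Finally the two sets of the
    statement differ only by the integer 1, whose probability tends to 0. *)

Set Implicit Arguments.
Unset Strict Implicit.
Unset Printing Implicit Defensive.

(** * Chebyshev's bound on the primorial *)

Section Primorial.
Local Open Scope nat_scope.

Lemma prod_primes_dvd (s : seq nat) (m : nat) :
  uniq s -> all (fun p => prime p && (p %| m)) s -> \prod_(p <- s) p %| m.
Proof.
elim: s => [|p s IH] /=; first by rewrite big_nil dvd1n.
move=> /andP[ps us] /andP[/andP[pp pm] sm]; rewrite big_cons Gauss_dvd ?pm ?IH//.
have cop q : q \in s -> coprime p q.
  move=> qs; have /andP[pq _] := allP sm _ qs.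
  rewrite prime_coprime//; apply: contra ps => /prime_nt_dvdP ->//.
  by rewrite neq_ltn prime_gt1 ?orbT.
rewrite big_seq; elim/big_ind: _ => [|x y cx cy|q /cop//]; first exact: coprimen1.
by rewrite coprimeMr cx cy.
Qed.
(** A prime in ]m, 2m] divides (2m)! but not m!. *)
Lemma prime_dvd_bin2n m p : prime p -> m < p <= m.*2 -> p %| 'C(m.*2, m).
Proof.
move=> pp /andP[mp p2m].
have mm : m <= m.*2 by rewrite -addnn leq_addr.
have := bin_fact mm; rewrite -addnn addnK addnn => E.
have : p %| (m.*2)`! by rewrite dvdn_fact// p2m prime_gt0.
rewrite -E !Euclid_dvdM// => /orP[//|].
have nf : ~~ (p %| m`!).
  elim: m mp {p2m mm E} => [|m IH] mp; first by rewrite fact0 Euclid_dvd1.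
  rewrite factS Euclid_dvdM// negb_or IH ?(ltnW mp)// andbT.
  by rewrite gtnNdvd.
by rewrite (negbTE nf).
Qed.
Definition primorial n := \prod_(0 <= p < n.+1 | prime p) p.
Lemma primorial_gt0 n : 0 < primorial n.
Proof. by apply: prodn_cond_gt0 => p /prime_gt0. Qed.
Lemma primorial_le m n : m <= n -> primorial m <= primorial n.
Proof.
move=> mn; rewrite /primorial [X in _ <= X](big_cat_nat (n := m.+1))//=.
by rewrite leq_pmulr// prodn_cond_gt0 // => p /prime_gt0.
Qed.
(** The primes in ]m, 2m] all divide the central binomial coefficient, which is
    at most 2 ^ (2m). *)
Lemma primorial_double m : primorial m.*2 <= primorial m * 4 ^ m.
Proof.
rewrite /primorial (big_cat_nat (n := m.+1))//=; last by rewrite ltnS -addnn leq_addr.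
rewrite leq_pmul2l ?primorial_gt0//.
apply: (@leq_trans 'C(m.*2, m)); last first.
  rewrite (_ : 4 = 2 ^ 2)// -expnM mul2n -[2]/(1 + 1) expnDn.
  under eq_bigr do rewrite !exp1n !muln1.
  have mm : m < m.*2.+1 by rewrite ltnS -addnn leq_addr.
  by rewrite (bigD1 (Ordinal mm))//= leq_addr.
apply: dvdn_leq; first by rewrite bin_gt0 -addnn leq_addr.
rewrite -big_filter; apply: prod_primes_dvd; first by rewrite filter_uniq ?iota_uniq.
apply/allP => p; rewrite mem_filter mem_index_iota ltnS => /andP[pp H].
by rewrite pp prime_dvd_bin2n.
Qed.
(** Induction from uphalf n to n. The base 16, larger than Chebyshev's 4, absorbs
    the rounding: 16 ^ m * 4 ^ m <= 16 ^ n for m = uphalf n as soon as n >= 3. *)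
Lemma primorial_le16 n : primorial n <= 16 ^ n.
Proof.
elim/ltn_ind: n => -[|[|[|n]]] IH.
1-3: by rewrite /primorial unlock.
set m := (uphalf n.+3).
have m1 : m < n.+3 by rewrite /m; lia.
have m2 : n.+3 <= m.*2 by rewrite /m; lia.
apply: leq_trans (primorial_le m2) _; apply: leq_trans (primorial_double m) _.
apply: (@leq_trans (16 ^ m * 4 ^ m)); first by rewrite leq_mul2r IH ?orbT.
rewrite (_ : 16 = 2 ^ 4)// (_ : 4 = 2 ^ 2)// -!expnM -expnD leq_exp2l//.
rewrite /m; lia.
Qed.
End Primorial.

(** * Mertens' estimate for the sum of ln p / p *)

Section Mertens.
Context {R : realType}.
Implicit Types (n p : nat).
Lemma ln_natM (a b : nat) : (0 < a)%N -> (0 < b)%N ->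
  ln (a * b)%:R = ln a%:R + ln b%:R :> R.
Proof. by move=> a0 b0; rewrite natrM lnM// posrE ltr0n. Qed.
Lemma ln_natX (a k : nat) : (0 < a)%N -> ln (a ^ k)%:R = k%:R * ln a%:R :> R.
Proof. by move=> a0; rewrite natrX lnXn ?ltr0n// mulr_natl. Qed.
Lemma ln_nat_prod (s : seq nat) (P : pred nat) (F : nat -> nat) :
  (forall i, P i -> (0 < F i)%N) ->
  ln (\prod_(i <- s | P i) F i)%N%:R = \sum_(i <- s | P i) ln (F i)%:R :> R.
Proof.
move=> F0; elim: s => [|i s IH]; first by rewrite !big_nil ln1.
rewrite !big_cons; case: ifP => // Pi; rewrite ln_natM ?IH ?F0//.
exact: prodn_cond_gt0.
Qed.
Lemma ln_fact_primes n : ln n`!%:R =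
  \sum_(0 <= p < n.+1 | prime p) (logn p n`!)%:R * ln p%:R :> R.
Proof.
rewrite -{1}(partnT (fact_gt0 n)) (widen_partn _ (leqnn _)).
have nf : (n <= n`!)%N by case: n => // n; rewrite factS leq_pmulr ?fact_gt0.
rewrite (big_cat_nat (n := n.+1))//= [X in (_ * X)%N]big1_seq ?muln1; last first.
  move=> p; rewrite mem_index_iota /= => /andP[np _].
  have [pp|/negbTE pp] := boolP (prime p); last by rewrite lognE pp.
  rewrite logn_fact// big1_seq// => k; rewrite mem_index_iota /= => /andP[k0 _].
  rewrite divn_small// (leq_trans np)//.
  by rewrite -{1}(expn1 p) leq_exp2l// prime_gt1.
rewrite [in LHS](bigID prime)/= [X in (_ * X)%N]big1 ?muln1; last first.
  by move=> p /negbTE pp; rewrite lognE pp.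
rewrite ln_nat_prod; last by move=> p pp; rewrite expn_gt0 prime_gt0.
by apply: eq_bigr => p pp; rewrite ln_natX ?prime_gt0.
Qed.
Lemma logn_fact_ge n p : prime p -> (n %/ p <= logn p n`!)%N.
Proof.
move=> pp; rewrite logn_fact//; case: n => [|n]; first by rewrite div0n.
by rewrite big_nat_recl// expn1 leq_addr.
Qed.
(** Legendre's formula bounds the exponent by the geometric series of sum
    n / (p - 1); carrying the remainder n %/ p ^ m keeps the induction in nat. *)
Lemma logn_fact_le n p : prime p -> (logn p n`! * p.-1 <= n)%N.
Proof.
move=> pp; rewrite logn_fact//.
have H m : ((\sum_(1 <= k < m.+1) n %/ p ^ k) * p.-1 + n %/ p ^ m <= n)%N.
  elim: m => [|m IH]; first by rewrite big_geq// mul0n expn0 divn1.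
  rewrite big_nat_recr//= mulnDl -addnA; apply: leq_trans IH; rewrite leq_add2l.
  rewrite expnSr divnMA; set q := (n %/ p ^ m)%N.
  rewrite addnC -mulnS prednK ?prime_gt0//.
  exact: leq_divM.
exact: leq_trans (leq_addr _ _) (H n).
Qed.
Lemma ln_fact_le n : ln n`!%:R <= n%:R * ln n%:R :> R.
Proof.
case: n => [|n]; first by rewrite fact0 ln1 mul0r.
rewrite -ln_natX// ler_ln ?posrE ?ltr0n ?fact_gt0 ?expn_gt0// ler_nat.
elim: n => // n IH; rewrite factS expnS leq_mul2l; apply/orP; right.
by apply: leq_trans IH _; rewrite leq_exp2r.
Qed.
Lemma ln_succ_le n : (0 < n)%N -> ln n.+1%:R - ln n%:R <= n%:R^-1 :> R.
Proof.
move=> n0; have nR : 0 < n%:R :> R by rewrite ltr0n.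
rewrite -ln_div ?posrE ?ltr0n//.
rewrite (_ : n.+1%:R / n%:R = 1 + n%:R^-1 :> R); last first.
  by rewrite -natr1 mulrDl mul1r divff// gt_eqF.
by rewrite le_ln1Dx// (lt_trans (ltrN10 _)) ?invr_gt0.
Qed.
(** This weak form of Stirling's formula loses O(n), which costs O(1) in
    Mertens' estimate. *)
Lemma ln_fact_ge n : n%:R * ln n%:R - n%:R <= ln n`!%:R :> R.
Proof.
elim: n => [|n IH]; first by rewrite fact0 ln1 mul0r subr0.
have [->|n0] := posnP n; first by rewrite factS fact0 ln1 mul1r sub0r lerN10.
rewrite factS ln_natM ?fact_gt0//.
have nR : 0 < n%:R :> R by rewrite ltr0n.
have := ln_succ_le n0; rewrite -(ler_pM2l nR) divff ?gt_eqF// => H.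
have E : n.+1%:R = n%:R + 1 :> R by rewrite natr1.
by set L := ln n.+1%:R in H *; rewrite E; lra.
Qed.
Definition mertens_sum n : R := \sum_(0 <= p < n.+1 | prime p) ln p%:R / p%:R.
Lemma ln_prime_ge0 p : prime p -> 0 <= ln p%:R :> R.
Proof. by move=> pp; rewrite ln_ge0// ler1n prime_gt0. Qed.
Lemma theta_le n : \sum_(0 <= p < n.+1 | prime p) ln p%:R <= n%:R * ln 16 :> R.
Proof.
rewrite -ln_nat_prod; last by move=> p /prime_gt0.
rewrite -ln_natX// ler_ln ?posrE ?ltr0n ?expn_gt0 ?primorial_gt0//.
by rewrite ler_nat primorial_le16.
Qed.
(** The exponent of p in n! is at least n / p - 1, and the total loss is theta(n),
    which is O(n). *)
Lemma mertens_le n : (0 < n)%N -> mertens_sum n <= ln n%:R + ln 16.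
Proof.
move=> n0; have nR : 0 < n%:R :> R by rewrite ltr0n.
rewrite -(ler_pM2l nR) mulrDr.
apply: le_trans (lerD (ln_fact_le n) (theta_le n)).
rewrite ln_fact_primes /mertens_sum mulr_sumr -big_split/=.
apply: ler_sum => p pp; have p0 : 0 < p%:R :> R by rewrite ltr0n prime_gt0.
rewrite mulrCA -[X in _ <= _ + X]mul1r -mulrDl mulrC ler_wpM2r ?ln_prime_ge0//.
rewrite ler_pdivrMr// natr1 -natrM ler_nat.
apply: leq_trans (ltnW (ltn_ceil n (prime_gt0 pp))) _.
by rewrite leq_mul2r ltnS logn_fact_ge ?orbT.
Qed.
(** The general term is at most v (m - 1) - v m, where v m = (2 + ln m) / m. *)
Lemma sum_ln_div_sqr n :
  \sum_(2 <= m < n.+1) ln m%:R / (m%:R * m.-1%:R) <= 2 :> R.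
Proof.
pose v m : R := (2 + ln m%:R) / m%:R.
have v0 m : 0 <= v m.
  rewrite divr_ge0// addr_ge0//; case: m => [|m]; first by rewrite ln0.
  by rewrite ln_ge0// ler1n.
case: n => [|n]; first by rewrite big_geq.
suff H : \sum_(2 <= m < n.+2) ln m%:R / (m%:R * m.-1%:R) <= v 1%N - v n.+1.
  apply: le_trans H _; apply: (@le_trans _ _ (v 1%N)); first by rewrite gerBl v0.
  by rewrite /v ln1 addr0 divr1.
elim: n => [|n IH]; first by rewrite big_geq// subrr.
rewrite big_nat_recr//= -(subrK (v n.+1) (v 1%N)) -addrA lerD//.
have a0 : 0 < n.+1%:R :> R by [].
have b0 : 0 < n.+2%:R :> R by [].
have ab : n.+2%:R = n.+1%:R + 1 :> R by rewrite natr1.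
have := @ln_succ_le n.+1 isT; rewrite /v /=.
have : n.+1%:R^-1 <= 1 :> R by rewrite invf_le1// ler1n.
move: (ln n.+1%:R) (ln n.+2%:R) => la lb; rewrite ab => a1 H.
rewrite -subr_ge0; set a := n.+1%:R in a0 a1 H *.
have -> : (2 + la) / a - (2 + lb) / (a + 1) - lb / ((a + 1) * a) =
    (2 - (a + 1) * (lb - la)) / (a * (a + 1)).
  by field; rewrite !gt_eqF// ltr_wpDl// ltW.
apply: divr_ge0; last by rewrite mulr_ge0// ltW// addr_gt0.
rewrite subr_ge0.
have H1 := le_trans H a1.
have {}H : (lb - la) * a <= 1 by rewrite -ler_pdivlMr// div1r.
lra.
Qed.
Lemma sum_primes_ln_div n :
  \sum_(0 <= p < n.+1 | prime p) ln p%:R / (p%:R * p.-1%:R) <= 2 :> R.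
Proof.
apply: le_trans (sum_ln_div_sqr n).
rewrite big_mkcond /=; case: n => [|n]; first by rewrite big_nat1 big_geq.
rewrite big_nat_recl// big_nat_recl//= !add0r.
rewrite (big_addn 0 n.+2 2) subn2/= !big_mkord ler_sum// => i _; rewrite addn2.
by case: ifP => // _; rewrite divr_ge0// ln_ge0// ler1n.
Qed.
(** The exponent of p in n! is at most n / (p - 1) = n / p + n / (p (p - 1)), and
    the second terms have a bounded sum when weighted by ln p. *)
Lemma mertens_ge n : (0 < n)%N -> ln n%:R - 3 <= mertens_sum n.
Proof.
move=> n0; have nR : 0 < n%:R :> R by rewrite ltr0n.
suff : n%:R * ln n%:R - n%:R <= n%:R * (mertens_sum n + 2).
  rewrite (_ : _ - _ = n%:R * (ln n%:R - 1)); last by rewrite mulrBr mulr1.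
  by rewrite ler_pM2l//; lra.
apply: le_trans (ln_fact_ge n) _; rewrite ln_fact_primes.
have H := sum_primes_ln_div n.
apply: le_trans (_ : n%:R * (mertens_sum n +
   \sum_(0 <= p < n.+1 | prime p) ln p%:R / (p%:R * p.-1%:R)) <= _); last first.
  by rewrite ler_pM2l// lerD2l.
rewrite /mertens_sum -big_split mulr_sumr/=; apply: ler_sum => p pp.
have p0 : 0 < p%:R :> R by rewrite ltr0n prime_gt0.
have p1 : 0 < p.-1%:R :> R by rewrite ltr0n -subn1 subn_gt0 prime_gt1.
rewrite -mulrDr mulrCA mulrC ler_wpM2l ?ln_prime_ge0//.
have pE : p%:R = p.-1%:R + 1 :> R by rewrite natr1 prednK ?prime_gt0.
rewrite (_ : p%:R^-1 + (p%:R * p.-1%:R)^-1 = p.-1%:R^-1); last first.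
  by rewrite pE in p0 *; field; rewrite !gt_eqF.
by rewrite ler_pdivlMr// -natrM ler_nat logn_fact_le.
Qed.
End Mertens.

(** * One-variable calculus *)

Section Calculus.
Context {R : realType}.
Local Notation mu := lebesgue_measure.
Lemma cvg_le_cst (T : Type) (F : set_system T) {FF : ProperFilter F}
  (f : T -> R) (l c : R) : f x @[x --> F] --> l -> (\forall x \near F, f x <= c) -> l <= c.
Proof.
move=> fl fc; rewrite -(cvg_lim _ fl)//; apply: limr_le fc.
by apply/cvg_ex; exists l.
Qed.
Lemma cvg_ge_cst (T : Type) (F : set_system T) {FF : ProperFilter F}
  (f : T -> R) (l c : R) : f x @[x --> F] --> l -> (\forall x \near F, c <= f x) -> c <= l.
Proof.
move=> fl fc; rewrite -(cvg_lim _ fl)//; apply: limr_ge fc.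
by apply/cvg_ex; exists l.
Qed.
Lemma is_derive_mul (f g : R -> R) (x a b : R) :
  is_derive x 1 f a -> is_derive x 1 g b ->
  is_derive x 1 (fun y => f y * g y) (a * g x + f x * b).
Proof.
move=> df dg; have := is_deriveM df dg; rewrite /GRing.scale/= addrC.
by rewrite (mulrC _ a).
Qed.
Lemma is_derive_scale (f : R -> R) (x a c : R) :
  is_derive x 1 f a -> is_derive x 1 (fun y => c * f y) (c * a).
Proof.
move=> df; have := is_derive_mul (is_derive_cst c x 1) df.
by rewrite mul0r add0r.
Qed.
Lemma is_derive_exp (f : R -> R) (x a : R) :
  is_derive x 1 f a -> is_derive x 1 (fun y => expR (f y)) (a * expR (f x)).
Proof.
by move=> df; have := is_derive1_comp (is_derive_expR (f x)) df; rewrite mulrC.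
Qed.
Lemma is_derive_expM (x c : R) :
  is_derive x 1 (fun y => expR (c * y)) (c * expR (c * x)).
Proof.
have := is_derive_exp (is_derive_scale c (is_derive_id x 1)).
by rewrite mulr1.
Qed.
Lemma is_derive_expN (x : R) : is_derive x 1 (fun y => expR (- y)) (- expR (- x)).
Proof.
have := is_derive_expM x (-1); rewrite !mulN1r.
by under eq_fun do rewrite mulN1r.
Qed.
Lemma is_derive_subl (f : R -> R) (x a c : R) :
  is_derive (x - c) 1 f a -> is_derive x 1 (fun y => f (y - c)) a.
Proof.
move=> df; have dg : is_derive x (1 : R) (fun y => y - c) 1.
  by have := is_deriveB (is_derive_id x (1 : R)) (is_derive_cst c x (1 : R)); rewrite subr0.
by have := @is_derive1_comp R f (fun y => y - c) x a 1 df dg; rewrite mulr1.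
Qed.
Lemma mean_value (f df : R -> R) (a b : R) : a < b ->
  (forall x : R, a < x < b -> is_derive x 1 f (df x)) ->
  (forall x : R, a <= x <= b -> {for x, continuous f}) ->
  exists2 c, a < c < b & f b - f a = df c * (b - a).
Proof.
move=> ab fd fc.
have fd' x : x \in `]a, b[ -> is_derive x 1 f (df x) by rewrite in_itv; exact: fd.
have fc' : {within `[a, b], continuous f}.
  apply: continuous_in_subspaceT => x; rewrite inE/= in_itv/=; exact: fc.
by have [c cab E] := MVT ab fd' fc'; exists c => //; move: cab; rewrite in_itv.
Qed.
Lemma is_derive_continuous (f : R -> R) (x d : R) :
  is_derive x 1 f d -> {for x, continuous f}.
Proof.
by move=> H; apply: differentiable_continuous; apply/derivable1_diffP; apply: ex_derive.
Qed.
Lemma mean_value_derive (f df : R -> R) (a b : R) : a < b ->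
  (forall x : R, a <= x <= b -> is_derive x 1 f (df x)) ->
  exists2 c, a < c < b & f b - f a = df c * (b - a).
Proof.
move=> ab fd; apply: mean_value => // x xab; first by apply: fd; move: xab; lra.
exact: is_derive_continuous (fd _ xab).
Qed.
Lemma ge0_derive_le (f df : R -> R) (a b : R) : a <= b ->
  (forall x : R, a < x < b -> is_derive x 1 f (df x)) ->
  (forall x : R, a <= x <= b -> {for x, continuous f}) ->
  (forall x : R, a < x < b -> 0 <= df x) -> f a <= f b.
Proof.
rewrite le_eqVlt => /predU1P[->//|ab] fd fc d0.
have [c cab E] := mean_value ab fd fc.
by rewrite -subr_ge0 E mulr_ge0 ?d0// subr_ge0 ltW.
Qed.
(** The base point -1 makes 0 an interior point of the domain of differentiability,
    so that functions on [0, +oo[ need no one-sided derivative at 0. *)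
Lemma derive_primitive (f : R -> R) : continuous f ->
  exists F : R -> R, F 0 = 0 /\ forall x : R, -1 < x -> is_derive x 1 F (f x).
Proof.
move=> cf; pose G x := (\int[mu]_(t in `[-1, x]) f t)%R.
exists (fun x => G x - G 0); split; first by rewrite subrr.
move=> x x1; have ifx : mu.-integrable `[-1, x + 1] (EFin \o f).
  apply: continuous_compact_integrable; first exact: segment_compact.
  exact: continuous_subspaceT.
have xx1 : x < x + 1 by rewrite ltrDl.
have [dG GE] := @continuous_FTC1_closed R f (-1) x _ xx1 ifx x1 (cf x).
rewrite -[f x]subr0; apply: is_deriveB.
by rewrite -GE derive1E; exact/derivableP.
Qed.
(** Integrals over [0, +oo[ are handled below through a primitive and its
    derivative. Here the primitive increases and stays below C (1 - exp (- x)), so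
    it has a limit, which is the Lebesgue integral. *)
Lemma exp_decay_integral (f F : R -> R) (C : R) : continuous f ->
  F 0 = 0 -> (forall x : R, -1 < x -> is_derive x 1 F (f x)) ->
  (forall x : R, 0 <= x -> 0 <= f x <= C * expR (- x)) ->
  exists l, F x @[x --> +oo] --> l /\
    (\int[mu]_(x in `[0%R, +oo[) (f x)%:E)%E = l%:E.
Proof.
move=> cf F0 dF fC.
have lt1 (x : R) : 0 <= x -> -1 < x by apply: lt_le_trans; rewrite ltrN10.
have Fc (x : R) : 0 <= x -> {for x, continuous F}.
  by move=> x0; apply: is_derive_continuous (dF _ _); exact: lt1.
have Fnd (x y : R) : 0 <= x -> x <= y -> F x <= F y.
  move=> x0 xy; apply: (@ge0_derive_le F f) => // z /andP[xz zy].
  - by apply/dF/lt1; rewrite (le_trans x0)// ltW.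
  - by apply: Fc; rewrite (le_trans x0).
  - by have /andP[] := fC z (le_trans x0 (ltW xz)).
have Fub (x : R) : 0 <= x -> F x <= C.
  move=> x0; have C0 : 0 <= C.
    by have /andP[f0 fC0] := fC 0 (lexx _); move: (le_trans f0 fC0); rewrite oppr0 expR0 mulr1.
  pose G (y : R) := C * (1 - expR (- y)) - F y.
  have dG (y : R) : 0 <= y -> is_derive y 1 G (C * expR (- y) - f y).
    move=> y0; apply: is_deriveB (dF _ (lt1 _ y0)); apply: is_derive_scale.
    have := is_deriveB (is_derive_cst (1 : R) y (1 : R)) (is_derive_expN y).
    by rewrite sub0r opprK.
  have : G 0 <= G x.
    apply: (@ge0_derive_le G (fun y => C * expR (- y) - f y)) => // z /andP[xz zy].
    - by apply: dG; rewrite ltW.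
    - by apply: is_derive_continuous (dG _ _).
    - by rewrite subr_ge0; have /andP[] := fC z (ltW xz).
  rewrite /G oppr0 expR0 subrr mulr0 F0 subr0 subr_ge0 => /le_trans; apply.
  by rewrite ler_piMr// gerBl expR_ge0.
pose H (x : R) := F (Num.max x 0).
have Hl : H x @[x --> +oo] --> sup (range H).
  apply: nondecreasing_cvgr => [x y xy|].
    apply: Fnd; first by rewrite le_max lexx orbT.
    by rewrite ge_max !le_max xy lexx orbT.
  by exists C => _ [x _ <-]; apply: Fub; rewrite le_max lexx orbT.
have Fl : F x @[x --> +oo] --> sup (range H).
  apply: cvg_trans Hl; apply: near_eq_cvg; near=> x.
  rewrite /H max_l//; near: x; exact: nbhs_pinfty_ge.
exists (sup (range H)); split => //.
rewrite (@ge0_continuous_FTC2y R f F 0 (sup (range H))) ?F0 ?sube0//.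
- by move=> x x0; have /andP[] := fC x x0.
- exact: continuous_subspaceT.
- by move=> x x0; have dFx := dF x (lt1 _ (ltW x0)); exact: ex_derive.
- have := Fc 0 (lexx 0); rewrite /prop_for /continuous_at F0 => Fc0.
  exact: cvg_at_right_filter Fc0.
- move=> x; rewrite in_itv/= andbT => x0; rewrite derive1E.
  by have dFx := dF x (lt1 _ (ltW x0)); exact: derive_val.
Unshelve. all: by end_near. Qed.
End Calculus.

(** * The Dickman function *)

Section Dickman.
Context {R : realType} (rho : R -> R) (hrho : is_dickman_function rho).
(** The Dickman function, made constant to the left of 1: it is continuous on the
    whole line, and the point 0 needs no separate treatment. *)
Definition dickman_ext (x : R) : R := if x <= 1 then 1 else rho x.
Local Notation r := dickman_ext.
Lemma dickman_extE (x : R) : 0 < x -> r x = rho x.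
Proof.
move=> x0; rewrite /r; case: ifP => // x1.
by have [_ -> //] := hrho; rewrite x0 x1.
Qed.
Lemma dickman_ext1 (x : R) : x <= 1 -> r x = 1.
Proof. by rewrite /r => ->. Qed.
Lemma continuous_dickman_ext : continuous r.
Proof.
move=> x; have [x1|x1] := ltP x 1.
  rewrite /prop_for /continuous_at dickman_ext1 ?ltW//.
  apply: cvg_near_cst; near=> y; apply: dickman_ext1.
  by apply: ltW; near: y; exact: lt_nbhsl.
have [crho _ _] := hrho; have x0 : 0 < x by exact: lt_le_trans x1.
have /crho : x \in `]0, +oo[ by rewrite in_itv/= x0.
rewrite /prop_for /continuous_at -dickman_extE//; apply: cvg_trans; apply: near_eq_cvg; near=> y.
apply/esym/dickman_extE; near: y; exact: lt_nbhsr.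
Unshelve. all: by end_near. Qed.
Lemma derive_dickman_ext (x : R) : 1 < x -> is_derive x 1 r (- r (x - 1) / x).
Proof.
move=> x1; have [_ _ /(_ x x1)[drho E]] := hrho.
have x0 : 0 < x by exact: lt_trans x1.
have nr : \forall y \near x, rho y = r y.
  by near=> y; apply/esym/dickman_extE; near: y; exact: lt_nbhsr.
apply: (near_eq_is_derive nr).
apply: DeriveDef => //; rewrite -derive1E dickman_extE ?subr_gt0//.
move: E => /eqP; rewrite addr_eq0 => /eqP <-.
by rewrite mulrC mulKf// gt_eqF.
Unshelve. all: by end_near. Qed.
(** For x >= 1, x r(x) is the integral of r over [x - 1, x], since both sides equal
    1 at x = 1 and have the same derivative; the mean value theorem then gives c. *)
Lemma dickman_ext_mean (x : R) : 1 <= x ->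
  exists2 c, x - 1 < c < x & x * r x = r c.
Proof.
have [F [F0 dF]] := derive_primitive continuous_dickman_ext.
have step (y : R) : 0 <= y -> exists2 c, y < c < y + 1 & F (y + 1) - F y = r c.
  move=> y0; have [||c cy E] := @mean_value_derive R F r y (y + 1).
  - by rewrite ltrDl.
  - by move=> z /andP[yz _]; apply: dF; apply: lt_le_trans (le_trans y0 yz); rewrite ltrN10.
  - by exists c => //; rewrite E addrAC subrr add0r mulr1.
suff H (y : R) : 1 <= y -> y * r y = F y - F (y - 1).
  move=> x1; have := step (x - 1); rewrite subrK subr_ge0 => /(_ x1)[c xc E].
  by exists c => //; rewrite H.
rewrite le_eqVlt => /predU1P[<-|y1].
  rewrite mul1r subrr dickman_ext1//.
  have := step 0 (lexx _); rewrite add0r => -[c /andP[_ c1] ->].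
  by rewrite dickman_ext1// ltW.
(* D is constant on [1, y]. *)
pose D (z : R) : R := z * r z - (F z - F (z - 1)).
have dcF (z : R) : 1 <= z -> is_derive z 1 (fun z : R => F z - F (z - 1)) (r z - r (z - 1)).
  move=> z1; apply: is_deriveB.
    by apply: dF; apply: lt_le_trans z1; lra.
  by apply: is_derive_subl; apply: dF; lra.
have [|z|z|c /andP[c1 cy]] := @mean_value R D (fun=> 0) 1 y => //.
- move=> /andP[z1 zy].
  have := is_deriveB (is_derive_mul (is_derive_id z (1 : R)) (derive_dickman_ext z1)) (dcF z (ltW z1)).
  have -> // : 1 * r z + z * (- r (z - 1) / z) - (r z - r (z - 1)) = 0.
  by rewrite mulrCA divff ?gt_eqF ?(lt_trans _ z1)//; lra.
- move=> /andP[z1 zy].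
  have cr : {for z, continuous (fun w : R => w * r w)}.
    by apply: (@continuousM _ _ id r) => //; exact: continuous_dickman_ext.
  exact: (continuousB cr (is_derive_continuous (dcF z z1))).
rewrite mul0r => /eqP; rewrite subr_eq0 => /eqP.
rewrite /D/= (_ : 1 - 1 = 0) ?mul1r ?(dickman_ext1 (lexx 1))//; last exact: subrr.
have := step 0 (lexx _); rewrite add0r => -[d /andP[_ d1] ->].
rewrite (dickman_ext1 (ltW d1)) subrr => /eqP; by rewrite subr_eq0 => /eqP.
Qed.
(** The equation x r'(x) = - r(x - 1) turns positivity up to n into strict decrease
    on the next unit interval. *)
Lemma dickman_ext_decr_on (n : nat) : (0 < n)%N ->
  (forall x : R, x <= n%:R -> 0 < r x) ->
  forall x y : R, n%:R <= x -> x < y -> y <= n.+1%:R -> r y < r x.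
Proof.
move=> n0 rpos x y nx xy yn.
have n1 : 1 <= n%:R :> R by rewrite ler1n.
have [z|z|c /andP[xc cy] E] := @mean_value R r (fun x => - r (x - 1) / x) x y xy => //.
- move=> /andP[xz zy]; apply: derive_dickman_ext.
  by rewrite (le_lt_trans _ xz)// (le_trans n1).
- by move=> _; exact: continuous_dickman_ext.
rewrite -subr_lt0 E mulNr mulNr oppr_lt0 mulr_gt0 ?subr_gt0// divr_gt0//.
  by apply: rpos; move: yn; rewrite -natr1; lra.
by lra.
Qed.
(** Induction over unit intervals. On [n, n + 1] one has x r(x) = r(c) with
    c < x; either c <= n, or r(x) < r(c) = x r(x), which forces r(x) > 0. *)
Lemma dickman_ext_gt0 (x : R) : 0 < r x.
Proof.
suff H n : forall x : R, x <= n%:R -> 0 < r x.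
  have [x0|x0] := leP x 0; first by apply: (H 0%N).
  by apply: (H (Num.bound x)); rewrite ltW// archi_boundP// ltW.
elim: n => [|[|n] IH] y yn.
- by rewrite dickman_ext1// (le_trans yn).
- by rewrite dickman_ext1.
have [/IH//|ny] := leP y n.+1%:R.
have y1 : 1 < y by apply: le_lt_trans ny; rewrite ler1n.
have y0 : 0 < y by rewrite (lt_trans _ y1).
have [c /andP[yc cy] E] := dickman_ext_mean (ltW y1).
rewrite -(pmulr_rgt0 _ y0) E; have [/IH//|nc] := leP c n.+1%:R.
have := dickman_ext_decr_on (isT : (0 < n.+1)%N) IH (ltW nc) cy yn.
by rewrite -E; nra.
Qed.
Lemma dickman_ext_le (x y : R) : x <= y -> r y <= r x.
Proof.
have H (a b : R) : 1 <= a -> a < b -> r b <= r a.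
  move=> a1 ab; rewrite -subr_le0.
  have [z|z|c /andP[ac cb] ->] := @mean_value R r (fun x => - r (x - 1) / x) a b ab => //.
  - by move=> /andP[az zb]; apply: derive_dickman_ext; rewrite (le_lt_trans a1).
  - by move=> _; exact: continuous_dickman_ext.
  rewrite mulNr mulNr oppr_le0 mulr_ge0 ?subr_ge0 ?ltW// divr_gt0 ?dickman_ext_gt0//.
  by rewrite (lt_trans _ ac)// (lt_le_trans _ a1).
rewrite le_eqVlt => /predU1P[->//|xy].
have [x1|x1] := leP 1 x; first exact: H.
rewrite (dickman_ext1 (ltW x1)); have [y1|y1] := leP y 1; first by rewrite dickman_ext1.
by rewrite -(dickman_ext1 (lexx 1)) H.
Qed.
Lemma dickman_ext_le1 (x : R) : r x <= 1.
Proof.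
have [x1|x1] := leP x 1; first by rewrite dickman_ext1.
by rewrite -(dickman_ext1 (lexx 1)) dickman_ext_le// ltW.
Qed.
Lemma dickman_ext_pred (x : R) : 1 <= x -> x * r x <= r (x - 1).
Proof.
move=> x1; have [c /andP[xc cx] ->] := dickman_ext_mean x1.
by apply: dickman_ext_le; exact: ltW.
Qed.
(** Past M = exp 2, each unit step divides r by at least exp 2. The rate 2 leaves
    a factor exp (- x) to spare in Laplace integrals of parameter above -1. *)
Lemma dickman_ext_decay : exists2 C : R, 1 <= C &
  forall x : R, r x <= C * expR (- (2 * x)).
Proof.
set M := expR (2 : R); have M1 : 1 < M by rewrite expR_gt1.
exists (expR (2 * M)); first by rewrite ltW// expR_gt1 mulr_gt0// (lt_trans _ M1).
suff H n : forall x : R, x <= M + n%:R -> r x <= expR (2 * M) * expR (- (2 * x)).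
  move=> x; apply: (H (Num.bound x)); have [x0|x0] := leP x 0.
    by rewrite (le_trans x0)// addr_ge0// ltW// (lt_trans _ M1).
  by rewrite ltW// (lt_trans (archi_boundP (ltW x0)))// ltrDr (lt_trans _ M1).
elim: n => [|n IH] x xn.
  apply: le_trans (dickman_ext_le1 x) _; rewrite -expRD -[leLHS]expR0 ler_expR.
  by move: xn; rewrite addr0; lra.
have [xM|Mx] := leP x M; first by apply: IH; rewrite (le_trans xM)// lerDl.
have x1 : 1 < x by exact: lt_trans Mx.
have x0 : 0 < x by rewrite (lt_trans _ x1).
rewrite -(ler_pM2l x0); apply: le_trans (dickman_ext_pred (ltW x1)) _.
apply: le_trans (IH (x - 1) _) _; first by move: xn; rewrite -natr1; lra.
rewrite mulrCA ler_pM2l ?expR_gt0//.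
rewrite (_ : - (2 * (x - 1)) = 2 + - (2 * x)); last by lra.
by rewrite expRD ler_pM2r ?expR_gt0// ltW.
Qed.
End Dickman.

(** * The entire exponential integral *)

Section Ein.
Context {R : realType}.
(** The integrand (1 - exp (- x)) / x of the entire exponential integral, its
    removable singularity at 0 filled in. *)
Definition ein_deriv (x : R) : R := if x == 0 then 1 else (1 - expR (- x)) / x.
Lemma ein_derivM (x : R) : x * ein_deriv x = 1 - expR (- x).
Proof.
rewrite /ein_deriv; case: eqP => [->|/eqP x0]; first by rewrite mul0r oppr0 expR0 subrr.
by rewrite mulrCA divff// mulr1.
Qed.
(** At 0 this is the continuous difference quotient of Caratheodory's criterion,
    applied to 1 - exp (- x). *)
Lemma continuous_ein_deriv : continuous ein_deriv.
Proof.
move=> x; have [->|x0] := eqVneq x 0.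
  have d0 : is_derive (0 : R) 1 (fun y : R => 1 - expR (- y)) 1.
    have := is_deriveB (is_derive_cst (1 : R) (0 : R) (1 : R)) (is_derive_expN 0).
    by rewrite sub0r opprK oppr0 expR0.
  have /is_derive1_caratheodory[g [gE cg g0]] := d0.
  suff -> : ein_deriv = g by [].
  apply/funext => y; rewrite /ein_deriv; case: eqP => [->//|/eqP y0].
  have := gE y; rewrite oppr0 expR0 subrr !subr0 => ->.
  by rewrite addr0 mulfK.
have cq : {for x, continuous (fun y : R => (1 - expR (- y)) / y)}.
  apply: (@continuousM _ _ (fun y : R => 1 - expR (- y)) (fun y : R => y^-1)).
    apply: is_derive_continuous (- - expR (- x)) _.
    have := is_deriveB (is_derive_cst (1 : R) x (1 : R)) (is_derive_expN x).
    by rewrite sub0r.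
  exact: inv_continuous.
rewrite /prop_for /continuous_at {2}/ein_deriv (negbTE x0).
have nx : \forall y \near x, y != 0.
  by apply: open_nbhs_nbhs; split; [exact: open_neq|exact: x0].
apply: cvg_trans cq; apply: near_eq_cvg; near=> y.
rewrite /ein_deriv ifF//; apply/negbTE; near: y; exact: nx.
Unshelve. all: by end_near. Qed.
Lemma ein_deriv_ge0 (x : R) : 0 <= x -> 0 <= ein_deriv x.
Proof.
rewrite /ein_deriv; case: eqP => // _ x0; rewrite divr_ge0// subr_ge0.
by rewrite expR_le1 oppr_le0.
Qed.
(** These are the slopes of the chords from 0 of the concave function
    1 - exp (- x). *)
Lemma ein_deriv_le (x y : R) : 0 <= x -> x <= y -> ein_deriv y <= ein_deriv x.
Proof.
have H1 (z : R) : 0 < z -> ein_deriv z <= 1.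
  move=> z0; rewrite -(ler_pM2l z0) ein_derivM mulr1.
  by have := expR_ge1Dx (- z); lra.
rewrite le_eqVlt => /predU1P[<-|x0].
  rewrite le_eqVlt => /predU1P[<-//|/H1 /le_trans]; apply.
  by rewrite /ein_deriv eqxx.
move=> xy; pose f (z : R) : R := ein_deriv x * z - (1 - expR (- z)).
suff : f x <= f y.
  have y0 := lt_le_trans x0 xy.
  by rewrite /f -!ein_derivM mulrC subrr subr_ge0 mulrC ler_pM2r.
have df (z : R) : is_derive z 1 f (ein_deriv x - expR (- z)).
  have := is_deriveB (is_derive_scale (ein_deriv x) (is_derive_id z (1 : R)))
    (is_deriveB (is_derive_cst (1 : R) z (1 : R)) (is_derive_expN z)).
  by rewrite mulr1 sub0r opprK.
apply: (@ge0_derive_le R f (fun z => ein_deriv x - expR (- z))) => // z.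
  by move=> _; exact: is_derive_continuous (df z).
move=> /andP[xz zy]; rewrite subr_ge0.
apply: (@le_trans _ _ (expR (- x))); first by rewrite ler_expR lerN2 ltW.
rewrite -(ler_pM2l x0) ein_derivM lerBrDr -{2}[expR _]mul1r -mulrDl.
by rewrite -[leRHS](expRxMexpNx_1 x) ler_pM2r ?expR_gt0// addrC expR_ge1Dx.
Qed.
(** The entire exponential integral Ein. *)
Definition ein : R -> R := sval (cid (derive_primitive continuous_ein_deriv)).
Lemma ein0 : ein 0 = 0.
Proof. by rewrite /ein; case: cid => ? []. Qed.
Lemma derive_ein (x : R) : -1 < x -> is_derive x 1 ein (ein_deriv x).
Proof. by rewrite /ein; case: cid => f /= [? ]; exact. Qed.
End Ein.

(** * The Laplace transform of the Dickman function *)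

Section Laplace.
Context {R : realType} (rho : R -> R) (hrho : is_dickman_function rho).
Local Notation mu := (@lebesgue_measure R).
Local Notation r := (dickman_ext rho).
Definition dickman_laplace (l : R) : R :=
  (\int[mu]_(x in `[0%R, +oo[) (expR (- l * x) * r x))%R.
Let cr : continuous r := continuous_dickman_ext hrho.
Lemma continuous_laplace_integrand (l : R) : continuous (fun x : R => expR (- l * x) * r x).
Proof.
move=> x; apply: (@continuousM _ _ (fun x : R => expR (- l * x)) r); last exact: cr.
exact: is_derive_continuous (is_derive_expM x (- l)).
Qed.
Lemma continuous_laplace_integrand1 (l : R) :
  continuous (fun x : R => x * (expR (- l * x) * r x)).
Proof.
move=> x; apply: (@continuousM _ _ id (fun x : R => expR (- l * x) * r x)) => //.
exact: continuous_laplace_integrand.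
Qed.
(** Parameters down to -1 are allowed so that the transform is differentiable at
    the parameter 0 itself. The second bound serves the derivative. *)
Lemma laplace_integrand_decay : exists2 C : R, 0 < C &
  forall l x : R, -1 < l -> 0 <= x ->
    0 <= expR (- l * x) * r x <= C * expR (- x) /\
    0 <= x * (expR (- l * x) * r x) <= C * expR (- x).
Proof.
have [C C1 rC] := dickman_ext_decay hrho.
have C0 : 0 < C by exact: lt_le_trans C1.
have e2 : 1 < expR (2 : R) by rewrite expR_gt1.
exists (C * expR 2) => [|l x l1 x0]; first by rewrite mulr_gt0 ?expR_gt0.
have r0 := ltW (dickman_ext_gt0 hrho x).
have e0 := expR_ge0 (- l * x).
have E1 : expR (- l * x) * expR (- (2 * x)) <= expR (- x).
  by rewrite -expRD ler_expR; nra.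
have xr : x * r x <= C * expR 2 * expR (- (2 * x)).
  rewrite -mulrA -expRD; have [x1|x1] := leP x 1.
    rewrite dickman_ext1// mulr1 (le_trans x1)// -[leLHS]mulr1.
    by rewrite ler_pM ?ler01// -[leLHS]expR0 ler_expR; lra.
  apply: le_trans (dickman_ext_pred hrho (ltW x1)) _.
  by apply: le_trans (rC _) _; rewrite ler_wpM2l ?(ltW C0)// ler_expR; lra.
split; apply/andP; split; rewrite ?mulr_ge0//.
  apply: (@le_trans _ _ (expR (- l * x) * (C * expR 2 * expR (- (2 * x))))).
    rewrite ler_wpM2l// (le_trans (rC x))// ler_wpM2r ?expR_ge0//.
    by rewrite ler_peMr ?ltW.
  by rewrite mulrCA ler_wpM2l// mulr_ge0 ?expR_ge0// ltW.
rewrite mulrCA; apply: le_trans (ler_wpM2l e0 xr) _.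
by rewrite mulrCA ler_wpM2l// mulr_ge0 ?expR_ge0// ltW.
Qed.
(** The transform both as a Lebesgue integral and as the limit of a primitive, the
    form in which it is computed. *)
Lemma laplaceP (l : R) : -1 < l -> exists F : R -> R,
  [/\ F 0 = 0, forall x : R, -1 < x -> is_derive x 1 F (expR (- l * x) * r x),
   F x @[x --> +oo] --> dickman_laplace l &
   (\int[mu]_(x in `[0%R, +oo[) (expR (- l * x) * r x)%:E)%E = (dickman_laplace l)%:E].
Proof.
move=> l1; have [C C0 decay] := laplace_integrand_decay.
have [F [F0 dF]] := derive_primitive (@continuous_laplace_integrand l).
have [L [FL IL]] := exp_decay_integral (@continuous_laplace_integrand l) F0 dF
  (fun x x0 => (decay l x l1 x0).1).
have LE : dickman_laplace l = L by rewrite /dickman_laplace /Rintegral IL.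
by exists F; rewrite LE.
Qed.
Let laplace_moment (l : R) : R :=
  (\int[mu]_(x in `[0%R, +oo[) (x * (expR (- l * x) * r x)))%R.
Let laplace_momentP (l : R) : -1 < l -> exists F : R -> R,
  [/\ F 0 = 0, forall x : R, -1 < x -> is_derive x 1 F (x * (expR (- l * x) * r x)),
   F x @[x --> +oo] --> laplace_moment l &
   (\int[mu]_(x in `[0%R, +oo[) (x * (expR (- l * x) * r x))%:E)%E = (laplace_moment l)%:E].
Proof.
move=> l1; have [C C0 decay] := laplace_integrand_decay.
have [F [F0 dF]] := derive_primitive (@continuous_laplace_integrand1 l).
have [L [FL IL]] := exp_decay_integral (@continuous_laplace_integrand1 l) F0 dF
  (fun x x0 => (decay l x l1 x0).2).
have LE : laplace_moment l = L by rewrite /laplace_moment /Rintegral IL.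
by exists F; rewrite LE.
Qed.
(** The equation x r'(x) = - r(x - 1), after integration by parts and the shift
    of x by 1. The identity is proved for primitives on [0, x] by comparing
    derivatives, on [0, 1] where r = 1 and then on [1, x], before x tends to +oo. *)
Let laplace_momentE (l : R) : -1 < l ->
  l * laplace_moment l = dickman_laplace l * (1 - expR (- l)).
Proof.
move=> l1; have [F [F0 dF FL _]] := laplaceP l1.
have [Q [Q0 dQ QL _]] := laplace_momentP l1.
have [C C0 decay] := laplace_integrand_decay.
pose E (x : R) : R := expR (- l * x) * r x.
pose D0 (x : R) : R := l * Q x - F x + x * expR (- l * x).
(* On [0, 1], where r = 1, the primitives satisfy a simpler relation. *)
have D01 : D0 1 = 0.
  have dD0 (x : R) : 0 <= x <= 1 -> is_derive x 1 D0 0.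
    move=> /andP[x0 x1]; have x1' : -1 < x by exact: lt_le_trans x0.
    have := is_deriveD (is_deriveB (is_derive_scale l (dQ x x1')) (dF x x1'))
      (is_derive_mul (is_derive_id x (1 : R)) (is_derive_expM x (- l))).
    by rewrite dickman_ext1//; congr is_derive; ring.
  have [c _] := mean_value_derive ltr01 dD0.
  by rewrite mul0r [D0 0]/D0 Q0 F0 mulr0 mul0r subrr addr0 subr0.
have key (x : R) : 1 <= x -> l * Q x = F x - expR (- l) * F (x - 1) - x * E x.
  move=> x1; suff : l * Q x - F x + expR (- l) * F (x - 1) + x * E x = 0 by lra.
  pose D (y : R) : R := l * Q y - F y + expR (- l) * F (y - 1) + y * E y.
  have D1 : D 1 = 0.
    have -> : D 1 = D0 1 + expR (- l) * F (1 - 1).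
      by rewrite /D /D0 /E dickman_ext1//; ring.
    by rewrite D01 (_ : 1 - 1 = 0) ?F0 ?mulr0 ?addr0//; exact: subrr.
  move: x1; rewrite le_eqVlt => /predU1P[<-//|x1].
  have d1 (y : R) : 1 <= y ->
      is_derive y 1 (fun y : R => l * Q y - F y + expR (- l) * F (y - 1))
        (l * (y * E y) - E y + expR (- l) * E (y - 1)).
    move=> y1; have y1' : -1 < y by apply: lt_le_trans y1; lra.
    have y2 : -1 < y - 1 by lra.
    exact: (is_deriveD (is_deriveB (is_derive_scale l (dQ y y1')) (dF y y1'))
      (is_derive_scale (expR (- l)) (is_derive_subl (dF (y - 1) y2)))).
  have [//|y|y|c _] := @mean_value R D (fun=> 0) 1 x.
  - move=> /andP[y1 _].
    have := is_deriveD (d1 y (ltW y1)) (is_derive_mul (is_derive_id y (1 : R))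
      (is_derive_mul (is_derive_expM y (- l)) (derive_dickman_ext hrho y1))).
    congr is_derive; rewrite /E.
    rewrite (_ : - l * (y - 1) = l + - l * y); last by ring.
    rewrite expRD expRN; field.
    by have y0 : 0 < y by [lra]; rewrite ?(gt_eqF y0) ?gt_eqF ?expR_gt0.
  - move=> /andP[y1 _]; apply: (continuousD (is_derive_continuous (d1 y y1))).
    exact: continuous_laplace_integrand1.
  - by rewrite mul0r D1 subr0.
have xE0 : x * E x @[x --> +oo] --> (0 : R).
  have b0 : C * expR (- x) @[x --> +oo] --> (0 : R).
    by rewrite -[X in _ --> X](mulr0 C); apply: cvgMr; exact: cvgr_expR.
  apply: (@squeeze_cvgr _ _ _ _ (fun=> 0) (fun x : R => C * expR (- x))) => //.
    near=> x; apply: (decay l x l1 _).2; near: x; exact: nbhs_pinfty_ge.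
  exact: cvg_cst.
have F1 : F (x - 1) @[x --> +oo] --> dickman_laplace l.
  exact: cvg_comp (cvg_addrr (-1)) FL.
have R1 : F x - expR (- l) * F (x - 1) - x * E x @[x --> +oo] -->
    dickman_laplace l - expR (- l) * dickman_laplace l - 0.
  by apply: cvgB => //; apply: cvgB => //; exact: cvgMr.
have R2 : F x - expR (- l) * F (x - 1) - x * E x @[x --> +oo] --> l * laplace_moment l.
  apply: (@cvg_trans _ (l * Q x @[x --> +oo])); last exact: cvgMr.
  apply: near_eq_cvg; near=> x; rewrite key//; near: x; exact: nbhs_pinfty_ge.
have := cvg_unique _ R1 R2 => <- //; ring.
Unshelve. all: by end_near. Qed.
(** Differentiation under the integral sign, dominated by C exp (- x). *)
Let derive_laplace (l : R) : -1 < l -> is_derive l 1 dickman_laplace (- laplace_moment l).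
Proof.
move=> l1; have [C C0 decay] := laplace_integrand_decay.
pose f (m x : R) : R := expR (- m * x) * r x.
have df (m x : R) : is_derive m 1 (f ^~ x) (- (x * f m x)).
  have := is_derive_mul (is_derive_expM m (- x)) (is_derive_cst (r x) m (1 : R)).
  rewrite mulr0 addr0 /f (_ : (fun y => _) = (fun m => expR (- m * x) * r x)).
    by congr is_derive; rewrite /f /cst (_ : - x * m = - m * x); ring.
  by apply/funext => y; rewrite (_ : - x * y = - y * x)//; ring.
have d1f (m x : R) : partial1of2 f m x = - (x * f m x).
  by rewrite /partial1of2 derive1E; have dfmx := df m x; exact: derive_val.
pose u := (l - 1) / 2.
have u1 : -1 < u by rewrite /u; lra.
have Il : `]u, (l + 1)[%classic l by rewrite /= in_itv/= /u; lra.
have fint (m : R) : `]u, (l + 1)[%classic m ->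
    mu.-integrable `[0%R, +oo[ (EFin \o f m).
  rewrite /= in_itv/= => /andP[um _]; have m1 : -1 < m by exact: lt_trans um.
  have [F [_ _ _ Fint]] := laplaceP m1.
  apply/integrableP; split.
    apply/measurable_EFinP; apply: measurable_funTS.
    exact: continuous_measurable_fun (@continuous_laplace_integrand m).
  under eq_integral => x /[!inE]/= /[!in_itv]/= /andP[x0 _].
    rewrite ger0_norm; last by rewrite mulr_ge0 ?expR_ge0 ?ltW ?dickman_ext_gt0.
    over.
  by rewrite Fint ltry.
have derf (m x : R) : `]u, (l + 1)[%classic m -> `[0%R, +oo[%classic x ->
    derivable (f ^~ x) m 1.
  by move=> _ _; have dfmx := df m x; exact: ex_derive.
pose G (x : R) : R := C * expR (- x).
have G0 x : 0 <= G x by rewrite mulr_ge0 ?expR_ge0 ?ltW.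
have Gint : mu.-integrable `[0%R, +oo[ (EFin \o G).
  have cG : continuous G.
    move=> x; exact: is_derive_continuous (is_derive_scale C (is_derive_expN x)).
  have [F [F0 dF]] := derive_primitive cG.
  have [x x0|L [_ Gint]] := exp_decay_integral (C := C) cG F0 dF.
    by rewrite G0/=.
  apply/integrableP; split.
    by apply/measurable_EFinP; apply: measurable_funTS; exact: continuous_measurable_fun cG.
  under eq_integral do rewrite /= ger0_norm//.
  by rewrite Gint ltry.
have Gub (m x : R) : `]u, (l + 1)[%classic m -> `[0%R, +oo[%classic x ->
    `|partial1of2 f m x| <= G x.
  rewrite /= !in_itv/= => /andP[um _] /andP[x0 _]; rewrite d1f normrN.
  have [_ /andP[f0 fC]] := decay m x (lt_trans u1 um) x0.
  by rewrite ger0_norm.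
have D1 := @derivable_under_integral R _ _ mu f _ _ l u (l + 1) Il fint derf G G0 Gint Gub.
have D2 := @differentiation_under_integral R _ _ mu f _ _ l u (l + 1) Il fint derf G G0 Gint Gub.
apply: DeriveDef; first by apply: D1.
have -> : 'D_1 dickman_laplace l = derive1 dickman_laplace l by rewrite derive1E.
rewrite [LHS]D2// /laplace_moment -mulN1r -RintegralZl//.
  by apply: eq_Rintegral => x _; rewrite d1f mulN1r.
have [F [_ _ _ Fint]] := laplace_momentP l1.
apply/integrableP; split.
  apply/measurable_EFinP; apply: measurable_funTS.
  exact: continuous_measurable_fun (@continuous_laplace_integrand1 l).
under eq_integral => x /[!inE]/= /[!in_itv]/= /andP[x0 _].
  rewrite (@ger0_norm _ (x * (expR (- l * x) * r x))); last first.
    by rewrite mulr_ge0 ?mulr_ge0 ?expR_ge0 ?(ltW (dickman_ext_gt0 hrho _)).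
  over.
by rewrite Fint ltry.
Qed.
(** By laplace_momentE, the logarithmic derivative of the transform is
    - (1 - exp (- l)) / l = - ein_deriv l. *)
Lemma dickman_laplaceE (l : R) : 0 <= l ->
  dickman_laplace l = dickman_laplace 0 * expR (- ein l).
Proof.
pose K (l : R) : R := dickman_laplace l * expR (ein l).
move=> l0; suff E : K l = K 0.
  by move: E; rewrite /K ein0 expR0 mulr1 => <-; rewrite -mulrA expRxMexpNx_1 mulr1.
move: l0; rewrite le_eqVlt => /predU1P[<-//|l0].
have dK (m : R) : 0 <= m -> is_derive m 1 K (- laplace_moment m * expR (ein m) +
    dickman_laplace m * (ein_deriv m * expR (ein m))).
  move=> m0; have m1 : -1 < m by apply: lt_le_trans m0; rewrite ltrN10.
  exact: is_derive_mul (derive_laplace m1) (is_derive_exp (derive_ein m1)).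
have [//|m|m|c _] := @mean_value R K (fun=> 0) 0 l.
- move=> /andP[m0 _]; have := dK m (ltW m0); congr is_derive.
  have m1 : -1 < m by apply: lt_trans m0; rewrite ltrN10.
  have S := laplace_momentE m1; have e := ein_derivM m.
  apply: (mulfI (lt0r_neq0 m0)); rewrite mulr0 mulrDr.
  rewrite (mulrCA (dickman_laplace m)) (mulrC (ein_deriv m)).
  rewrite !mulrA mulrN S -e; ring.
- by move=> /andP[m0 _]; exact: is_derive_continuous (dK m m0).
- by rewrite mul0r => /eqP; rewrite subr_eq0 => /eqP.
Qed.
(** For a large parameter the integral concentrates near 0, where r = 1: it lies
    between the integrals of exp (- n x) over [0, 1] and over [0, +oo[. *)
Lemma cvg_laplace_oo : n%:R * dickman_laplace n%:R @[n --> \oo] --> (1 : R).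
Proof.
have e0 : 1 - expR (- n%:R) @[n --> \oo] --> (1 : R).
  by rewrite -[X in _ --> X]subr0; apply: cvgB; [exact: cvg_cst|exact: cvgn_expR].
apply: (@squeeze_cvgr _ _ _ _ (fun n : nat => 1 - expR (- n%:R : R)) (fun=> 1)) => //; last exact: cvg_cst.
near=> n; have n0 : 0 < n%:R :> R by rewrite ltr0n; near: n; exact: nbhs_infty_gt.
have n1 : -1 < n%:R :> R by apply: lt_trans n0; rewrite ltrN10.
have [F [F0 dF Fl _]] := laplaceP n1.
(* n times the integral over [0, x] of exp (- n t) (1 - r t). *)
pose H (x : R) : R := 1 - expR (- n%:R * x) - n%:R * F x.
have dH (x : R) : 0 <= x ->
    is_derive x 1 H (n%:R * expR (- n%:R * x) * (1 - r x)).
  move=> x0; have x1 : -1 < x by apply: lt_le_trans x0; rewrite ltrN10.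
  have := is_deriveB (is_deriveB (is_derive_cst (1 : R) x (1 : R))
    (is_derive_expM x (- n%:R))) (is_derive_scale n%:R (dF x x1)).
  by congr is_derive; ring.
have H0 : H 0 = 0 by rewrite /H F0 !mulr0 expR0 subrr subr0.
have H1 : H 1 = 0.
  have [//|x|x|c _] := @mean_value R H (fun=> 0) 0 1.
  - move=> /andP[x0 x1]; have := dH x (ltW x0); rewrite dickman_ext1 ?ltW//.
    by rewrite subrr mulr0.
  - by move=> /andP[x0 _]; exact: is_derive_continuous (dH x x0).
  - by rewrite mul0r H0 subr0.
have Hge (x : R) : 0 <= x -> 0 <= H x.
  move=> x0; rewrite -H0.
  apply: (ge0_derive_le x0 (fun y yy => dH y _)) => y /andP[y0 yx].
  - exact: ltW.
  - exact: is_derive_continuous (dH y y0).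
  - apply: mulr_ge0; first by rewrite mulr_ge0 ?expR_ge0.
    by rewrite subr_ge0 dickman_ext_le1.
have nF : n%:R * F x @[x --> +oo] --> n%:R * dickman_laplace n%:R by exact: cvgMr.
apply/andP; split; last first.
  apply: (cvg_le_cst nF).
  near=> x; have := Hge x; rewrite /H; have := expR_ge0 (- n%:R * x).
  suff x0 : 0 <= x by move=> ? /(_ x0); lra.
  by near: x; exact: nbhs_pinfty_ge.
apply: (cvg_ge_cst nF).
near=> x; have x1 : 1 <= x by near: x; exact: nbhs_pinfty_ge.
have : F 1 <= F x.
  apply: (ge0_derive_le x1 (fun y yy => dF y _)) => y /andP[y0 yx].
  - by lra.
  - by apply: is_derive_continuous (dF y _); lra.
  - by apply: mulr_ge0; [exact: expR_ge0|rewrite ltW ?dickman_ext_gt0].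
rewrite -(ler_pM2l n0); move: H1; rewrite /H mulr1; lra.
Unshelve. all: by end_near. Qed.
End Laplace.

(** * The total mass of the Dickman function *)

Section EulerGamma.
Context {R : realType}.
(** With v = t / n, the upper bound comes from (1 - v) exp v >= 1 - v ^ 2 raised to
    the power n, and from Bernoulli's inequality. *)
Lemma exp_approx (n : nat) (t : R) : (0 < n)%N -> 0 <= t <= n%:R ->
  0 <= expR (- t) - (1 - t / n%:R) ^+ n <= t ^+ 2 / n%:R * expR (- t).
Proof.
move=> n0 /andP[t0 tn]; have nR : 0 < n%:R :> R by rewrite ltr0n.
set v := t / n%:R; have v0 : 0 <= v by rewrite divr_ge0// ltW.
have v1 : v <= 1 by rewrite ler_pdivrMr// mul1r.
have tE : t = n%:R * v by rewrite mulrCA divff ?gt_eqF// mulr1.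
have en : expR (- t) = expR (- v) ^+ n by rewrite tE -mulrN expRM_natl.
apply/andP; split.
  by rewrite subr_ge0 en lerXn2r ?nnegrE ?expR_ge0 ?subr_ge0// expR_ge1Dx.
have H1 : 1 - v ^+ 2 <= (1 - v) * expR v.
  rewrite (_ : 1 - v ^+ 2 = (1 - v) * (1 + v)); last by ring.
  by rewrite ler_wpM2l ?subr_ge0// expR_ge1Dx.
have v21 : v ^+ 2 <= 1 by rewrite expr_le1.
have bern (m : nat) : 1 - m%:R * v ^+ 2 <= (1 - v ^+ 2) ^+ m.
  elim: m => [|m IH]; first by rewrite mul0r subr0 expr0.
  have b0 : 0 <= 1 - v ^+ 2 by rewrite subr_ge0.
  rewrite [leRHS]exprS; apply: (le_trans _ (ler_wpM2l b0 IH)); rewrite -natr1.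
  have : 0 <= m%:R * v ^+ 2 * v ^+ 2 by rewrite !mulr_ge0 ?sqr_ge0.
  by nra.
have H2 : 1 - n%:R * v ^+ 2 <= (1 - v) ^+ n * expR t.
  apply: le_trans (bern n) _; rewrite tE expRM_natl -exprMn lerXn2r//.
    by rewrite nnegrE subr_ge0.
  by rewrite nnegrE mulr_ge0 ?subr_ge0 ?expR_ge0.
have E : t ^+ 2 / n%:R = n%:R * v ^+ 2.
  by rewrite {1}tE; field; rewrite gt_eqF.
have H3 : (1 - n%:R * v ^+ 2) * expR (- t) <= (1 - v) ^+ n.
  by rewrite expRN ler_pdivrMr ?expR_gt0.
by rewrite E; lra.
Qed.
(** The harmonic sum is the integral over [0, n] of (1 - (1 - t / n) ^ n) / t, and
    (1 - t / n) ^ n is close to exp (- t). *)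
Lemma harmonic_ein (n : nat) : (0 < n)%N ->
  0 <= \sum_(1 <= k < n.+1) k%:R^-1 - ein (n%:R : R) <= n%:R^-1.
Proof.
move=> n0; have nR : 0 < n%:R :> R by rewrite ltr0n.
have nn : n%:R != 0 :> R by rewrite gt_eqF.
pose w (t : R) : R := 1 - t / n%:R.
have dw (t : R) (i : nat) : is_derive t 1 (fun t => w t ^+ i.+1)
    (- (i.+1%:R / n%:R * w t ^+ i)).
  have dw1 : is_derive t 1 w (- n%:R^-1).
    have := is_deriveB (is_derive_cst (1 : R) t (1 : R))
      (is_derive_scale n%:R^-1 (is_derive_id t (1 : R))).
    rewrite mulr1 sub0r; congr is_derive; apply/funext => s.
    by rewrite /w mulrC.
  have := is_deriveX i.+1 dw1.
  rewrite /= (_ : w ^+ i.+1 = (fun t => w t ^+ i.+1)); last by apply/funext => s; rewrite exprfctE.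
  by congr is_derive; rewrite /GRing.scale/=; ring.
(* G is the primitive of (1 - w ^ n) / t, expanded as a geometric sum. *)
pose G (t : R) : R := \sum_(i < n) (1 - w t ^+ i.+1) / i.+1%:R.
have G0 : G 0 = 0.
  rewrite /G big1// => i _; rewrite /w mul0r subr0 expr1n subrr mul0r//.
have Gn : G n%:R = \sum_(1 <= k < n.+1) k%:R^-1.
  rewrite big_add1/= big_mkord; apply: eq_bigr => i _.
  by rewrite /w divff// subrr expr0n/= subr0 mul1r.
have dG (t : R) : is_derive t 1 G (n%:R^-1 * \sum_(i < n) w t ^+ i).
  rewrite mulr_sumr /G.
  have := @is_derive_sum _ _ _ n (fun i t => (1 - w t ^+ i.+1) / i.+1%:R) t 1
    (fun i => n%:R^-1 * w t ^+ i).
  rewrite (_ : \sum_(i < n) _ = (fun t => \sum_(i < n) (1 - w t ^+ i.+1) / i.+1%:R)); last first.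
    by apply/funext => s; rewrite fct_sumE.
  apply => i.
  have := is_derive_scale (i.+1%:R^-1) (is_deriveB (is_derive_cst (1 : R) t (1 : R)) (dw t i)).
  rewrite (_ : (fun y => _) = (fun t => (1 - w t ^+ i.+1) / i.+1%:R)); last first.
    by apply/funext => s; rewrite mulrC.
  congr is_derive; rewrite sub0r opprK; field.
  by rewrite nn addrC natr1 pnatr_eq0.
have geom (t : R) : t != 0 -> n%:R^-1 * (\sum_(i < n) w t ^+ i) = (1 - w t ^+ n) / t.
  move=> t0; have := subrX1 (w t) n => E.
  apply: (mulfI t0); rewrite [RHS]mulrC divfK//.
  have -> : 1 - w t ^+ n = (t / n%:R) * \sum_(i < n) w t ^+ i.
    by rewrite -opprB E /w; ring.
  by ring.
have bnd (t : R) : 0 < t < n%:R ->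
    0 <= n%:R^-1 * (\sum_(i < n) w t ^+ i) - ein_deriv t <= t / n%:R * expR (- t).
  move=> /andP[t0 tn]; have tn0 := lt0r_neq0 t0.
  have tn1 : 0 <= t <= n%:R by rewrite !ltW.
  have /andP[H1 H2] := exp_approx n0 tn1.
  have -> : n%:R^-1 * (\sum_(i < n) w t ^+ i) - ein_deriv t =
      (expR (- t) - (1 - t / n%:R) ^+ n) / t.
    by rewrite geom// /ein_deriv (negbTE tn0) -mulrBl /w; congr (_ / _); ring.
  rewrite divr_ge0 ?(ltW t0)//= ler_pdivrMr//.
  by apply: le_trans H2 _; rewrite le_eqVlt; apply/orP; left; apply/eqP; ring.
have d1 (t : R) : 0 <= t -> is_derive t 1 (fun t => G t - ein t)
    (n%:R^-1 * (\sum_(i < n) w t ^+ i) - ein_deriv t).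
  move=> t0; have t1 : -1 < t by apply: lt_le_trans t0; rewrite ltrN10.
  exact: (is_deriveB (dG t) (derive_ein t1)).
(* The integral of s exp (- s) / n over [0, t]. *)
pose U (t : R) : R := n%:R^-1 * (1 - (1 + t) * expR (- t)).
have dU (t : R) : is_derive t 1 U (t / n%:R * expR (- t)).
  have := is_derive_scale n%:R^-1 (is_deriveB (is_derive_cst (1 : R) t (1 : R))
    (is_derive_mul (is_deriveD (is_derive_cst (1 : R) t (1 : R)) (is_derive_id t (1 : R)))
      (is_derive_expN t))).
  by congr is_derive; rewrite /cst/= !fctE; ring.
rewrite -Gn; apply/andP; split.
  have <- : G 0 - ein 0 = 0 by rewrite G0 ein0 subrr.
  apply: (@ge0_derive_le R (fun t => G t - ein t) _ 0 n%:R (ltW nR)) => t /andP[t0 tn].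
  - exact: d1 (ltW t0).
  - exact: is_derive_continuous (d1 t t0).
  - by have := bnd t; rewrite t0 tn => /(_ isT) /andP[].
apply: (@le_trans _ _ (U n%:R)); last first.
  rewrite /U -[leRHS]mulr1 ler_pM2l ?invr_gt0// gerBl mulr_ge0 ?expR_ge0// addr_ge0//.
pose D (t : R) : R := G t - ein t.
pose V (t : R) : R := U t - D t.
have dV (t : R) : 0 <= t -> is_derive t 1 V (t / n%:R * expR (- t) -
    (n%:R^-1 * (\sum_(i < n) w t ^+ i) - ein_deriv t)).
  by move=> t0; exact: is_deriveB (dU t) (d1 t t0).
have V0 : V 0 = 0.
  by rewrite /V /D /U addr0 mul1r oppr0 expR0 subrr mulr0 G0 ein0 subrr subr0.
suff : V 0 <= V n%:R by rewrite V0 /V subr_ge0.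
apply: (ge0_derive_le (ltW nR) (fun t tt => dV t _)) => t /andP[t0 tn].
- exact: ltW.
- exact: is_derive_continuous (dV t t0).
- by rewrite subr_ge0; have := bnd t; rewrite t0 tn => /(_ isT) /andP[].
Qed.
(** Taking logarithms in n R(n) -> 1 with R(n) = R(0) exp (- Ein n) gives
    ln n + ln R(0) - Ein n -> 0. As H_n - Ein n -> 0 too, ln R(0) is the limit of
    H_n - ln n. *)
Lemma dickman_laplace0 (rho : R -> R) : is_dickman_function rho ->
  dickman_laplace rho 0 = expR (euler_gamma R).
Proof.
move=> hrho; set L := dickman_laplace rho.
have c1 := cvg_laplace_oo hrho; rewrite -/L in c1.
have L0 : 0 < L 0.
  rewrite ltNge; apply/negP => L0.
  have : (1 : R) <= 0.
    apply: (cvg_le_cst c1).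
    near=> n; rewrite /L dickman_laplaceE// -/L mulr_ge0_le0//.
    by rewrite mulr_le0_ge0// expR_ge0.
  by rewrite ler10.
have lc : ln (n%:R * L n%:R) @[n --> \oo] --> (0 : R).
  by rewrite -ln1; apply: continuous_cvg => //; exact: continuous_ln.
have Ec : ln n%:R + ln (L 0) - ein n%:R @[n --> \oo] --> (0 : R).
  apply: cvg_trans lc; apply: near_eq_cvg; near=> n.
  have n0 : 0 < n%:R :> R by rewrite ltr0n; near: n; exact: nbhs_infty_gt.
  rewrite {1}/L dickman_laplaceE// -/L lnM ?posrE ?mulr_gt0 ?expR_gt0//.
  by rewrite lnM ?posrE ?expR_gt0// expRK addrA.
have Hc : \sum_(1 <= k < n.+1) k%:R^-1 - ein n%:R @[n --> \oo] --> (0 : R).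
  apply: (@squeeze_cvgr _ _ _ _ (fun=> 0) (fun n : nat => n%:R^-1)) => //.
  - near=> n; apply: harmonic_ein; near: n; exact: nbhs_infty_gt.
  - exact: cvg_cst.
  - apply/gtr0_cvgV0; last exact: cvgr_idn.
    near=> n; rewrite ltr0n; near: n; exact: nbhs_infty_gt.
have gc : \sum_(1 <= k < n.+1) k%:R^-1 - ln n%:R @[n --> \oo] --> ln (L 0).
  have -> : (fun n => \sum_(1 <= k < n.+1) k%:R^-1 - ln n%:R) =
      (fun n => (\sum_(1 <= k < n.+1) k%:R^-1 - ein n%:R) -
        (ln n%:R + ln (L 0) - ein n%:R) + ln (L 0)) :> (nat -> R).
    by apply/funext => n; ring.
  rewrite -[X in _ --> X]add0r -[X in _ --> X + _](subrr (0 : R)).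
  by apply: cvgD (cvg_cst _); exact: cvgB Hc Ec.
by rewrite /euler_gamma (cvg_lim _ gc)// lnK// posrE.
Unshelve. all: by end_near. Qed.
End EulerGamma.

(** * Weierstrass' approximation theorem *)

Section Weierstrass.
Context {R : realType}.
(** The mean of g at a binomial variable of parameters n and t, by conditioning on
    the first trial; as a function of t, a Bernstein polynomial. The recursion
    makes its moments and positivity immediate by induction. *)
Fixpoint binomial_mean (t : R) (n : nat) (g : nat -> R) : R :=
  if n is n'.+1 then
    t * binomial_mean t n' (g \o S) + (1 - t) * binomial_mean t n' g
  else g 0%N.
(** The variance is the case a = - n t; the induction needs every shift a. *)
Lemma binomial_mean_sqr (t a : R) (n : nat) :
  binomial_mean t n (fun k => (k%:R + a) ^+ 2) =
  (n%:R * t + a) ^+ 2 + n%:R * (t * (1 - t)).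
Proof.
elim: n a => [|n IH] a /=; first by ring.
have -> : (fun k => (k%:R + a) ^+ 2) \o S = (fun k => (k%:R + (a + 1)) ^+ 2) :> (nat -> R).
  by apply/funext => k /=; rewrite -natr1; congr (_ ^+ 2); ring.
by rewrite !IH -natr1; ring.
Qed.
Lemma binomial_mean_affine (t a b : R) (n : nat) (g : nat -> R) :
  binomial_mean t n (fun k => a + b * g k) = a + b * binomial_mean t n g.
Proof.
elim: n g => [|n IH] g //=.
by have /= -> := IH (g \o S); rewrite IH; ring.
Qed.
Lemma binomial_mean_le (t : R) (n : nat) (g h : nat -> R) : 0 <= t <= 1 ->
  (forall k, (k <= n)%N -> g k <= h k) ->
  binomial_mean t n g <= binomial_mean t n h.
Proof.
move=> /andP[t0 t1]; elim: n g h => [|n IH] g h gh /=; first exact: gh.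
rewrite lerD// ler_wpM2l ?subr_ge0//; apply: IH => k kn; apply: gh => //.
exact: leqW.
Qed.
Lemma binomial_mean_poly (n : nat) (g : nat -> R) :
  exists p : {poly R}, forall t, p.[t] = binomial_mean t n g.
Proof.
elim: n g => [|n IH] g /=; first by exists (g 0%N)%:P => t; rewrite hornerC.
have [p pE] := IH (g \o S); have [q qE] := IH g.
exists ('X * p + (1 - 'X) * q) => t.
by rewrite !hornerE pE qE.
Qed.
Lemma uniform_continuous01 (h : R -> R) (e : R) : continuous h -> 0 < e ->
  exists2 d : R, 0 < d & forall s t : R, 0 <= s <= 1 -> `|s - t| < d -> `|h s - h t| < e.
Proof.
move=> ch e0.
have /compact_near_coveringP/near_covering_withinP cov := @segment_compact R 0 1.
have : \forall d \near (0 : R)^'+, `[0, 1]%classic `<=`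
    (fun s => forall t, `|s - t| < d -> `|h s - h t| < e).
  apply: cov => x _.
  have /cvgrPdist_lt /(_ (e / 2)) := ch x; rewrite divr_gt0// => /(_ isT).
  move=> /nbhs_ballP[eta /= eta0 H].
  have eta2 : 0 < eta / 2 by rewrite divr_gt0.
  near=> y d => _ t /= yt.
  have xy : `|x - y| < eta / 2.
    by near: y; apply/nbhs_ballP; exists (eta / 2) => // y; rewrite /ball/=.
  have d2 : d < eta / 2.
    by near: d; exact: nbhs_right_lt.
  have h1 : `|h x - h y| < e / 2 by apply: H; rewrite /ball/=; lra.
  have h2 : `|h x - h t| < e / 2.
    apply: H; rewrite /ball/= (_ : x - t = (x - y) + (y - t)); last by ring.
    by apply: le_lt_trans (ler_normD _ _) _; lra.
  rewrite (_ : h y - h t = (h x - h t) - (h x - h y)); last by ring.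
  by apply: le_lt_trans (ler_normB _ _) _; lra.
move=> nd; have : \forall d \near (0 : R)^'+, 0 < d by exact: nbhs_right_gt.
move=> /(filterI nd) /filter_ex[d [sub d0]].
by exists d => // s t s01; apply: sub; rewrite /= in_itv.
Unshelve. all: by end_near. Qed.
(** Bernstein's proof. At a binomial variable k, h (k / n) is within e / 2 of h t
    if k / n is within d of t, and within 2 M ((t - k / n) / d) ^ 2 of it
    otherwise; the mean of the latter is O(1 / n). *)
Lemma weierstrass (h : R -> R) (M e : R) : continuous h -> 0 < e ->
  (forall t : R, 0 <= t <= 1 -> `|h t| <= M) ->
  exists p : {poly R}, forall t : R, 0 <= t <= 1 -> `|h t - p.[t]| <= e.
Proof.
move=> ch e0 hM.
have M0 : 0 <= M by apply: le_trans (hM 0 _); rewrite ?lexx ?ler01.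
have e2 : 0 < e / 2 by rewrite divr_gt0.
have [d d0 ud] := uniform_continuous01 ch e2.
have d20 : 0 < d ^+ 2 by rewrite exprn_gt0.
(* n is large enough for the mean of the quadratic part of G to be at most e / 2. *)
pose n := (Num.bound (4 * M / (d ^+ 2 * e))).+1.
have nR : 0 < n%:R :> R by rewrite ltr0n.
have nb : 4 * M / (d ^+ 2 * e) <= n%:R.
  apply: ltW; apply: lt_le_trans (archi_boundP _) _; last by rewrite ler_nat.
  by apply: divr_ge0; apply: mulr_ge0 => //; exact: ltW.
have [p pE] := binomial_mean_poly n (fun k => h (k%:R / n%:R)).
exists p => t t01; rewrite pE.
have /andP[t0 t1] := t01.
pose G (k : nat) : R := e / 2 + 2 * M / d ^+ 2 * ((n%:R ^+ 2)^-1 * (k%:R + - (n%:R * t)) ^+ 2).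
have hG k : (k <= n)%N -> `|h t - h (k%:R / n%:R)| <= G k.
  move=> kn; have k01 : 0 <= (k%:R / n%:R : R) <= 1.
    by rewrite divr_ge0 ?(ltW nR)//= ler_pdivrMr// mul1r ler_nat.
  have E : (n%:R ^+ 2)^-1 * (k%:R + - (n%:R * t)) ^+ 2 = (t - k%:R / n%:R) ^+ 2.
    by field; rewrite gt_eqF.
  rewrite /G E; have [lt|ge] := ltP `|t - k%:R / n%:R| d.
    apply: le_trans (ltW (ud _ _ t01 lt)) _.
    rewrite lerDl; apply: mulr_ge0; last exact: sqr_ge0.
    by apply: divr_ge0; [exact: mulr_ge0|exact: ltW].
  apply: (@le_trans _ _ (2 * M)).
    by apply: le_trans (ler_normB _ _) _; have := hM _ t01; have := hM _ k01; lra.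
  apply: (@le_trans _ _ (2 * M / d ^+ 2 * (t - k%:R / n%:R) ^+ 2)); last by rewrite lerDr ltW.
  rewrite mulrAC ler_pdivlMr// ler_wpM2l ?mulr_ge0//.
  by rewrite -[leRHS]real_normK ?num_real// lerXn2r ?nnegrE ?(ltW d0).
have GE : binomial_mean t n G = e / 2 + 2 * M / d ^+ 2 * (n%:R^-1 * (t * (1 - t))).
  rewrite /G binomial_mean_affine; congr (_ + _ * _).
  have := binomial_mean_affine t 0 (n%:R ^+ 2)^-1 n (fun k => (k%:R + - (n%:R * t)) ^+ 2).
  under eq_fun do rewrite add0r.
  by move=> ->; rewrite binomial_mean_sqr; field; rewrite gt_eqF.
have Ge : binomial_mean t n G <= e.
  rewrite GE; have t14 : t * (1 - t) <= 1 by nra.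
  have : 2 * M / d ^+ 2 * (n%:R^-1 * (t * (1 - t))) <= 2 * M / d ^+ 2 * n%:R^-1.
    apply: ler_wpM2l; first by apply: divr_ge0; [exact: mulr_ge0|exact: ltW].
    by rewrite ler_piMr// invr_ge0 ltW.
  have : 2 * M / d ^+ 2 * n%:R^-1 <= e / 2.
    rewrite ler_pdivrMr//; move: nb.
    rewrite ler_pdivrMr ?mulr_gt0// ler_pdivrMr//; lra.
  by lra.
rewrite ler_norml; apply/andP; split.
  suff : binomial_mean t n (fun k => h (k%:R / n%:R)) <= h t + binomial_mean t n G by lra.
  have := binomial_mean_affine t (h t) 1 n G; rewrite mul1r => <-.
  apply: binomial_mean_le => // k kn; have := hG k kn; rewrite ler_norml; lra.
suff : h t + -1 * binomial_mean t n G <= binomial_mean t n (fun k => h (k%:R / n%:R)) by lra.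
rewrite -binomial_mean_affine; apply: binomial_mean_le => // k kn.
by have := hG k kn; rewrite ler_norml; lra.
Qed.
End Weierstrass.

(** * Weak limits from Laplace transforms at the integers *)

Section Functional.
Context {R : realType}.
Definition bounded_continuous (f : R -> R) : Prop :=
  continuous f /\ exists M : R, forall x, `|f x| <= M.
(** What remains of the expectation of a nonnegative random variable when it is
    seen as a functional on test functions. The discrete laws and their limit live
    on different spaces, and are compared as such functionals. *)
Definition expectation_on_nonneg (L : (R -> R) -> R) : Prop :=
  [/\ L (fun=> 1) = 1,
      (forall (a : R) (f g : R -> R), bounded_continuous f -> bounded_continuous g ->
         L (fun x => a * f x + g x) = a * L f + L g) &
      (forall f g : R -> R, bounded_continuous f -> bounded_continuous g ->
         (forall x : R, 0 <= x -> f x <= g x) -> L f <= L g)].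
Lemma bounded_continuous_cst (a : R) : bounded_continuous (fun=> a).
Proof. by split; [move=> x; exact: cvg_cst|exists `|a|]. Qed.
Lemma bounded_continuous_lin (a : R) (f g : R -> R) :
  bounded_continuous f -> bounded_continuous g ->
  bounded_continuous (fun x => a * f x + g x).
Proof.
move=> [cf [M fM]] [cg [N gN]]; split.
  by move=> x; apply: cvgD; [apply: cvgMr; exact: cf|exact: cg].
exists (`|a| * M + N) => x; apply: le_trans (ler_normD _ _) _.
by rewrite lerD// normrM ler_wpM2l.
Qed.
Lemma bounded_continuousM (f g : R -> R) :
  bounded_continuous f -> bounded_continuous g ->
  bounded_continuous (fun x => f x * g x).
Proof.
move=> [cf [M fM]] [cg [N gN]]; split.
  by move=> x; apply: cvgM; [exact: cf|exact: cg].
by exists (M * N) => x; rewrite normrM ler_pM.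
Qed.
Lemma expectation_cst (L : (R -> R) -> R) (a : R) :
  expectation_on_nonneg L -> L (fun=> a) = a.
Proof.
move=> [L1 Llin _].
have := Llin (a - 1) _ _ (bounded_continuous_cst 1) (bounded_continuous_cst 1).
by rewrite L1 mulr1 subrK => {2}<-; congr L; apply/funext => x; rewrite mulr1 subrK.
Qed.
(** The function exp (- x) of [0, +oo[, made bounded on the whole line; its powers
    are the Laplace kernels at the integers. *)
Definition exp_clip (x : R) : R := expR (- Num.max x 0).
Lemma exp_clip_bounds (x : R) : 0 < exp_clip x <= 1.
Proof. by rewrite expR_gt0/= expR_le1 oppr_le0 le_max lexx orbT. Qed.
Lemma bounded_continuous_exp_clip : bounded_continuous exp_clip.
Proof.
split; last first.
  by exists 1 => x; have /andP[x0 x1] := exp_clip_bounds x; rewrite ger0_norm// ltW.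
move=> x; apply: (@continuous_comp _ _ _ (fun x : R => - Num.max x 0) expR).
  apply: (@continuousN _ _ _ (fun x : R => Num.max x 0)).
  by apply: continuous_max => //; exact: cvg_cst.
exact: continuous_expR.
Qed.
Lemma bounded_continuous_exp_clipX (n : nat) :
  bounded_continuous (fun x => exp_clip x ^+ n).
Proof.
elim: n => [|n IH]; first exact: bounded_continuous_cst.
under eq_fun do rewrite exprS.
exact: bounded_continuousM bounded_continuous_exp_clip IH.
Qed.
Lemma expectation_exp_clip_poly (p : {poly R}) (n : nat) :
  bounded_continuous (fun x => \sum_(i < n) p`_i * exp_clip x ^+ i) /\
  forall L, expectation_on_nonneg L ->
    L (fun x => \sum_(i < n) p`_i * exp_clip x ^+ i) =
    \sum_(i < n) p`_i * L (fun x => exp_clip x ^+ i).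
Proof.
elim: n => [|n [IH1 IH2]].
  under eq_fun do rewrite big_ord0.
  split; first exact: bounded_continuous_cst.
  by move=> L EL; rewrite big_ord0 expectation_cst.
under eq_fun do rewrite big_ord_recr/= addrC.
split; first exact: bounded_continuous_lin (bounded_continuous_exp_clipX n) IH1.
move=> L EL; have [_ Llin _] := EL; rewrite big_ord_recr/= addrC Llin ?IH2//.
exact: bounded_continuous_exp_clipX.
Qed.
Lemma bounded_continuous_poly (p : {poly R}) :
  bounded_continuous (fun x => p.[exp_clip x]).
Proof.
under eq_fun do rewrite horner_coef.
by have [] := expectation_exp_clip_poly p (size p).
Qed.
(** In the variable t = exp (- x), f becomes continuous on ]0, 1], and the factor
    1 - (1 - t) ^ m makes it vanish at t = 0. Weierstrass' theorem approximates the
    product by a polynomial in t, for which convergence is the hypothesis. The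
    remainder f (1 - t) ^ m has a small expectation under L for large m, hence also
    under L_ n for large n, (1 - t) ^ m being itself a polynomial. *)
Lemma weak_cvg_of_laplace (L_ : nat -> (R -> R) -> R) (L : (R -> R) -> R) :
  (forall n, expectation_on_nonneg (L_ n)) -> expectation_on_nonneg L ->
  (forall j : nat, L_ n (fun x => exp_clip x ^+ j) @[n --> \oo] -->
                   L (fun x => exp_clip x ^+ j)) ->
  L (fun x => (1 - exp_clip x) ^+ m) @[m --> \oo] --> (0 : R) ->
  forall f, bounded_continuous f -> L_ n f @[n --> \oo] --> L f.
Proof.
move=> EL_ EL cj c0 f [cf [M0 fM0]].
have [M M1 fM] : exists2 M : R, 1 <= M & forall x, `|f x| <= M.
  by exists (Num.max 1 M0) => [|x]; rewrite le_max ?lexx// fM0 orbT.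
have Mp : 0 < M by exact: lt_le_trans M1.
have cp (p : {poly R}) : L_ n (fun x => p.[exp_clip x]) @[n --> \oo] -->
    L (fun x => p.[exp_clip x]).
  have E (K : (R -> R) -> R) : expectation_on_nonneg K ->
      K (fun x => p.[exp_clip x]) = \sum_(i < size p) p`_i * K (fun x => exp_clip x ^+ i).
    move=> EK; under eq_fun do rewrite horner_coef.
    by have [_ ->] := expectation_exp_clip_poly p (size p).
  rewrite E//; under eq_cvg do rewrite E//.
  by apply: cvg_big => [|i _]; [exact: add_continuous|apply: cvgMr; exact: cj].
apply/cvgrPdist_le => e e0.
(* The choice makes M * L u at most e / 16, and M * L_ n u at most e / 8. *)
pose e' := e / (4 * M); have e'0 : 0 < e' by rewrite divr_gt0// mulr_gt0.
have [m0 mP] : exists m, (0 < m)%N /\ L (fun x => (1 - exp_clip x) ^+ m) <= e' / 4.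
  have e'4 : 0 < e' / 4 by rewrite divr_gt0.
  have /cvgrPdist_le /(_ _ e'4) H := c0.
  have : \forall m \near \oo, (0 < m)%N /\ L (fun x => (1 - exp_clip x) ^+ m) <= e' / 4.
    near=> m; split; first by near: m; exact: nbhs_infty_gt.
    apply: le_trans (ler_norm _) _; rewrite -normrN -sub0r; near: m; exact: H.
  by case/filter_ex => m mP; exists m.
move: mP => [m0_gt mP].
(* h is f in the variable t = exp (- x), cut off near t = 0. *)
pose h (t : R) : R := if t <= 0 then 0 else f (- ln t) * (1 - (1 - t) ^+ m0).
have cpow : continuous (fun t : R => 1 - (1 - t) ^+ m0).
  move=> t; apply: cvgB; first exact: cvg_cst.
  apply: (@continuous_comp _ _ _ (fun t : R => 1 - t) (fun t : R => t ^+ m0)).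
    by apply: cvgB; [exact: cvg_cst|exact: cvg_id].
  exact: exprn_continuous.
have ch : continuous h.
  move=> t; have [t0|t0|->] := ltgtP t 0.
  - rewrite /prop_for /continuous_at {2}/h ltW//; apply: cvg_near_cst.
    near=> y; rewrite /h ltW//; near: y; exact: lt_nbhsl.
  - have H : {for t, continuous (fun t => f (- ln t) * (1 - (1 - t) ^+ m0))}.
      apply: (@continuousM _ _ (fun t => f (- ln t))); last exact: cpow.
      apply: (@continuous_comp _ _ _ (fun t : R => - ln t) f); last exact: cf.
      by apply: (@continuousN _ _ _ (@ln R)); exact: continuous_ln.
    rewrite /prop_for /continuous_at {2}/h leNgt t0/=.
    apply: cvg_trans H; apply: near_eq_cvg; near=> y.
    rewrite /h leNgt ifF//; apply/negbF; near: y; exact: lt_nbhsr.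
  - rewrite /prop_for /continuous_at {2}/h lexx.
    apply: norm_cvg0.
    apply: (@squeeze_cvgr _ _ _ _ (fun=> 0) (fun t => M * `|1 - (1 - t) ^+ m0|)).
    + near=> y; rewrite normr_ge0/= /h; case: ifP => _.
        by rewrite normr0 mulr_ge0// ltW.
      by rewrite normrM ler_wpM2r.
    + exact: cvg_cst.
    + rewrite -[X in _ --> X](mulr0 M); apply: cvgMr.
      have := cpow 0; rewrite /prop_for /continuous_at subr0 expr1n subrr => H.
      have nH : `|1 - (1 - t) ^+ m0| @[t --> (0 : R)] --> `|0 : R| by exact: cvg_norm H.
      by rewrite normr0 in nH; exact: nH.
have hM (t : R) : 0 <= t <= 1 -> `|h t| <= M.
  move=> /andP[t0 t1]; rewrite /h; case: ifP => _; first by rewrite normr0 ltW.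
  rewrite normrM -[leRHS]mulr1 ler_pM//.
  have u0 : 0 <= (1 - t) ^+ m0 by rewrite exprn_ge0// subr_ge0.
  have u1 : (1 - t) ^+ m0 <= 1 by rewrite exprn_ile1 ?subr_ge0// gerBl.
  by rewrite ger0_norm ?subr_ge0// gerBl.
have e8 : 0 < e / 8 by rewrite divr_gt0.
have [p pP] := weierstrass ch e8 hM.
pose u (x : R) := (1 - exp_clip x) ^+ m0.
have ue x : u x = ((1 - 'X) ^+ m0).[exp_clip x] by rewrite horner_exp !hornerE.
have fu x : 0 <= x -> f x = h (exp_clip x) + f x * u x.
  move=> x0; have /andP[t0 t1] := exp_clip_bounds x.
  rewrite /h leNgt t0/= {1}/exp_clip expRK opprK max_l// /u; ring.
have ux x : 0 <= u x.
  by have /andP[t0 t1] := exp_clip_bounds x; rewrite exprn_ge0// subr_ge0.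
have bu : bounded_continuous u.
  by rewrite /u; under eq_fun do rewrite -/(u _) ue; exact: bounded_continuous_poly.
have bp := bounded_continuous_poly p.
have bf : bounded_continuous f by split => //; exists M.
(* Uniformly over functionals, f is close to the polynomial in mean. *)
have key K : expectation_on_nonneg K ->
    `|K f - K (fun x => p.[exp_clip x])| <= e / 8 + M * K u.
  move=> EK; have [_ Klin Kle] := EK; have bc := bounded_continuous_cst.
  have b1 : bounded_continuous (fun x => M * u x + (fun=> e / 8) x) by exact: bounded_continuous_lin.
  have b2 : bounded_continuous (fun x => 1 * (M * u x + (fun=> e / 8) x) + p.[exp_clip x]).
    exact: bounded_continuous_lin.
  have b3 : bounded_continuous (fun x => -1 * (M * u x + (fun=> e / 8) x) + p.[exp_clip x]).
    exact: bounded_continuous_lin.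
  have := Klin 1 _ _ b1 bp; have := Klin (-1) _ _ b1 bp.
  have := Klin M u (fun=> e / 8) bu (bc (e / 8)); rewrite (expectation_cst (e / 8) EK) => E1.
  rewrite E1 => E3 E2.
  have pt x : 0 <= x -> `|f x - p.[exp_clip x]| <= M * u x + e / 8.
    move=> x0; have /andP[t0 t1] := exp_clip_bounds x.
    rewrite (_ : _ - _ = f x * u x + (h (exp_clip x) - p.[exp_clip x])); last first.
      by rewrite {1}fu//; ring.
    apply: le_trans (ler_normD _ _) _; rewrite lerD//; last by rewrite pP// ltW.
    by rewrite normrM (ger0_norm (ux x)) ler_wpM2r.
  have le2 : K f <= K (fun x => 1 * (M * u x + (fun=> e / 8) x) + p.[exp_clip x]).
    apply: Kle => // x x0; have := pt x x0; rewrite ler_norml; lra.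
  have le3 : K (fun x => -1 * (M * u x + (fun=> e / 8) x) + p.[exp_clip x]) <= K f.
    apply: Kle => // x x0; have := pt x x0; rewrite ler_norml; lra.
  by rewrite ler_norml; rewrite E2 in le2; rewrite E3 in le3; lra.
have Lu : M * L u <= e / 16.
  rewrite (_ : e / 16 = M * (e' / 4)); first by rewrite ler_pM2l.
  by rewrite /e'; field; rewrite gt_eqF.
have cu : L_ n u @[n --> \oo] --> L u.
  have -> : u = (fun x => ((1 - 'X) ^+ m0).[exp_clip x]) by apply/funext => x; exact: ue.
  exact: cp.
have /cvgrPdist_le /(_ _ e8) cp' := cp p.
have e'16 : 0 < e' / 4 by rewrite divr_gt0.
have /cvgrPdist_le /(_ _ e'16) cu' := cu.
near=> n.
have k1 := key _ EL; have k2 := key _ (EL_ n).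
have a1 : `|L (fun x => p.[exp_clip x]) - L_ n (fun x => p.[exp_clip x])| <= e / 8.
  by near: n; exact: cp'.
have a2 : M * (L_ n u - L u) <= e / 16.
  rewrite (_ : e / 16 = M * (e' / 4)); last by rewrite /e'; field; rewrite gt_eqF.
  rewrite ler_pM2l//; apply: le_trans (ler_norm _) _; rewrite distrC; near: n; exact: cu'.
move: k1 k2 a1; rewrite !ler_norml; lra.
Unshelve. all: by end_near. Qed.
End Functional.

Section RandomVariables.
Context {R : realType} d {T : measurableType d} (P : probability T R).
Lemma measurable_bounded_continuous (X : T -> R) (f : R -> R) :
  measurable_fun setT X -> bounded_continuous f -> measurable_fun setT (f \o X).
Proof.
move=> mX [cf _]; apply: measurableT_comp => //.
exact: continuous_measurable_fun.
Qed.
Lemma integrable_bounded_continuous (X : T -> R) (f : R -> R) :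
  measurable_fun setT X -> bounded_continuous f ->
  P.-integrable setT (EFin \o (f \o X)).
Proof.
move=> mX bf; apply: measurable_bounded_integrable => //.
- exact: le_lt_trans (probability_le1 P measurableT) (ltry _).
- exact: measurable_bounded_continuous.
- have [_ [M fM]] := bf; exists M; split; first exact: num_real.
  by move=> N MN w _ /=; rewrite (le_trans (fM _))// ltW.
Qed.
Lemma EFin_Rintegral (X : T -> R) (f : R -> R) :
  measurable_fun setT X -> bounded_continuous f ->
  (\int[P]_w (f (X w))%:E = ((\int[P]_w f (X w))%R)%:E)%E.
Proof.
move=> mX bf; rewrite /Rintegral fineK//.
exact: integrable_fin_num (integrable_bounded_continuous mX bf).
Qed.
Lemma expectation_on_nonneg_rv (X : T -> R) :
  measurable_fun setT X -> (forall w, 0 <= X w) ->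
  expectation_on_nonneg (fun f => (\int[P]_w f (X w))%R).
Proof.
move=> mX X0; split.
- have := Rintegral_cst P measurableT 1; rewrite mul1r => ->.
  exact: (congr1 fine (probability_setT P)).
- move=> a f g bf bg.
  have If := integrable_bounded_continuous mX bf.
  have Ig := integrable_bounded_continuous mX bg.
  rewrite RintegralD//; last first.
    exact: (integrableZl measurableT a If).
  by rewrite RintegralZl.
- move=> f g bf bg fg; apply: le_Rintegral => //.
  + exact: integrable_bounded_continuous.
  + exact: integrable_bounded_continuous.
  + by move=> w _; exact: fg.
Qed.
(** A random variable gives no mass to infinity, the only place where exp_clip
    vanishes. *)
Lemma cvg_exp_clip_tight (X : T -> R) : measurable_fun setT X ->
  (\int[P]_w (1 - exp_clip (X w)) ^+ m)%R @[m --> \oo] --> (0 : R).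
Proof.
move=> mX.
have b1 : bounded_continuous (fun x : R => 1 - exp_clip x).
  have -> : (fun x : R => 1 - exp_clip x) = (fun x => -1 * exp_clip x + (fun=> 1) x).
    by apply/funext => x; rewrite mulN1r addrC.
  exact: bounded_continuous_lin bounded_continuous_exp_clip (bounded_continuous_cst 1).
have bm m : bounded_continuous (fun x : R => (1 - exp_clip x) ^+ m).
  elim: m => [|m IH]; first exact: bounded_continuous_cst.
  under eq_fun do rewrite exprS.
  exact: bounded_continuousM.
have c : (\int[P]_w ((1 - exp_clip (X w)) ^+ m)%:E @[m --> \oo] --> \int[P]_w (cst 0 w))%E.
  have [] := @dominated_convergence _ _ _ P setT measurableT
    (fun m w => ((1 - exp_clip (X w)) ^+ m)%:E) (cst 0%E) (cst 1%E) => //.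
  - move=> m; apply/measurable_EFinP; exact: (measurable_bounded_continuous mX (bm m)).
  - apply: aeW => w _; apply: cvg_EFin; first exact: nearW.
    have /andP[t0 t1] := exp_clip_bounds (X w).
    by apply: cvg_expr; rewrite ger0_norm ?subr_ge0// gtrBl.
  - exact: (finite_measure_integrable_cst P 1 measurableT).
  - apply: aeW => w m _ /=; have /andP[t0 t1] := exp_clip_bounds (X w).
    rewrite lee_fin ger0_norm ?exprn_ge0 ?subr_ge0// exprn_ile1 ?subr_ge0// gerBl ltW//.
move: c; rewrite integral0.
under eq_cvg do rewrite (EFin_Rintegral mX (bm _)).
by move=> /fine_cvg.
Qed.
End RandomVariables.
Section Continuity.
Context {R : realType} d {T : measurableType d} (P : probability T R).
Variables (Y : T -> R) (mY : measurable_fun setT Y) (Y0 : forall w, 0 <= Y w).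
Variables (P_ : nat -> probability nat R) (X : nat -> R) (X0 : forall n, 0 <= X n).
Hypothesis laplace : forall j : nat,
  (\int[P_ N]_n expR (- (j%:R * X n)))%R @[N --> \oo] -->
  (\int[P]_w expR (- (j%:R * Y w)))%R.
Lemma laplace_weak_cvg (f : R -> R) : bounded_continuous f ->
  (\int[P_ N]_n f (X n))%R @[N --> \oo] --> (\int[P]_w f (Y w))%R.
Proof.
have mX : measurable_fun setT X by [].
have E j x : 0 <= x -> exp_clip x ^+ j = expR (- (j%:R * x)) :> R.
  by move=> x0; rewrite /exp_clip max_l// -expRM_natl mulrN.
apply: (weak_cvg_of_laplace (L_ := fun N f => (\int[P_ N]_n f (X n))%R)
  (L := fun f => (\int[P]_w f (Y w))%R)).
- by move=> N; exact: expectation_on_nonneg_rv.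
- exact: expectation_on_nonneg_rv.
- move=> j; have := laplace (j := j).
  rewrite (_ : (\int[P]_w expR (- (j%:R * Y w)))%R = (\int[P]_w exp_clip (Y w) ^+ j)%R); last first.
    by apply: eq_Rintegral => w _; rewrite E.
  rewrite (_ : (fun N => (\int[P_ N]_n expR (- (j%:R * X n)))%R) =
    (fun N => (\int[P_ N]_n exp_clip (X n) ^+ j)%R))//.
  by apply/funext => N; apply: eq_Rintegral => w _; rewrite E.
- exact: cvg_exp_clip_tight.
Qed.
End Continuity.

(** * Integration against a density *)

Section Density.
Context d (T : measurableType d) (R : realType).
Variables (mu nu : {measure set T -> \bar R}) (g : T -> R).
Hypotheses (mg : measurable_fun setT g) (g0 : forall x, 0 <= g x).
Hypothesis nuE : forall A, measurable A -> nu A = (\int[mu]_(x in A) (g x)%:E)%E.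
Let integral_density_indic (E : set T) : measurable E ->
  (\int[nu]_x (\1_E x)%:E = \int[mu]_x ((\1_E x)%:E * (g x)%:E))%E.
Proof.
move=> mE; rewrite integral_indic//= setIT nuE// [LHS]integral_mkcond.
apply: eq_integral => x _; rewrite patchE indicE.
by case: ifP => _; rewrite ?mul1e ?mul0e.
Qed.
Import HBNNSimple.
Let integral_density_nnsfun (f : {nnsfun T >-> R}) :
  (\int[nu]_x (f x)%:E = \int[mu]_x ((f x)%:E * (g x)%:E))%E.
Proof.
under [LHS]eq_integral do rewrite fimfunE -fsumEFin//.
rewrite [LHS]ge0_integral_fsum//; last 2 first.
  - by move=> r; exact/measurable_EFinP/measurableT_comp.
  - by move=> n x _; rewrite EFinM nnfun_muleindic_ge0.
under [RHS]eq_integral.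
  move=> x _; rewrite fimfunE -fsumEFin// ge0_mule_fsuml; last first.
    by move=> r; rewrite EFinM nnfun_muleindic_ge0.
  over.
rewrite [RHS]ge0_integral_fsum//; last 2 first.
  - move=> r; apply: emeasurable_funM; last exact/measurable_EFinP.
    by apply/measurable_EFinP; exact/measurableT_comp.
  - move=> n x _; rewrite mule_ge0 ?lee_fin ?g0//.
    by rewrite -lee_fin EFinM nnfun_muleindic_ge0.
apply: eq_fsbigr => r _.
have [r0|r0] := ltP r 0.
  have r0' : f @^-1` [set r] = set0.
    by apply: preimage_nnfun0.
  rewrite !integral0_eq// => x _; rewrite r0' indic0 mulr0 ?mul0e//.
under [RHS]eq_integral do rewrite EFinM -muleA.
rewrite [RHS]ge0_integralZl//.
- by rewrite -integral_density_indic// integralZl_indic_nnsfun.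
- by apply: emeasurable_funM; exact/measurable_EFinP.
- by move=> x _; rewrite mule_ge0 ?lee_fin.
Qed.
(** From indicators to simple functions, then by monotone convergence. *)
Lemma integral_density (f : T -> \bar R) :
  measurable_fun setT f -> (forall x, 0 <= f x)%E ->
  (\int[nu]_x f x = \int[mu]_x (f x * (g x)%:E))%E.
Proof.
move=> mf f0; pose f_ := nnsfun_approx measurableT mf.
transitivity (lim (\int[nu]_x (f_ n x)%:E @[n --> \oo])%E).
  rewrite -monotone_convergence//=.
  - apply: eq_integral => x /[!inE] xD; apply/esym/cvg_lim => //=.
    exact: cvg_nnsfun_approx.
  - by move=> n; exact/measurable_EFinP/measurable_funTS.
  - by move=> n x _; rewrite lee_fin.
  - by move=> x _ m n mn; rewrite lee_fin; exact/lefP/nd_nnsfun_approx.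
under eq_fun do rewrite integral_density_nnsfun.
rewrite -monotone_convergence//=.
- apply: eq_integral => x _; apply/cvg_lim => //=.
  by apply: cvgeMr => //; exact: cvg_nnsfun_approx.
- move=> n; apply: emeasurable_funM; last exact/measurable_EFinP.
  by exact/measurable_EFinP/measurable_funTS.
- by move=> n x _; rewrite mule_ge0 ?lee_fin.
- move=> x _ m n mn; rewrite lee_wpmul2r ?lee_fin//.
  exact/lefP/nd_nnsfun_approx.
Qed.
End Density.

(** * Variables with the Dickman distribution *)

Section DickmanVariable.
Context {R : realType} (rho : R -> R) (hrho : is_dickman_function rho).
Local Notation mu := (@lebesgue_measure R).
Local Notation r := (dickman_ext rho).
(** Written with dickman_ext, which is measurable on the whole line; it differs
    from the density given by rho at most at 0. *)
Definition dickman_pdf (x : R) : R :=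
  if 0 <= x then expR (- euler_gamma R) * r x else 0.
Lemma dickman_pdf_ge0 (x : R) : 0 <= dickman_pdf x.
Proof.
rewrite /dickman_pdf; case: ifP => // _.
by rewrite mulr_ge0 ?expR_ge0// ltW// dickman_ext_gt0.
Qed.
Lemma measurable_dickman_ext : measurable_fun (setT : set (measurableTypeR R)) r.
Proof. exact: continuous_measurable_fun (continuous_dickman_ext hrho). Qed.
Lemma measurable_dickman_pdf : measurable_fun (setT : set (measurableTypeR R)) dickman_pdf.
Proof.
apply: measurable_fun_ifT => //; last first.
  by apply: measurable_funM => //; exact: measurable_dickman_ext.
exact: measurable_fun_ler.
Qed.
Lemma integral_dickman_pdf (A : set (measurableTypeR R)) : measurable A ->
  (\int[mu]_(x in A `&` `[0%R, +oo[) (expR (- euler_gamma R) * rho x)%:E =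
   \int[mu]_(x in A) (dickman_pdf x)%:E)%E.
Proof.
move=> mA; set c := expR _.
have mA0 : measurable (A `&` `[0%R, +oo[ : set (measurableTypeR R)) by exact: measurableI.
have mA1 : measurable ((A `&` `[0%R, +oo[) `\ 0 : set (measurableTypeR R)) by exact: measurableD.
have eqr x : ((A `&` `[0%R, +oo[) `\ 0) x -> c * rho x = c * r x.
  move=> [[_ /=]]; rewrite in_itv/= andbT => x0 /eqP x1.
  by rewrite dickman_extE// lt0r x0 x1.
have mr (D : set (measurableTypeR R)) : measurable_fun D (fun x => c * r x).
  apply: measurable_funTS; apply: measurable_funM => //; exact: measurable_dickman_ext.
have mrho : measurable_fun ((A `&` `[0%R, +oo[) `\ 0 : set (measurableTypeR R)) (fun x => c * rho x).
  apply: eq_measurable_fun (mr _) => x /[!inE] xA; by rewrite eqr.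
rewrite -(integral_setD1 mA1 ((measurable_EFinP _ _).2 mrho)).
rewrite (eq_integral (fun x : measurableTypeR R => (c * r x)%:E)); last by move=> x /[!inE] xA; congr EFin; exact: eqr.
rewrite (integral_setD1 mA1 ((measurable_EFinP _ _).2 (mr _))) integral_mkcondr.
apply: eq_integral => x _; rewrite patchE mem_setE in_itv/= andbT /dickman_pdf.
by case: ifP.
Qed.
Lemma dickman_expectation d (T : measurableType d) (P : probability T R)
    (D : {RV P >-> R}) : has_dickman_distribution rho D ->
  forall f : R -> R, measurable_fun (setT : set R) f -> (forall x, 0 <= f x) ->
  (\int[P]_w (f (D w))%:E = \int[mu]_(x in `[0%R, +oo[) (f x * (expR (- euler_gamma R) * r x))%:E)%E.
Proof.
move=> hD f mf f0.
have mD : measurable_fun setT (D : T -> measurableTypeR R) by exact: (@measurable_funPT _ _ _ _ D).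
pose nu_ : {measure set (measurableTypeR R) -> \bar R} :=
  pushforward P (D : T -> measurableTypeR R).
pose nu := nu_ mD.
transitivity (\int[nu]_x (f x)%:E)%E.
  rewrite ge0_integral_pushforward//.
  - exact/measurable_EFinP.
  - by move=> x _; rewrite lee_fin.
rewrite (@integral_density _ _ _ mu nu dickman_pdf).
- rewrite [RHS]integral_mkcond; apply: eq_integral => x _.
  rewrite patchE mem_setE in_itv/= andbT /dickman_pdf; case: ifP => _ //.
  by rewrite mule0.
- exact: measurable_dickman_pdf.
- exact: dickman_pdf_ge0.
- by move=> A mA; rewrite -integral_dickman_pdf// -hD.
- exact/measurable_EFinP.
- by move=> x; rewrite lee_fin.
Qed.
(** D is almost surely nonnegative, so the truncation changes D + 1 on a null set
    only; it makes the variable nonnegative everywhere. *)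
Lemma dickman_rv_laplace d (T : measurableType d) (P : probability T R)
    (D : {RV P >-> R}) : has_dickman_distribution rho D -> forall j : nat,
  (\int[P]_w expR (- (j%:R * Num.max (D w + 1) 0)))%R =
  expR (- j%:R) * expR (- ein j%:R).
Proof.
move=> hD j; rewrite /Rintegral.
have mf : measurable_fun (setT : set R) (fun x => expR (- (j%:R * Num.max (x + 1) 0))).
  apply: continuous_measurable_fun => x.
  apply: (@continuous_comp _ _ _ (fun x : R => - (j%:R * Num.max (x + 1) 0)) expR); last first.
    exact: continuous_expR.
  have cm : {for x, continuous (fun y : R => Num.max (y + 1) 0)}.
    apply: continuous_max; last exact: cvg_cst.
    by apply: cvgD; [exact: cvg_id|exact: cvg_cst].
  by apply: cvgN; apply: cvgMr; exact: cm.
rewrite (dickman_expectation hD mf) => [|x]; last exact: expR_ge0.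
have j1 : -1 < j%:R :> R by apply: lt_le_trans (ler0n _ _); rewrite ltrN10.
set g := euler_gamma R.
rewrite (eq_integral (fun x : measurableTypeR R => (expR (- j%:R) * expR (- g))%:E *
    (expR (- j%:R * x) * r x)%:E)%E); last first.
  move=> x; rewrite mem_setE in_itv/= andbT => x0.
  rewrite max_l ?addr_ge0// -EFinM; congr EFin.
  rewrite (_ : - (j%:R * (x + 1)) = - j%:R + - j%:R * x); last by ring.
  by rewrite expRD; ring.
have [F [_ _ _ IL]] := laplaceP hrho j1.
rewrite ge0_integralZl//.
- rewrite IL /= dickman_laplaceE// dickman_laplace0// -/g.
  rewrite -!mulrA; congr (_ * _); rewrite mulrA (mulrC _ (expR g)) expRxMexpNx_1 mul1r//.
- apply/measurable_EFinP; apply: measurable_funTS.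
  exact: continuous_measurable_fun (continuous_laplace_integrand hrho (l := j%:R)).
- by move=> x _; rewrite lee_fin mulr_ge0 ?expR_ge0// ltW// dickman_ext_gt0.
Qed.
(** The statement on densities speaks of rho alone; this law provides a variable D
    through which its integrals are tail probabilities. The proof among the
    arguments is what the probability structure below is inferred from. *)
Definition dickman_prob & is_dickman_function rho : set (measurableTypeR R) -> \bar R :=
  fun A => (\int[mu]_(x in A) (dickman_pdf x)%:E)%E.
Local Notation dprob := (dickman_prob hrho).
Let dprob0 : dprob set0 = 0%E.
Proof. by rewrite /dickman_prob integral_set0. Qed.
Let dprob_ge0 A : (0 <= dprob A)%E.
Proof. by apply: integral_ge0 => x _; rewrite lee_fin dickman_pdf_ge0. Qed.
Let dprob_sigma_additive : semi_sigma_additive dprob.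
Proof.
move=> F mF tF mUF; rewrite /dickman_prob; apply: cvg_toP.
  apply: ereal_nondecreasing_is_cvgn => m n mn.
  apply: lee_sum_nneg_natr => // k _ _.
  by apply: integral_ge0 => x _; rewrite lee_fin dickman_pdf_ge0.
rewrite ge0_integral_bigcup//=.
- apply: measurable_funTS; apply/measurable_EFinP; exact: measurable_dickman_pdf.
- by move=> x _; rewrite lee_fin dickman_pdf_ge0.
Qed.
HB.instance Definition _ := isMeasure.Build _ _ _ dprob
  dprob0 dprob_ge0 dprob_sigma_additive.
Let dprob_setT : dprob setT = 1%E.
Proof.
have l0 : -1 < 0 :> R by rewrite ltrN10.
have [F [_ _ _ IL]] := laplaceP hrho l0.
set c := expR (- euler_gamma R).
have c0 : 0 <= c by exact: expR_ge0.
transitivity (\int[mu]_(x in `[0%R, +oo[) (c%:E * (expR (- 0 * x) * r x)%:E))%E.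
  rewrite [RHS]integral_mkcond; apply: eq_integral => x _.
  rewrite patchE mem_setE in_itv/= andbT /dickman_pdf; case: ifP => // _.
  by rewrite oppr0 mul0r expR0 mul1r.
rewrite ge0_integralZl//.
- by rewrite IL dickman_laplace0// -EFinM mulrC expRxMexpNx_1.
- apply/measurable_EFinP; apply: measurable_funTS.
  exact: continuous_measurable_fun (continuous_laplace_integrand hrho (l := 0)).
- by move=> x _; rewrite lee_fin mulr_ge0 ?expR_ge0// ltW// dickman_ext_gt0.
Qed.
HB.instance Definition _ := @Measure_isProbability.Build _ _ R dprob dprob_setT.
Lemma dickman_rv_exists : exists D : {RV dprob >-> R}, has_dickman_distribution rho D.
Proof.
have mid : @measurable_fun _ _ (measurableTypeR R) R setT (fun x : R => x).
  by move=> _ A mA; rewrite setTI.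
exists (@mfun_Sub _ _ (measurableTypeR R) R _ (mem_set mid)) => A mA.
exact/esym/integral_dickman_pdf.
Qed.
End DickmanVariable.

(** * Euler products over smooth power-free integers *)

Section Primes.
Lemma prime_nth_prime (j : nat) : prime (nth_prime j.+1).
Proof. by apply/nth_primeP; exists j.+1. Qed.
Lemma nth_prime_ltS (j : nat) : (nth_prime j < nth_prime j.+1)%N.
Proof. by have [] := next_primeP (nth_prime j). Qed.
Lemma nth_prime_lt (i j : nat) : (i < j)%N -> (nth_prime i < nth_prime j)%N.
Proof.
elim: j => // j IH; rewrite ltnS leq_eqVlt => /predU1P[->|/IH ij].
  exact: nth_prime_ltS.
exact: ltn_trans ij (nth_prime_ltS j).
Qed.
Lemma nth_prime_ge (j : nat) : (j <= nth_prime j)%N.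
Proof. by elim: j => // j /leq_ltn_trans; apply; exact: nth_prime_ltS. Qed.
Lemma nth_prime_inj : injective nth_prime.
Proof.
move=> i j ij; have [/nth_prime_lt|/nth_prime_lt|//] := ltngtP i j.
  by rewrite ij ltnn.
by rewrite ij ltnn.
Qed.
Lemma sum_nth_prime (V : nmodType) (F : nat -> V) (J : nat) :
  \sum_(i < J) F (nth_prime i.+1) =
  \sum_(0 <= m < (nth_prime J).+1 | prime m) F m.
Proof.
elim: J => [|J IH]; first by rewrite big_ord0 big_mkcond big_nat1.
rewrite big_ord_recr/= IH; have lt := nth_prime_ltS J.
rewrite [RHS](big_cat_nat (n := (nth_prime J).+1))//=; last by rewrite ltnS ltnW.
congr (_ + _); rewrite big_mkcond big_nat_recr//= prime_nth_prime.
rewrite big1_seq ?add0r// => m; rewrite mem_index_iota => /andP[_ /andP[Jm mJ]].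
case: ifP => // pm; have [_ _ /(_ m pm Jm)] := next_primeP (nth_prime J).
by rewrite leqNgt mJ.
Qed.
End Primes.
(** The value k = 0 encodes the absence of any condition, so that one argument
    covers all integers and the k-free ones. *)
Definition allowed (k : nat) : set nat := if k is 0 then setT else kfree k.
Definition Omega_free (k N : nat) : set nat := Omega N `&` allowed k.
Section OmegaFree.
Lemma Omega_gt0 N n : Omega N n -> (0 < n)%N.
Proof. by case. Qed.
Lemma kfree1 k : (0 < k)%N -> kfree k 1.
Proof.
move=> k0; split => // p pp; rewrite dvdn1; apply/negP => /eqP /(congr1 (logn p)).
by rewrite pfactorK// logn1 => k00; rewrite k00 in k0.
Qed.
Lemma Omega0E : Omega 0 = [set 1%N].
Proof.
apply/seteqP; split => [n [n0 nP]|_ ->] /=; last first.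
  split => // -[//|j] _; have pp := prime_nth_prime j.
  by rewrite dvdn1; apply: contraL pp => /eqP ->.
apply/eqP; apply: contraT => n1.
have pn : prime (pdiv n) by rewrite pdiv_prime // ltn_neqAle eq_sym n1.
have [j j0 jE] := (nth_primeP (pdiv n)).1 pn.
by have := nP j j0; rewrite jE pdiv_dvd.
Qed.
Lemma Omega_free0E k : Omega_free k 0 = [set 1%N].
Proof.
rewrite /Omega_free Omega0E; apply/seteqP; split => [n []//|_ ->]; split => //.
by case: k => // k; exact: kfree1.
Qed.
Lemma OmegaS N n : Omega N n -> Omega N.+1 n.
Proof. by move=> [n0 nP]; split => // j jN; apply: nP; exact: ltn_trans jN. Qed.
Lemma allowed_dvd k a b : (a %| b)%N -> allowed k b -> allowed k a.
Proof.
case: k => // k ab [b0 bP]; split; first exact: dvdn_gt0 ab.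
by move=> p /bP; apply: contra => /dvdn_trans; exact.
Qed.
Definition exponents (k : nat) : set nat := [set i | (k == 0%N) || (i < k)%N].
(** Unique factorization, isolating the power of the largest available prime. *)
Lemma Omega_free_bij k N :
  set_bij (exponents k `*` Omega_free k N) (Omega_free k N.+1)
    (fun x => (nth_prime N.+1 ^ x.1 * x.2)%N).
Proof.
set p := nth_prime N.+1; have pp : prime p := prime_nth_prime N.
have p0 := prime_gt0 pp.
have lognE i m : Omega_free k N m -> logn p (p ^ i * m) = i.
  move=> [[m0 mP] _]; rewrite lognM ?expn_gt0 ?p0// pfactorK//.
  by rewrite lognE pp m0 (negbTE (mP N.+1 (ltnSn N))) addn0.
split => /=.
- move=> [i m] /= [ik mN]; have [[m0 mP] mk] := mN; split.
    split; first by rewrite muln_gt0 expn_gt0 p0 m0.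
    move=> j jN; have pj : prime (nth_prime j) by case: j jN => // j _; exact: prime_nth_prime.
    rewrite Euclid_dvdM// negb_or mP ?andbT//; last exact: ltn_trans jN.
    rewrite Euclid_dvdX// negb_and; apply/orP; left; apply/negP.
    rewrite dvdn_prime2// => /eqP /nth_prime_inj E.
    by rewrite E ltnn in jN.
  case: k ik mk mN {lognE} => // k ik [_ mk] mN; split.
    by rewrite muln_gt0 expn_gt0 p0 m0.
  move=> q pq; have [->|qp] := eqVneq q p; last first.
    rewrite Gauss_dvdr ?mk// coprimeXl// coprimeXr// prime_coprime//.
    by rewrite dvdn_prime2.
  rewrite Gauss_dvdl; last by rewrite coprimeXl// prime_coprime// mP.
  by rewrite dvdn_Pexp2l ?prime_gt1// -ltnNge.
- move=> [i m] [j l]; rewrite !in_setE => -[/= _ mN] [/= _ lN] E.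
  have ij : i = j by rewrite -(lognE i m mN) E lognE.
  move: E; rewrite ij => /eqP; rewrite eqn_mul2l expn_eq0 eqn0Ngt p0/=.
  by move=> /eqP ->.
- move=> n [[n0 nP] nk].
  have [m pm nE] := pfactor_coprime pp n0.
  have mn : (m %| n)%N by rewrite nE dvdn_mulr.
  exists (logn p n, m); last by rewrite /= mulnC -nE.
  split => /=.
    case: k nk {lognE} => // k [_ /(_ p pp) nk]; rewrite /exponents/=.
    case: (ltnP (logn p n) k.+1) => // kn; case/negP: nk.
    by rewrite (dvdn_trans (dvdn_exp2l p kn))// pfactor_dvdnn.
  split; last exact: allowed_dvd mn nk.
  split; first exact: dvdn_gt0 mn.
  move=> j; rewrite leq_eqVlt => /predU1P[<-|/nP].
    by rewrite -prime_coprime.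
  by apply: contra => /dvdn_trans; exact.
Qed.
End OmegaFree.
Section EulerProduct.
Context {R : realType}.
(** The sum of x ^ i over the exponents i allowed by k. *)
Definition euler_factor (k : nat) (x : R) : R :=
  if k is 0 then (1 - x)^-1 else (1 - x ^+ k) / (1 - x).
Lemma euler_factor_gt0 (k : nat) (x : R) : 0 <= x < 1 -> 0 < euler_factor k x.
Proof.
move=> /andP[x0 x1]; have x1' : 0 < 1 - x by rewrite subr_gt0.
case: k => [|k]; rewrite /euler_factor; first by rewrite invr_gt0.
by rewrite divr_gt0// subr_gt0 exprn_ilt1.
Qed.
Lemma esum_powers (k : nat) (x : R) : 0 <= x < 1 ->
  (\esum_(i in exponents k) (x ^+ i)%:E = (euler_factor k x)%:E)%E.
Proof.
move=> /andP[x0 x1]; case: k => [|k].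
  rewrite (_ : exponents 0 = setT); last by apply/seteqP; split.
  rewrite -nneseries_esumT; last by move=> n; rewrite lee_fin exprn_ge0.
  apply/cvg_lim => //; under eq_fun do rewrite sumEFin.
  apply: cvg_EFin; first exact: nearW.
  have := @cvg_geometric_series R 1 x; rewrite ger0_norm// mul1r => /(_ x1).
  by rewrite /euler_factor -exprn_geometric.
rewrite (_ : exponents k.+1 = `I_k.+1); last by apply/seteqP; split.
rewrite esum_fset -?fsbig_ord//; last by move=> i _; rewrite lee_fin exprn_ge0.
rewrite sumEFin /euler_factor; congr EFin.
have x1' : 1 - x != 0 by rewrite gt_eqF// subr_gt0.
have E := subrX1 x k.+1; apply: (mulIf x1'); rewrite divfK//.
by rewrite -[RHS]opprB E; ring.
Qed.
Lemma esumZl (S : set nat) (c : R) (a : nat -> R) : 0 <= c -> (forall n, 0 <= a n) ->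
  (\esum_(n in S) (c * a n)%:E = c%:E * \esum_(n in S) (a n)%:E)%E.
Proof.
move=> c0 a0; rewrite esum_mkcond [in RHS]esum_mkcond.
rewrite -!nneseries_esumT; try by move=> n; case: ifP => // _; rewrite lee_fin ?mulr_ge0.
rewrite -nneseriesZl//; last by move=> n _; case: ifP => // _; rewrite lee_fin.
by apply: eq_eseriesr => n _; case: ifP => _; rewrite ?mule0.
Qed.
Variables (k : nat) (w : nat -> R).
Hypotheses (w0 : forall n, 0 <= w n) (w1 : w 1%N = 1).
Hypothesis wM : forall a b, (0 < a)%N -> (0 < b)%N -> w (a * b)%N = w a * w b.
Hypothesis wlt1 : forall p, prime p -> w p < 1.
(** Each new prime multiplies the sum by its Euler factor, through Omega_free_bij. *)
Lemma euler_product (N : nat) :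
  (\esum_(n in Omega_free k N) (w n)%:E =
   (\prod_(i < N) euler_factor k (w (nth_prime i.+1)))%:E)%E.
Proof.
have wX a i : (0 < a)%N -> w (a ^ i)%N = w a ^+ i.
  move=> a0; elim: i => [|i IH]; first by rewrite expn0 expr0.
  by rewrite expnS exprS wM ?IH// expn_gt0 a0.
elim: N => [|N IH].
  by rewrite Omega_free0E big_ord0 esum_set1 ?w1 ?lee_fin.
have pp := prime_nth_prime N; set p := nth_prime N.+1 in pp *.
have p0 := prime_gt0 pp.
rewrite (reindex_esum _ _ _ _ (Omega_free_bij k N))/= -/p.
transitivity (\esum_(i in exponents k) \esum_(m in Omega_free k N) (w p ^+ i * w m)%:E)%E.
  rewrite (@esum_esum _ _ _ _ (fun=> Omega_free k N) (fun i m => (w p ^+ i * w m)%:E)).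
    apply: eq_esum => -[i m] [/= _ [/Omega_gt0 m0 _]].
    by rewrite wM ?expn_gt0 ?p0// wX.
  by move=> i m _ _; rewrite lee_fin mulr_ge0 ?exprn_ge0.
under eq_esum => i _ do rewrite esumZl ?exprn_ge0// IH -EFinM mulrC.
rewrite esumZl; last 2 first.
- by apply: prodr_ge0 => i _; rewrite ltW// euler_factor_gt0 ?w0 ?wlt1// prime_nth_prime.
- by move=> i; rewrite exprn_ge0.
by rewrite esum_powers ?w0 ?wlt1// big_ord_recr.
Qed.
End EulerProduct.

(** * Sums over primes *)

Section PrimeProducts.
Context {R : realType}.
(** Summation by parts. *)
Lemma abel_inequality (b h : nat -> R) (B : R) (n : nat) :
  (forall m, `|\sum_(i < m) b i| <= B) ->
  (forall i, 0 <= h i) -> (forall i, h i.+1 <= h i) ->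
  `|\sum_(i < n) b i * h i| <= B * h 0%N.
Proof.
move=> bB h0 hS.
have E m : \sum_(i < m) b i * h i = (\sum_(i < m) b i) * h m +
    \sum_(i < m) (\sum_(l < i.+1) b l) * (h i - h i.+1).
  elim: m => [|m IH]; first by rewrite !big_ord0 mul0r addr0.
  by rewrite big_ord_recr/= IH [in RHS]big_ord_recr/= [in RHS]big_ord_recr/= [\sum_(l < m.+1) _]big_ord_recr/=; ring.
rewrite E; apply: le_trans (ler_normD _ _) _.
have tel : \sum_(i < n) (h i - h i.+1) = h 0%N - h n.
  elim: n => [|n IH]; first by rewrite big_ord0 subrr.
  by rewrite big_ord_recr/= IH; ring.
have -> : B * h 0%N = B * h n + \sum_(i < n) B * (h i - h i.+1).
  by rewrite -mulr_sumr tel; ring.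
rewrite lerD ?normrM ?(ger0_norm (h0 n)) ?ler_wpM2r//.
apply: le_trans (ler_norm_sum _ _ _) _; apply: ler_sum => i _.
by rewrite normrM (@ger0_norm _ (_ - _)) ?subr_ge0// ler_wpM2r// subr_ge0.
Qed.
Definition prime_coef (m : nat) : R := if prime m then ln m%:R / m%:R else 0.
Lemma mertens_sum_coef (n : nat) :
  mertens_sum n.+1 = \sum_(i < n) prime_coef i.+2.
Proof.
rewrite /mertens_sum big_mkcond/= big_nat_recl// big_nat_recl//= !add0r.
by rewrite big_mkord.
Qed.
Lemma sum_ln_diff (n : nat) : \sum_(i < n) (ln i.+2%:R - ln i.+1%:R) = ln n.+1%:R :> R.
Proof.
elim: n => [|n IH]; first by rewrite big_ord0 ln1.
by rewrite big_ord_recr/= IH; ring.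
Qed.
Definition mertens_bound : R := ln 16 + 3.
(** Mertens' estimate as the hypothesis of Abel's inequality: ln p / p on primes
    has the same partial sums as the increments of ln, up to a constant. *)
Lemma mertens_bounded (m : nat) :
  `|\sum_(i < m) (prime_coef i.+2 - (ln i.+2%:R - ln i.+1%:R))| <= mertens_bound.
Proof.
rewrite sumrB -mertens_sum_coef sum_ln_diff /mertens_bound.
have := @mertens_le R m.+1 isT; have := @mertens_ge R m.+1 isT.
have : 0 <= ln 16 :> R by rewrite ln_ge0// ler1n.
by rewrite ler_norml; lra.
Qed.
(** Abel's inequality replaces prime_coef by the increments of ln, and the sum
    becomes a Riemann sum of ein_deriv on the subdivision c ln i. Both errors are
    O(c) because ein_deriv is monotone on [0, +oo[, with values in [0, 1]. *)
Lemma sum_primes_ein (n : nat) (c : R) : 0 <= c ->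
  `|c * \sum_(i < n) prime_coef i.+2 * ein_deriv (c * ln i.+2%:R) -
    ein (c * ln n.+1%:R)| <= c * (mertens_bound + 1).
Proof.
move=> c0; pose h i := ein_deriv (c * ln i.+2%:R) : R.
have ln0 i : 0 <= ln i.+1%:R :> R by rewrite ln_ge0// ler1n.
have lnS i : ln i.+1%:R <= ln i.+2%:R :> R.
  by rewrite ler_ln ?posrE ?ltr0n// ler_nat.
have cl0 i : 0 <= c * ln i.+1%:R by rewrite mulr_ge0.
have clS i : c * ln i.+1%:R <= c * ln i.+2%:R by rewrite ler_wpM2l.
have h0 i : 0 <= h i by exact: ein_deriv_ge0.
have e0 : ein_deriv 0 = 1 :> R by rewrite /ein_deriv eqxx.
have h1 : h 0%N <= 1 by rewrite -e0 ein_deriv_le.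
have hS i : h i.+1 <= h i by rewrite ein_deriv_le.
pose b i : R := prime_coef i.+2 - (ln i.+2%:R - ln i.+1%:R).
have H1 : `|\sum_(i < n) b i * h i| <= mertens_bound * h 0%N.
  by apply: abel_inequality => // m; exact: mertens_bounded.
have mb0 : 0 <= mertens_bound :> R by rewrite addr_ge0// ln_ge0// ler1n.
have {}H1 := le_trans H1 (ler_wpM2l mb0 h1).
(* The Riemann sum: lower sums are compared with Ein by the mean value theorem. *)
have H2 : `|c * \sum_(i < n) (ln i.+2%:R - ln i.+1%:R) * h i - ein (c * ln n.+1%:R)| <= c.
  have mv i : exists2 t, c * ln i.+1%:R <= t <= c * ln i.+2%:R &
     ein (c * ln i.+2%:R) - ein (c * ln i.+1%:R) = ein_deriv t * (c * ln i.+2%:R - c * ln i.+1%:R).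
    have := clS i; rewrite le_eqVlt => /predU1P[->|lt].
      by exists (c * ln i.+2%:R); rewrite ?lexx// !subrr mulr0.
    have [|t /andP[t0 t1] E] := @mean_value_derive R ein ein_deriv _ _ lt.
      move=> t /andP[t0 _]; apply: derive_ein.
      by apply: lt_le_trans (le_trans (cl0 i) t0); rewrite ltrN10.
    by exists t; rewrite ?(ltW t0) ?(ltW t1).
  have tel : ein (c * ln n.+1%:R) =
      \sum_(i < n) (ein (c * ln i.+2%:R) - ein (c * ln i.+1%:R)).
    elim: n {H1} => [|n IH]; first by rewrite big_ord0 ln1 mulr0 ein0.
    by rewrite big_ord_recr/= -IH; ring.
  have lo : c * \sum_(i < n) (ln i.+2%:R - ln i.+1%:R) * h i <= ein (c * ln n.+1%:R).
    rewrite tel mulr_sumr; apply: ler_sum => i _.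
    have [t /andP[t0 t1] ->] := mv i; rewrite -mulrBr.
    have et : h i <= ein_deriv t by rewrite ein_deriv_le// (le_trans (cl0 i)).
    rewrite (mulrC _ (h i)) mulrCA; apply: ler_wpM2r et.
    by rewrite mulr_ge0// subr_ge0.
  have hi : ein (c * ln n.+1%:R) - c * \sum_(i < n) (ln i.+2%:R - ln i.+1%:R) * h i <= c.
    pose h' i := ein_deriv (c * ln i.+1%:R) : R.
    apply: (@le_trans _ _ (\sum_(i < n) c * (h' i - h' i.+1))).
      rewrite tel mulr_sumr -sumrB; apply: ler_sum => i _.
      have [t /andP[t0 t1] ->] := mv i; rewrite -mulrBr.
      have d1 : ln i.+2%:R - ln i.+1%:R <= 1 :> R.
        by apply: le_trans (@ln_succ_le R i.+1 isT) _; rewrite invf_le1// ler1n.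
      have d0 : 0 <= ln i.+2%:R - ln i.+1%:R :> R by rewrite subr_ge0.
      have et : ein_deriv t <= h' i by rewrite ein_deriv_le.
      rewrite -/(h' i.+1) -/(h i) (_ : h i = h' i.+1)//.
      have hh : h' i.+1 <= h' i by rewrite ein_deriv_le.
      rewrite (_ : _ - _ = c * ((ln i.+2%:R - ln i.+1%:R) * (ein_deriv t - h' i.+1))); last by ring.
      by rewrite ler_wpM2l//; nra.
    rewrite -mulr_sumr -[leRHS]mulr1 ler_wpM2l//.
    have -> : \sum_(i < n) (h' i - h' i.+1) = h' 0%N - h' n.
      elim: n {H1 tel lo} => [|n IH]; first by rewrite big_ord0 subrr.
      by rewrite big_ord_recr/= IH; ring.
    rewrite /h' ln1 mulr0 e0 gerBl; exact: ein_deriv_ge0.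
  by rewrite ler_norml; lra.
have E : \sum_(i < n) prime_coef i.+2 * ein_deriv (c * ln i.+2%:R) =
    \sum_(i < n) (prime_coef i.+2 - (ln i.+2%:R - ln i.+1%:R)) * h i +
    \sum_(i < n) (ln i.+2%:R - ln i.+1%:R) * h i.
  by rewrite -big_split/=; apply: eq_bigr => i _; rewrite -/(h i); ring.
rewrite E; set X := \sum_(i < n) (_ - _) * _ in H1 *; set Y := \sum_(i < n) _ in H2 *.
have H3 : `|c * X| <= c * mertens_bound.
  by rewrite normrM (ger0_norm c0) ler_wpM2l// -[leRHS]mulr1.
rewrite mulrDr mulrDr mulr1 -addrA; apply: le_trans (ler_normD _ _) _.
by rewrite lerD.
Qed.
End PrimeProducts.

(** * Ratios of Euler products *)

Section EulerRatio.
Context {R : realType}.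
(** The weight n ^ (- 1 - c). *)
Definition tilted (c : R) (n : nat) : R := n%:R^-1 * expR (- (c * ln n%:R)).
Definition euler_prod (k : nat) (c : R) (N : nat) : R :=
  \prod_(i < N) euler_factor k (tilted c (nth_prime i.+1)).
Lemma tilted_ge0 (c : R) (n : nat) : 0 <= tilted c n.
Proof. by rewrite mulr_ge0 ?invr_ge0 ?expR_ge0. Qed.
Lemma tilted1 (c : R) : tilted c 1 = 1.
Proof. by rewrite /tilted ln1 mulr0 oppr0 expR0 invr1 mulr1. Qed.
Lemma tiltedM (c : R) (a b : nat) : (0 < a)%N -> (0 < b)%N ->
  tilted c (a * b) = tilted c a * tilted c b.
Proof.
move=> a0 b0; rewrite /tilted ln_natM// natrM invfM mulrDr opprD expRD; ring.
Qed.
Lemma tilted_le (c : R) (n : nat) : 0 <= c -> (0 < n)%N -> tilted c n <= n%:R^-1.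
Proof.
move=> c0 n0; rewrite ler_piMr ?invr_ge0// expR_le1 oppr_le0 mulr_ge0//.
by rewrite ln_ge0// ler1n.
Qed.
Lemma prime_inv_half (p : nat) : prime p -> p%:R^-1 <= 2^-1 :> R.
Proof. by move=> pp; rewrite lef_pV2 ?posrE ?ltr0n ?prime_gt0// ler_nat prime_gt1. Qed.
Lemma tilted_prime_half (c : R) (p : nat) : 0 <= c -> prime p -> tilted c p <= 2^-1.
Proof.
by move=> c0 pp; rewrite (le_trans (tilted_le c0 (prime_gt0 pp)))// prime_inv_half.
Qed.
Lemma tilted_prime_lt1 (c : R) (p : nat) : 0 <= c -> prime p -> tilted c p < 1.
Proof.
by move=> c0 pp; rewrite (le_lt_trans (tilted_prime_half c0 pp))// invf_lt1// ltr1n.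
Qed.
Lemma tilted0 (n : nat) : tilted 0 n = n%:R^-1.
Proof. by rewrite /tilted mul0r oppr0 expR0 mulr1. Qed.
Lemma euler_factor_ge1 (k : nat) (x : R) : k != 1%N -> 0 <= x < 1 -> 1 <= euler_factor k x.
Proof.
move=> k1 /andP[x0 x1]; have x1' : 0 < 1 - x by rewrite subr_gt0.
case: k k1 => [|[//|k]] _; rewrite /euler_factor.
  by rewrite -[leLHS]invr1 lef_pV2 ?posrE// gerBl.
by rewrite ler_pdivlMr// mul1r lerD2l lerN2 exprS ler_piMr// exprn_ile1// ltW.
Qed.
Lemma ln_le_subr1 (y : R) : 0 < y -> ln y <= y - 1.
Proof. by move=> y0; have := @le_ln1Dx R (y - 1); rewrite [1 + _]addrC subrK; apply; lra. Qed.
(** To first order in x, the logarithm of an Euler factor is x for every k <> 1; in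
    the increment from q to x the error is O(x ^ 2 a). *)
Lemma ln_euler_factor (k : nat) (x a : R) : 0 <= x <= 2^-1 -> 0 <= a ->
  let q := x * expR (- a) in
  k != 1%N ->
  x - q - (k%:R * 2 * x ^+ 2 * a) <= ln (euler_factor k x) - ln (euler_factor k q)
    <= x - q + 2 * x ^+ 2 * a.
Proof.
move=> /andP[x0 x2] a0 q k1.
have e1 : expR (- a) <= 1 by rewrite expR_le1 oppr_le0.
have q0 : 0 <= q by rewrite mulr_ge0 ?expR_ge0.
have qx : q <= x by rewrite ler_piMr.
have xq : x - q <= x * a.
  by rewrite /q -{1}[x]mulr1 -mulrBr ler_wpM2l//; have := expR_ge1Dx (- a); lra.
have x1 : 0 < 1 - x by lra.
have q1 : 0 < 1 - q by lra.
have up : ln (1 - q) - ln (1 - x) <= x - q + 2 * x ^+ 2 * a.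
  rewrite -ln_div ?posrE//; apply: le_trans (ln_le_subr1 _) _; first by rewrite divr_gt0.
  rewrite lerBlDr ler_pdivrMr//.
  have h1 := ler_wpM2l x0 xq.
  have h2 : 0 <= x ^+ 2 * a * (1 - 2 * x) by rewrite !mulr_ge0 ?sqr_ge0//; lra.
  by lra.
have lo : x - q <= ln (1 - q) - ln (1 - x).
  rewrite -[leRHS]opprB -ln_div ?posrE// lerNr.
  apply: le_trans (ln_le_subr1 _) _; first by rewrite divr_gt0.
  rewrite lerBlDr ler_pdivrMr//.
  have h1 : 0 <= q * (x - q) by rewrite mulr_ge0// subr_ge0.
  by lra.
case: k k1 => [|[//|k]] _.
  rewrite /euler_factor !lnV ?posrE// !mul0r subr0.
  by rewrite opprK; apply/andP; split; lra.
have pow1 (y : R) : 0 <= y -> y <= 2^-1 -> 0 < 1 - y ^+ k.+2.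
  by move=> y0 y2; rewrite subr_gt0 exprn_ilt1//; lra.
have xk := pow1 _ x0 x2; have qk := pow1 _ q0 (le_trans qx x2).
rewrite /euler_factor !ln_div ?posrE//.
have xk2 : x ^+ k.+2 <= x ^+ 2 by rewrite ler_wiXn2l// (le_trans x2)// invf_le1 ?ler1n.
have xk0 : 0 <= x ^+ k.+2 by rewrite exprn_ge0.
have D0 : x ^+ k.+2 - q ^+ k.+2 <= k.+2%:R * x ^+ 2 * a.
  rewrite /q exprMn -expRM_natl -{1}[x ^+ _]mulr1 -mulrBr.
  rewrite (_ : k.+2%:R * x ^+ 2 * a = x ^+ 2 * (k.+2%:R * a)); last by ring.
  apply: ler_pM => //; last by have := expR_ge1Dx (k.+2%:R * - a); lra.
  by rewrite subr_ge0 expR_le1 mulrN oppr_le0 mulr_ge0.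
have D1 : q ^+ k.+2 <= x ^+ k.+2 by rewrite lerXn2r.
have up' : ln (1 - x ^+ k.+2) - ln (1 - q ^+ k.+2) <= 0.
  by rewrite subr_le0 ler_ln ?posrE// lerD2l lerN2.
have lo' : - (k.+2%:R * 2 * x ^+ 2 * a) <= ln (1 - x ^+ k.+2) - ln (1 - q ^+ k.+2).
  rewrite lerNl opprB -ln_div ?posrE//.
  apply: le_trans (ln_le_subr1 _) _; first by rewrite divr_gt0.
  have x4 : x ^+ 2 <= 2^-1 by nra.
  rewrite lerBlDr ler_pdivrMr//.
  set Y := x ^+ k.+2 in xk xk2 xk0 D0 D1 *; set Z := q ^+ k.+2 in qk D0 D1 *.
  have W0 : 0 <= k.+2%:R * x ^+ 2 * a by rewrite !mulr_ge0 ?sqr_ge0.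
  rewrite (_ : k.+2%:R * 2 * x ^+ 2 * a = 2 * (k.+2%:R * x ^+ 2 * a)); last by ring.
  move: W0 D0; set W := k.+2%:R * x ^+ 2 * a => W0 D0; nra.
apply/andP; split; lra.
Qed.
Lemma euler_prod_gt0 (k N : nat) (c : R) : 0 <= c -> 0 < euler_prod k c N.
Proof.
move=> c0; apply: prodr_gt0 => i _; apply: euler_factor_gt0.
by rewrite tilted_ge0 tilted_prime_lt1// prime_nth_prime.
Qed.
Lemma euler_prod_ge1 (k N : nat) (c : R) : 0 <= c -> k != 1%N -> 1 <= euler_prod k c N.
Proof.
move=> c0 k1; rewrite /euler_prod; elim/big_ind: _ => // [x y x1 y1|i _].
  by rewrite -[leLHS]mulr1 ler_pM.
by apply: euler_factor_ge1 => //; rewrite tilted_ge0 tilted_prime_lt1// prime_nth_prime.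
Qed.
Lemma ln_prod (N : nat) (f : nat -> R) : (forall i, 0 < f i) ->
  ln (\prod_(i < N) f i) = \sum_(i < N) ln (f i).
Proof.
move=> f0; elim: N => [|N IH]; first by rewrite !big_ord0 ln1.
by rewrite !big_ord_recr/= lnM ?posrE ?prodr_gt0// IH.
Qed.
(** By ln_euler_factor, the logarithm of the ratio is the sum over the first N
    primes of 1 / p - 1 / p ^ (1 + c), up to O(c). The general term is
    c (ln p / p) ein_deriv (c ln p), and sum_primes_ein applies. *)
Lemma ln_euler_prod_ein (k N : nat) (c : R) : 0 <= c -> k != 1%N -> (0 < N)%N ->
  `|ln (euler_prod k 0 N) - ln (euler_prod k c N) - ein (c * ln (nth_prime N)%:R)|
    <= c * (mertens_bound + 1 + (4 * k%:R + 4)).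
Proof.
move=> c0 k1 N0; set y := nth_prime N.
have y0 : (0 < y)%N by rewrite /y; case: (N) N0 => // n _; exact: prime_gt0 (prime_nth_prime n).
pose P i := nth_prime i.+1.
have pP i : prime (P i) by exact: prime_nth_prime.
have f0 (d : R) i : 0 <= d -> 0 < euler_factor k (tilted d (P i)).
  by move=> d0; apply: euler_factor_gt0; rewrite tilted_ge0 tilted_prime_lt1.
have lnE (d : R) : 0 <= d ->
    ln (euler_prod k d N) = \sum_(i < N) ln (euler_factor k (tilted d (P i))).
  by move=> d0; rewrite /euler_prod (@ln_prod N (fun i => euler_factor k (tilted d (P i)))) // => i; exact: f0.
rewrite !lnE// -sumrB.
pose F (p : nat) : R := p%:R^-1 - tilted c p.
pose G (p : nat) : R := ln p%:R / (p%:R * p.-1%:R).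
have Fsum : \sum_(i < N) F (P i) = c * \sum_(i < y.-1) prime_coef i.+2 * ein_deriv (c * ln i.+2%:R).
  rewrite /P sum_nth_prime -/y big_mkcond/= mulr_sumr.
  have -> : y = y.-1.+1 by rewrite prednK.
  rewrite big_nat_recl// big_nat_recl//= !add0r big_mkord.
  apply: eq_bigr => i _; rewrite /prime_coef; case: ifP => [pi|]; last by rewrite mul0r mulr0.
  rewrite (_ : c * (ln i.+2%:R / i.+2%:R * ein_deriv (c * ln i.+2%:R)) =
    i.+2%:R^-1 * ((c * ln i.+2%:R) * ein_deriv (c * ln i.+2%:R))); last by ring.
  by rewrite ein_derivM /F /tilted; ring.
have Gsum : \sum_(i < N) G (P i) <= 2 by rewrite /P sum_nth_prime; exact: sum_primes_ln_div.
have S1 : `|\sum_(i < N) F (P i) - ein (c * ln y%:R)| <= c * (mertens_bound + 1).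
  by have := sum_primes_ein y.-1 c0; rewrite Fsum prednK.
have term i : F (P i) - 2 * k%:R * c * G (P i) <=
    ln (euler_factor k (tilted 0 (P i))) - ln (euler_factor k (tilted c (P i))) <=
    F (P i) + 2 * c * G (P i).
  have p0 : 0 < (P i)%:R :> R by rewrite ltr0n prime_gt0.
  have p1 : 0 < (P i).-1%:R :> R by rewrite ltr0n -subn1 subn_gt0 prime_gt1.
  have l0 : 0 <= ln (P i)%:R :> R by exact: ln_prime_ge0.
  have x01 : 0 <= ((P i)%:R^-1 : R) <= 2^-1 by rewrite invr_ge0 ler0n prime_inv_half.
  have a0 : 0 <= c * ln (P i)%:R by rewrite mulr_ge0.
  have /andP[L U] := ln_euler_factor x01 a0 k1.
  rewrite tilted0 /F /tilted.
  have xG : (P i)%:R^-1 ^+ 2 * (c * ln (P i)%:R) <= c * G (P i).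
    rewrite mulrCA ler_wpM2l// mulrC /G ler_wpM2l// exprVn lef_pV2 ?posrE ?mulr_gt0 ?exprn_gt0//.
    by rewrite expr2 ler_pM2l// ler_nat leq_pred.
  move: L U xG; set X := (_ * expR _); set Z := (_ ^+ 2).
  move=> L U xG; apply/andP; split.
    apply: le_trans L; rewrite lerD2l lerN2.
    have := ler_wpM2l (_ : 0 <= 2 * k%:R) xG; rewrite mulr_ge0// => /(_ isT); lra.
  by apply: le_trans U _; rewrite lerD2l; lra.
have c2 : 0 <= c * k%:R by rewrite mulr_ge0.
have lo : \sum_(i < N) F (P i) - 2 * k%:R * c * 2 <=
    \sum_(i < N) (ln (euler_factor k (tilted 0 (P i))) - ln (euler_factor k (tilted c (P i)))).
  apply: (@le_trans _ _ (\sum_(i < N) (F (P i) - 2 * k%:R * c * G (P i)))).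
    have -> : \sum_(i < N) (F (P i) - 2 * k%:R * c * G (P i)) =
        \sum_(i < N) F (P i) - 2 * k%:R * c * \sum_(i < N) G (P i).
      by rewrite mulr_sumr -sumrB.
    by rewrite lerD2l lerN2 ler_wpM2l//; lra.
  by apply: ler_sum => i _; have /andP[] := term i.
have hi : \sum_(i < N) (ln (euler_factor k (tilted 0 (P i))) - ln (euler_factor k (tilted c (P i)))) <=
    \sum_(i < N) F (P i) + 2 * c * 2.
  apply: (@le_trans _ _ (\sum_(i < N) (F (P i) + 2 * c * G (P i)))).
    by apply: ler_sum => i _; have /andP[] := term i.
  have -> : \sum_(i < N) (F (P i) + 2 * c * G (P i)) =
      \sum_(i < N) F (P i) + 2 * c * \sum_(i < N) G (P i).
    by rewrite mulr_sumr -big_split.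
  by rewrite lerD2l ler_wpM2l//; lra.
move: S1; rewrite !ler_norml; lra.
Qed.
Lemma cvg_ln_nth_prime : ln (nth_prime N)%:R @[N --> \oo] --> (+oo : set_system R).
Proof.
apply/cvgryPge => A; near=> N.
have N0 : (0 < N)%N by near: N; exact: nbhs_infty_gt.
have AN : expR A <= N%:R by near: N; exact: nbhs_infty_ger.
rewrite -[A]expRK ler_ln ?posrE ?expR_gt0 ?ltr0n//; last first.
  by rewrite (leq_trans N0)// nth_prime_ge.
by rewrite (le_trans AN)// ler_nat nth_prime_ge.
Unshelve. all: by end_near. Qed.
Lemma cvg_tilt (j : R) : j / ln (nth_prime N)%:R @[N --> \oo] --> (0 : R).
Proof.
rewrite -[X in _ --> X](mulr0 j); apply: cvgMr; apply/gtr0_cvgV0.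
  by have /cvgryPgt/(_ 0) := cvg_ln_nth_prime.
exact: cvg_ln_nth_prime.
Qed.
(** Here c = j / ln p_N tends to 0, so that only Ein survives. *)
Lemma cvg_euler_ratio (k : nat) (j : R) : 0 <= j -> k != 1%N ->
  euler_prod k (j / ln (nth_prime N)%:R) N / euler_prod k 0 N @[N --> \oo] -->
  expR (- ein j).
Proof.
move=> j0 k1; set K := mertens_bound + 1 + (4 * k%:R + 4) : R.
have lnpos : \forall N \near \oo, 0 < ln (nth_prime N)%:R :> R.
  by have /cvgryPgt/(_ 0) := cvg_ln_nth_prime.
have L : ln (euler_prod k 0 N) - ln (euler_prod k (j / ln (nth_prime N)%:R) N) @[N --> \oo] --> ein j.
  apply/cvgrPdist_le => e e0.
  have cK : j / ln (nth_prime N)%:R * K @[N --> \oo] --> (0 : R).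
    by rewrite -[X in _ --> X](mul0r K); apply: cvgMl; exact: cvg_tilt.
  have /cvgrPdist_le /(_ _ e0) H := cK.
  near=> N; have l0 : 0 < ln (nth_prime N)%:R :> R by near: N; exact: lnpos.
  have N0 : (0 < N)%N by near: N; exact: nbhs_infty_gt.
  have c0 : 0 <= j / ln (nth_prime N)%:R by rewrite divr_ge0// ltW.
  have := ln_euler_prod_ein c0 k1 N0; rewrite divfK ?gt_eqF// distrC => /le_trans; apply.
  apply: le_trans (ler_norm _) _; rewrite -normrN -sub0r; near: N; exact: H.
have : expR (- (ln (euler_prod k 0 N) - ln (euler_prod k (j / ln (nth_prime N)%:R) N))) @[N --> \oo] --> expR (- ein j).
  by apply: continuous_cvg; [exact: continuous_expR|exact: cvgN].
move=> H; apply: cvg_trans H; apply: near_eq_cvg; near=> N.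
have l0 : 0 < ln (nth_prime N)%:R :> R by near: N; exact: lnpos.
have c0 : 0 <= j / ln (nth_prime N)%:R by rewrite divr_ge0// ltW.
by rewrite opprB expRB !lnK// posrE euler_prod_gt0.
Unshelve. all: by end_near. Qed.
End EulerRatio.

(** * Summation over the largest prime factor *)

Section Stolz.
Context {R : realType}.
(** The initial 1 stands for the integer 1, which belongs to no layer. *)
Lemma stolz_cesaro (a b : nat -> R) (l : R) :
  (forall i, 0 < b i) ->
  (1 + \sum_(i < N) b i @[N --> \oo] --> +oo) ->
  a i / b i @[i --> \oo] --> l ->
  (1 + \sum_(i < N) a i) / (1 + \sum_(i < N) b i) @[N --> \oo] --> l.
Proof.
move=> b0 Boo abl; apply/cvgrPdist_le => e e0.
pose d i : R := a i - l * b i.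
have e2 : 0 < e / 2 by rewrite divr_gt0.
have /cvgrPdist_le /(_ _ e2) [M _ HM] := abl.
have dM i : (M <= i)%N -> `|d i| <= e / 2 * b i.
  move=> Mi; have bi := b0 i; rewrite -ler_pdivrMr// -[X in _ / X <= _](gtr0_norm bi) -normf_div.
  rewrite /d mulrBl mulfK ?gt_eqF// distrC; exact: HM.
(* K bounds the contribution of the first M terms, for which the ratio is not yet near l. *)
pose K : R := `|1 - l| + \sum_(i < M) `|d i|.
have BN0 N : 0 <= \sum_(i < N) b i by apply: sumr_ge0 => i _; exact: ltW.
have dsum N : (M <= N)%N -> \sum_(i < N) `|d i| <= \sum_(i < M) `|d i| + e / 2 * \sum_(i < N) b i.
  elim: N => [|N IH]; first by rewrite leqn0 => /eqP ->; rewrite !big_ord0 mulr0 addr0.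
  rewrite leq_eqVlt => /predU1P[->|].
    by rewrite lerDl mulr_ge0 ?BN0// ltW.
  rewrite ltnS => MN; have := IH MN; have := dM N MN.
  by rewrite [\sum_(i < N.+1) `|_|]big_ord_recr [\sum_(i < N.+1) b _]big_ord_recr/=; lra.
near=> N.
have MN : (M <= N)%N by near: N; exact: nbhs_infty_ge.
have KB : 2 * K / e <= 1 + \sum_(i < N) b i.
  by near: N; move/cvgryPge: Boo; exact.
set B := 1 + _ in KB *.
have B0 : 0 < B by rewrite /B ltr_pwDl.
rewrite -(ler_pM2r B0) -[X in _ * X <= _](gtr0_norm B0) -normrM mulrBl divfK ?gt_eqF//.
rewrite (_ : _ - _ = - ((1 - l) + \sum_(i < N) d i)); last first.
  by rewrite /d sumrB -mulr_sumr /B; ring.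
rewrite normrN; apply: le_trans (ler_normD _ _) _.
apply: le_trans (lerD (lexx _) (ler_norm_sum _ _ _)) _.
have := dsum N MN; move: KB; rewrite ler_pdivrMr// => KB.
by rewrite /K in KB; rewrite /B; rewrite /B in KB; lra.
Unshelve. all: by end_near. Qed.
End Stolz.
Section EulerSums.
Context {R : realType}.
Lemma ein_nat_ge (n : nat) : (0 < n)%N -> ln n%:R - 1 <= ein n%:R :> R.
Proof.
move=> n0; have /andP[_ H] := @harmonic_ein R n n0.
have : n%:R^-1 <= 1 :> R by rewrite invf_le1 ?ltr0n// ler1n.
have : ln n.+1%:R <= \sum_(1 <= k < n.+1) k%:R^-1 :> R.
  rewrite -sum_ln_diff big_add1/= big_mkord; apply: ler_sum => i _.
  exact: ln_succ_le.
have : ln n%:R <= ln n.+1%:R :> R by rewrite ler_ln ?posrE ?ltr0n// ler_nat.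
by lra.
Qed.
(** The numerator in cvg_euler_ratio is at least 1, so for every n the product
    eventually exceeds exp (Ein n) / 2, where exp (Ein n) >= n / e. *)
Lemma cvg_euler_prod_oo (k : nat) : k != 1%N ->
  euler_prod k (0 : R) N @[N --> \oo] --> +oo.
Proof.
move=> k1; apply/cvgryPge => A.
(* n is chosen for exp (Ein n) >= n / e to reach 2 A. *)
pose n := (Num.bound (2 * expR 1 * Num.max A 0)).+1.
have n0 : 0 < n%:R :> R by rewrite ltr0n.
have nA : 2 * expR 1 * Num.max A 0 <= n%:R :> R.
  apply: ltW; apply: lt_le_trans (archi_boundP _) _; last by rewrite ler_nat.
  by rewrite !mulr_ge0 ?expR_ge0// le_max lexx orbT.
have H := cvg_euler_ratio (ltW n0) k1.
have H2 : expR (- ein n%:R) < 2 * expR (- ein n%:R) :> R.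
  by have := expR_gt0 (- ein n%:R : R); lra.
near=> N.
have c0 : 0 <= n%:R / ln (nth_prime N)%:R :> R.
  by rewrite divr_ge0// ltW//; near: N; have /cvgryPgt/(_ 0) := @cvg_ln_nth_prime R.
have g1 := euler_prod_ge1 N c0 k1.
have p0 := euler_prod_gt0 k N (lexx (0 : R)).
have : euler_prod k (n%:R / ln (nth_prime N)%:R) N / euler_prod k 0 N <= 2 * expR (- ein n%:R) :> R.
  by near: N; exact: (cvgr_le _ H).
rewrite ler_pdivrMr// => H3.
have E : n%:R <= expR 1 * expR (ein n%:R) :> R.
  rewrite -expRD -{1}(lnK (_ : n%:R \in Num.pos)) ?posrE// ler_expR.
  by have := @ein_nat_ge n isT; lra.
have e0 := expR_gt0 (ein n%:R : R).
have e1 := expRxMexpNx_1 (ein n%:R : R).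
have A1 : A <= Num.max A 0 by rewrite le_max lexx.
have E1 : expR 1 * (2 * Num.max A 0) <= expR 1 * expR (ein n%:R) by lra.
rewrite ler_pM2l ?expR_gt0// in E1.
have H4 : expR (ein n%:R) <= 2 * euler_prod k 0 N :> R.
  have := ler_wpM2l (ltW e0) (le_trans g1 H3); rewrite mulr1.
  rewrite (_ : _ * (_ * _ * _) = (expR (ein n%:R) * expR (- ein n%:R)) * (2 * euler_prod k 0 N)); last by ring.
  by rewrite e1 mul1r.
lra.
Unshelve. all: by end_near. Qed.
(** The correction due to power-freeness in the last Euler factor; it tends to 1
    as x tends to 0. *)
Definition last_factor (k : nat) (x : R) : R :=
  if k is l.+2 then (1 - x ^+ l.+1) / (1 - x ^+ l.+2) else 1.
Lemma last_factorE (k : nat) (x : R) : k != 1%N -> 0 <= x < 1 ->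
  1 - (euler_factor k x)^-1 = x * last_factor k x.
Proof.
move=> k1 /andP[x0 x1]; case: k k1 => [|[//|k]] _; rewrite /euler_factor /last_factor.
  by rewrite invrK mulr1; ring.
have h1 : 0 < 1 - x ^+ k.+2 by rewrite subr_gt0 exprn_ilt1.
have h2 : 0 < 1 - x by rewrite subr_gt0.
rewrite invf_div mulrA -[X in X - _](@divff _ (1 - x ^+ k.+2)) ?gt_eqF// -mulrBl.
by congr (_ / _); rewrite [x ^+ k.+2]exprS; ring.
Qed.
Lemma last_factor_gt0 (k : nat) (x : R) : 0 <= x < 1 -> 0 < last_factor k x.
Proof.
move=> /andP[x0 x1]; case: k => [|[|k]] //=; rewrite divr_gt0// subr_gt0 exprn_ilt1//.
Qed.
Lemma cvg_last_factor (k : nat) (x : nat -> R) :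
  x @ \oo --> (0 : R) -> last_factor k (x n) @[n --> \oo] --> (1 : R).
Proof.
move=> x0; case: k => [|[|k]] /=; [exact: cvg_cst..|].
have H m : 1 - x n ^+ m.+1 @[n --> \oo] --> (1 : R).
  rewrite -[X in _ --> X](subr0 1); apply: cvgB; first exact: cvg_cst.
  have C : {for 0, continuous (fun y : R => y ^+ m.+1)} by exact: exprn_continuous.
  by have X := continuous_cvg _ C x0; rewrite expr0n in X; exact: X.
rewrite -[X in _ --> X](divr1 1); apply: cvgM; first exact: H.
by apply: cvgV; [exact: oner_neq0|exact: H].
Qed.
(** The exponent c for which n ^ (- c) = exp (- j ln n / ln p) at p = p_(i+1): the
    Laplace kernel at integers whose largest prime factor is p. *)
Definition tilt (j : R) (i : nat) : R := j / ln (nth_prime i.+1)%:R.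
(** The contribution to the Euler product of the integers whose largest prime
    factor is p_(i+1). *)
Definition layer (k : nat) (c : R) (i : nat) : R := euler_prod k c i.+1 - euler_prod k c i.
Lemma layerE (k : nat) (c : R) (i : nat) : k != 1%N -> 0 <= c ->
  layer k c i = euler_prod k c i.+1 *
    (tilted c (nth_prime i.+1) * last_factor k (tilted c (nth_prime i.+1))).
Proof.
move=> k1 c0; have q01 : 0 <= tilted c (nth_prime i.+1) < 1.
  by rewrite tilted_ge0 tilted_prime_lt1// prime_nth_prime.
rewrite -last_factorE// /layer /euler_prod big_ord_recr/= mulrBr mulr1.
by rewrite mulfK// gt_eqF// euler_factor_gt0.
Qed.
Lemma sum_layer (k N : nat) (c : R) : 1 + \sum_(i < N) layer k c i = euler_prod k c N.
Proof.
elim: N => [|N IH]; first by rewrite big_ord0 addr0 /euler_prod big_ord0.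
by rewrite big_ord_recr/= addrA IH /layer; ring.
Qed.
(** By the Stolz-Cesaro theorem it suffices to compare the layers one by one. The
    prime p itself contributes exp (- j), as ln p / ln p = 1: this is the shift in
    D + 1. The cofactor contributes a ratio of Euler products, hence
    exp (- Ein j). *)
Lemma cvg_layers (k : nat) (j : R) : 0 <= j -> k != 1%N ->
  (1 + \sum_(i < N) layer k (tilt j i) i) / euler_prod k 0 N @[N --> \oo] -->
  expR (- j) * expR (- ein j).
Proof.
move=> j0 k1.
under eq_cvg do rewrite -(sum_layer k _ 0).
have ln0 i : 0 < ln (nth_prime i.+1)%:R :> R.
  by rewrite ln_gt0// ltr1n prime_gt1// prime_nth_prime.
have c0 i : 0 <= tilt j i by rewrite divr_ge0// ltW.
have p01 (c : R) i : 0 <= c -> 0 <= tilted c (nth_prime i.+1) < 1.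
  by move=> cc; rewrite tilted_ge0 tilted_prime_lt1// prime_nth_prime.
have t0 (c : R) i : 0 < tilted c (nth_prime i.+1).
  by rewrite mulr_gt0 ?expR_gt0// invr_gt0 ltr0n prime_gt0// prime_nth_prime.
have xto0 (c : nat -> R) : (forall i, 0 <= c i) -> tilted (c i) (nth_prime i.+1) @[i --> \oo] --> (0 : R).
  move=> cc; apply: (@squeeze_cvgr _ _ _ _ (fun=> 0) (fun i : nat => i.+1%:R^-1)) => //.
  - apply: nearW => i; rewrite tilted_ge0/=.
    apply: le_trans (tilted_le (cc i) (prime_gt0 (prime_nth_prime i))) _.
    have pi : (0 : R) < (nth_prime i.+1)%:R by rewrite ltr0n prime_gt0// prime_nth_prime.
    by rewrite lef_pV2 ?posrE// ler_nat nth_prime_ge.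
  - exact: cvg_cst.
  - have := @cvg_harmonic R; exact.
apply: (@stolz_cesaro R (fun i => layer k (tilt j i) i) (layer k 0)).
- move=> i; rewrite layerE// mulr_gt0 ?euler_prod_gt0// mulr_gt0// last_factor_gt0//; exact: p01.
- by under eq_cvg do rewrite sum_layer; exact: cvg_euler_prod_oo.
- have E i : layer k (tilt j i) i / layer k 0 i =
      euler_prod k (tilt j i) i.+1 / euler_prod k 0 i.+1 * expR (- j) *
      (last_factor k (tilted (tilt j i) (nth_prime i.+1)) / last_factor k (tilted 0 (nth_prime i.+1))).
    rewrite !layerE//.
    have -> : tilted (tilt j i) (nth_prime i.+1) = tilted 0 (nth_prime i.+1) * expR (- j).
      by rewrite tilted0 /tilted /tilt divfK ?gt_eqF.
    field; rewrite !gt_eqF ?euler_prod_gt0 ?last_factor_gt0//; exact: p01.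
  under eq_cvg do rewrite E.
  have -> : expR (- j) * expR (- ein j) = expR (- ein j) * expR (- j) * 1 by ring.
  apply: cvgM.
    apply: cvgM; last exact: cvg_cst.
    have := cvg_euler_ratio j0 k1; rewrite -cvg_shiftS; exact.
  have -> : 1 = 1 / 1 :> R by rewrite divr1.
  apply: cvgM; first exact: cvg_last_factor (xto0 _ c0).
  apply: cvgV; first exact: oner_neq0.
  exact: cvg_last_factor (xto0 (fun=> 0) (fun=> lexx _)).
Qed.
End EulerSums.

(** * The laws of the random integer *)

Section CountableIntegral.
Local Open Scope ereal_scope.

Context {R : realType}.
Lemma integral_nat (mu : {measure set nat -> \bar R}) (g : nat -> R) :
  (forall n, 0 <= g n)%R ->
  \int[mu]_n (g n)%:E = \esum_(n in setT) ((g n)%:E * mu [set n]).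
Proof.
move=> g0; have cover : setT = \bigcup_n [set n] :> set nat.
  by apply/seteqP; split => // n _; exists n.
rewrite cover ge0_integral_bigcup//=; last 2 first.
- by move=> n _; rewrite lee_fin.
- by move=> i j _ _ [n [/= -> ->]].
rewrite nneseries_esumT; last by move=> n; apply: integral_ge0 => m _; rewrite lee_fin.
rewrite -cover; apply: eq_esum => n _.
rewrite (eq_integral (cst (g n)%:E)); last by move=> m; rewrite inE => ->.
by rewrite integral_cst.
Qed.
End CountableIntegral.
Section Laws.
Context {R : realType}.
Definition law (k N : nat) : probability nat R :=
  if k is 0 then P_ R N else P_free R k N.
Lemma esum_Omega_free (k N : nat) (c : R) : (0 <= c)%R ->
  (\esum_(n in Omega_free k N) (tilted c n)%:E = (euler_prod k c N)%:E)%E.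
Proof.
move=> c0; apply: euler_product.
- exact: tilted_ge0.
- exact: tilted1.
- exact: tiltedM.
- by move=> p; exact: tilted_prime_lt1.
Qed.
Lemma esum_Omega_free0 (k N : nat) :
  (\esum_(n in Omega_free k N) (n%:R^-1 : R)%:E = (euler_prod k 0 N)%:E)%E.
Proof.
rewrite -(esum_Omega_free k N (lexx 0)); apply: eq_esum => n _.
by rewrite tilted0.
Qed.
Lemma C_E (N : nat) : C_ R N = (euler_prod 0 0 N)%:E.
Proof. by rewrite -esum_Omega_free0 /Omega_free setIT. Qed.
Lemma lawE (k N : nat) (A : set nat) :
  (law k N A = (\esum_(n in A `&` Omega_free k N) (n%:R^-1 : R)%:E) *
    ((euler_prod k 0 N)^-1)%:E)%E.
Proof.
case: k => [|k]; first by rewrite /law P_E C_E /Omega_free setIT.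
have c0 := euler_prod_gt0 0 N (lexx (0 : R)).
have ck := euler_prod_gt0 k.+1 N (lexx (0 : R)).
rewrite /law cond_probE; last exact: P_kfree_gt0.
have E2 : kfree k.+1 `&` Omega N = Omega_free k.+1 N by rewrite setIC.
have E1 : A `&` kfree k.+1 `&` Omega N = A `&` Omega_free k.+1 N by rewrite -setIA E2.
rewrite !P_E C_E E1 E2 esum_Omega_free0 -EFinM/= -muleA -EFinM; congr (_ * _%:E)%E.
by field; rewrite !gt_eqF.
Qed.
Lemma law_set1 (k N n : nat) : (law k N [set n] =
  (if n \in Omega_free k N then n%:R^-1 / euler_prod k 0 N : R else 0)%:E)%E.
Proof.
rewrite lawE; case: ifPn => [|].
  rewrite inE => nO; rewrite (_ : _ `&` _ = [set n]); last first.
    by apply/seteqP; split => [m []//|m ->].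
  by rewrite esum_set1.
rewrite notin_setE => nO; rewrite (_ : _ `&` _ = set0) ?esum_set0 ?mul0e//.
by apply/seteqP; split => [m [-> ]|].
Qed.
Lemma integral_law (k N : nat) (g : nat -> R) : (forall n, 0 <= g n) ->
  (\int[law k N]_n (g n)%:E =
   (\esum_(n in Omega_free k N) (n%:R^-1 * g n)%:E) * ((euler_prod k 0 N)^-1)%:E)%E.
Proof.
move=> g0; rewrite integral_nat// muleC -esumZl; last 2 first.
- by rewrite invr_ge0 ltW// euler_prod_gt0.
- by move=> n; rewrite mulr_ge0 ?invr_ge0.
rewrite [RHS]esum_mkcond; apply: eq_esum => n _.
transitivity ((g n)%:E * (if n \in Omega_free k N then n%:R^-1 / euler_prod k 0 N : R else 0)%:E)%E.
  by congr (_ * _)%E; exact: law_set1.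
by case: ifP => _; rewrite -EFinM ?mulr0//; congr EFin; ring.
Qed.
Lemma max_pdiv_layer (k N n : nat) : Omega_free k N.+1 n -> ~ Omega_free k N n ->
  max_pdiv n = nth_prime N.+1.
Proof.
move=> [[n0 nP] nk] nN; have pp := prime_nth_prime N.
have pn : (nth_prime N.+1 %| n)%N.
  apply: contra_notT nN => pn; split => //; split => // j.
  by rewrite leq_eqVlt => /predU1P[<-//|]; exact: nP.
have n1 : (1 < n)%N by rewrite (leq_trans (prime_gt1 pp))// dvdn_leq.
apply/eqP; rewrite eqn_leq; apply/andP; split; last first.
  by apply: max_pdiv_max; rewrite mem_primes pp n0.
have [j j0 jE] := (nth_primeP _).1 (max_pdiv_prime n1).
have := max_pdiv_dvd n; rewrite -jE.
have [/nP/negP//|jN _] := ltnP N.+1 j.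
by move: jN; rewrite leq_eqVlt => /predU1P[->//|/nth_prime_lt/ltnW].
Qed.
(** On the layer of p_(i+1) the Laplace kernel is n ^ (- tilt j i), which is
    multiplicative. *)
Lemma esum_laplace_log_ratio (k N : nat) (j : R) : 0 <= j ->
  (\esum_(n in Omega_free k N) (n%:R^-1 * expR (- (j * log_ratio R n)))%:E =
   (1 + \sum_(i < N) layer k (tilt j i) i)%:E)%E.
Proof.
move=> j0; elim: N => [|N IH].
  rewrite Omega_free0E big_ord0 addr0 esum_set1 ?lee_fin ?mulr_ge0 ?expR_ge0//.
  by rewrite /log_ratio ln1 mul0r mulr0 oppr0 expR0 invr1 mulr1.
have sub : Omega_free k N `<=` Omega_free k N.+1.
  by move=> n [nO nk]; split => //; exact: OmegaS.
have c0 : 0 <= tilt j N.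
  by rewrite divr_ge0// ln_ge0// ler1n prime_gt0// prime_nth_prime.
have g0 n : 0 <= n%:R^-1 * expR (- (j * log_ratio R n)) by rewrite mulr_ge0 ?expR_ge0.
rewrite (esumID (Omega_free k N)); last by move=> n _; rewrite lee_fin.
rewrite setIC setIidl// IH big_ord_recr/= addrA [RHS]EFinD; congr (_ + _)%E.
have := esum_Omega_free k N.+1 c0.
rewrite (esumID (Omega_free k N)); last by move=> n _; rewrite lee_fin tilted_ge0.
rewrite setIC setIidl// esum_Omega_free// => E.
rewrite /layer EFinB -E addeAC subee// add0e.
apply: eq_esum => n [nN /= nN']; congr EFin.
have n0 : (0 < n)%N by have [[]] := nN.
rewrite /tilted /log_ratio (max_pdiv_layer nN nN') /tilt; congr (_ * expR (- _)).
by rewrite mulrCA mulrA [RHS]mulrAC; ring.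
Qed.
Lemma log_ratio_ge0 (n : nat) : 0 <= log_ratio R n.
Proof.
case: n => [|n]; first by rewrite /log_ratio ln0 ?mul0r.
by rewrite divr_ge0// ln_ge0// ler1n// max_pdiv_gt0.
Qed.
Lemma cvg_laplace_log_ratio (k j : nat) : k != 1%N ->
  (\int[law k N]_n expR (- (j%:R * log_ratio R n)))%R @[N --> \oo] -->
  expR (- j%:R) * expR (- ein j%:R).
Proof.
move=> k1; under eq_cvg => N do
  rewrite /Rintegral integral_law ?esum_laplace_log_ratio//.
exact: cvg_layers.
Qed.
End Laws.

(** * Weak convergence of the ratio of logarithms *)

Section Limit.
Context {R : realType} (rho : R -> R) (hrho : is_dickman_function rho).
Context d (T : measurableType d) (P : probability T R) (D : {RV P >-> R}).
Hypothesis hD : has_dickman_distribution rho D.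
Local Notation mu := (@lebesgue_measure R).
Let Y (w : T) : R := Num.max (D w + 1) 0.
Let mD1 : measurable_fun setT (fun w => D w + 1).
Proof. by apply: measurable_funD => //; exact: measurable_funPT. Qed.
Let mY : measurable_fun setT Y.
Proof. exact: measurable_maxr. Qed.
(** Both Laplace transforms at j are exp (- j - Ein j) in the limit. *)
Lemma cvg_log_ratio_expectation (k : nat) (f : R -> R) : k != 1%N ->
  bounded_continuous f ->
  (\int[law k N]_n f (log_ratio R n))%R @[N --> \oo] --> (\int[P]_w f (Y w))%R.
Proof.
move=> k1 bf; apply: (laplace_weak_cvg mY) => //.
- by move=> w; rewrite le_max lexx orbT.
- exact: log_ratio_ge0.
- move=> j; rewrite (dickman_rv_laplace hrho hD).
  exact: cvg_laplace_log_ratio.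
Qed.
Lemma dickman_rv_nonneg : P [set w | D w < 0] = 0%E.
Proof.
have mI : measurable (`]-oo, 0[%classic : set R) by [].
have := hD mI; rewrite (_ : `]-oo, 0[ `&` `[0, +oo[ = set0 :> set R) ?integral_set0.
  move=> <-; congr (P _); apply/seteqP; split => w /=; by rewrite in_itv.
apply/seteqP; split => // x [] /=; rewrite !in_itv/= andbT => x0.
by rewrite leNgt x0.
Qed.
Lemma expectation_clip (f : R -> R) : bounded_continuous f ->
  (\int[P]_w (f (D w + 1))%:E = \int[P]_w (f (Y w))%:E)%E.
Proof.
move=> bf; apply: ae_eq_integral => //.
- by apply/measurable_EFinP; exact: (measurable_bounded_continuous mD1 bf).
- by apply/measurable_EFinP; exact: (measurable_bounded_continuous mY bf).
- exists [set w | D w < 0]; split.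
  + have := @measurable_funPT _ _ _ _ D measurableT `]-oo, 0[%classic.
    rewrite setTI (_ : _ @^-1` _ = [set w | D w < 0]); first by apply; exact: measurable_itv.
    by apply/seteqP; split => w /=; rewrite in_itv.
  + exact: dickman_rv_nonneg.
  + move=> w /=; apply: contra_notP => /negP; rewrite -leNgt => D0 _.
    by rewrite /Y max_l// addr_ge0.
Qed.
Lemma weak_cvg_log_ratio (k : nat) : k != 1%N ->
  weak_cvg (fun N => distribution (law k N) (log_ratio R)) (distribution P (D \+ cst 1)).
Proof.
move=> k1 f cf bf; have bcf : bounded_continuous f by split.
have mf : measurable_fun setT f by exact: continuous_measurable_fun.
have mlr : measurable_fun setT (log_ratio R) by [].
rewrite integral_distribution; last 2 first.
- exact/measurable_EFinP.
- exact: (integrable_bounded_continuous P mD1 bcf).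
have -> : (\int[P]_x ((fun x => (f x)%:E) \o ((D \+ cst 1)%R : T -> R)) x = ((\int[P]_w f (Y w))%R)%:E)%E.
  by rewrite -(EFin_Rintegral P mY bcf) -expectation_clip.
under eq_cvg => N.
  rewrite integral_distribution; last 2 first.
  - exact/measurable_EFinP.
  - exact: (integrable_bounded_continuous (law k N) mlr bcf).
  rewrite (EFin_Rintegral (law k N) mlr bcf).
  over.
by apply: cvg_EFin; [exact: nearW|exact: cvg_log_ratio_expectation].
Qed.
End Limit.

(** * Convergence of the tails *)

Section TailBounds.
Context {R : realType} d (T : measurableType d) (P : probability T R) (X : T -> R).
Hypothesis mX : measurable_fun setT X.
Lemma measurable_tail (a : R) : measurable [set w | a <= X w].
Proof.
have := mX measurableT (measurable_itv `[a, +oo[).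
by rewrite setTI (_ : _ @^-1` _ = [set w | a <= X w])//; apply/seteqP; split => w /=; rewrite in_itv/= andbT.
Qed.
Let tailE (a : R) : fine (P [set w | a <= X w]) = (\int[P]_w \1_[set w | a <= X w] w)%R.
Proof.
rewrite /Rintegral integral_indic//; last exact: measurable_tail.
by rewrite setIT.
Qed.
Let integrable_tail (a : R) : P.-integrable setT (EFin \o \1_[set w | a <= X w]).
Proof.
apply: measurable_bounded_integrable => //.
- exact: le_lt_trans (probability_le1 P measurableT) (ltry _).
- exact: measurable_indic (measurable_tail a).
- exists 1; split => // M M1 w _ /=; rewrite indicE.
  by case: (_ \in _); rewrite ?normr1 ?normr0 ltW// (lt_trans _ M1).
Qed.
Lemma tail_le_expectation (a : R) (f : R -> R) : bounded_continuous f ->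
  (forall x, 0 <= f x) -> (forall x, a <= x -> 1 <= f x) ->
  fine (P [set w | a <= X w]) <= (\int[P]_w f (X w))%R.
Proof.
move=> bf f0 f1; rewrite tailE; apply: le_Rintegral => //.
  exact: integrable_bounded_continuous.
move=> w _; rewrite indicE; case: (boolP (_ \in _)) => [|_]; last exact: f0.
by rewrite inE; exact: f1.
Qed.
Lemma expectation_le_tail (a : R) (f : R -> R) : bounded_continuous f ->
  (forall x, f x <= 1) -> (forall x, x < a -> f x <= 0) ->
  (\int[P]_w f (X w))%R <= fine (P [set w | a <= X w]).
Proof.
move=> bf f1 f0; rewrite tailE; apply: le_Rintegral => //.
  exact: integrable_bounded_continuous.
move=> w _; rewrite indicE; case: (boolP (_ \in _)) => [_|]; first exact: f1.
by rewrite notin_setE /= => /negP; rewrite -ltNge; exact: f0.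
Qed.
End TailBounds.
Section Ramp.
Context {R : realType}.
(** A continuous stand-in for the indicator of [a, +oo[. *)
Definition ramp (a e x : R) : R := Num.min 1 (Num.max 0 ((x - a) / e)).
Lemma ramp_bounds (a e x : R) : 0 <= ramp a e x <= 1.
Proof. by rewrite /ramp le_min ler01 le_max lexx/= ge_min lexx. Qed.
Lemma bounded_continuous_ramp (a e : R) : bounded_continuous (ramp a e).
Proof.
split; last by exists 1 => x; have /andP[r0 r1] := ramp_bounds a e x; rewrite ger0_norm.
move=> x.
have c1 : {for x, continuous (fun y : R => (y - a) / e)}.
  by apply: cvgMl; apply: cvgB; [exact: cvg_id|exact: cvg_cst].
have c2 : {for x, continuous (fun y : R => Num.max 0 ((y - a) / e))}.
  by apply: continuous_max => //; exact: cvg_cst.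
have c3 : {for x, continuous (fun y : R => Num.min 1 (Num.max 0 ((y - a) / e)))}.
  by apply: continuous_min => //; exact: cvg_cst.
exact: c3.
Qed.
Lemma ramp_eq1 (a e x : R) : 0 < e -> a + e <= x -> ramp a e x = 1.
Proof.
move=> e0 ax; have h : 1 <= (x - a) / e by rewrite ler_pdivlMr// mul1r; lra.
by rewrite /ramp max_r ?(le_trans ler01)// min_l.
Qed.
Lemma ramp_eq0 (a e x : R) : 0 < e -> x <= a -> ramp a e x = 0.
Proof.
move=> e0 xa; have h : (x - a) / e <= 0 by rewrite ler_pdivrMr// mul0r; lra.
by rewrite /ramp max_l// min_r.
Qed.
End Ramp.
Section Tail.
Context {R : realType} (rho : R -> R) (hrho : is_dickman_function rho).
Context d (T : measurableType d) (P : probability T R) (D : {RV P >-> R}).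
Hypothesis hD : has_dickman_distribution rho D.
Local Notation mu := (@lebesgue_measure R).
Let Y (w : T) : R := Num.max (D w + 1) 0.
Let mD : measurable_fun setT (fun w => D w : R).
Proof. exact: measurable_funPT. Qed.
Let mY : measurable_fun setT Y.
Proof. by apply: measurable_maxr => //; exact: measurable_funD. Qed.
Let c := expR (- euler_gamma R).
Let c0 : 0 < c. Proof. exact: expR_gt0. Qed.
Lemma dickman_tail (a : R) : 0 <= a ->
  (P [set w | (a <= D w)%R] = c%:E * \int[mu]_(x in `[a, +oo[) (rho x)%:E)%E.
Proof.
move=> a0; have mI : measurable (`[a, +oo[%classic : set R) by [].
have sub : (`[a, +oo[%classic : set R) `<=` `[0, +oo[.
  by move=> x /=; rewrite !in_itv/= !andbT; exact: le_trans.
have mr : measurable_fun `]a, +oo[ (dickman_ext rho : measurableTypeR R -> R).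
  by apply: measurable_funTS; exact: measurable_dickman_ext.
have rr (x : R) : x \in `]a, +oo[%classic -> rho x = dickman_ext rho x.
  by rewrite inE/= in_itv/= andbT => ax; rewrite dickman_extE// (le_lt_trans a0).
have mrho : measurable_fun `]a, +oo[ (rho : measurableTypeR R -> R).
  by apply: eq_measurable_fun mr => x xa; rewrite rr.
have Ir : (\int[mu]_(x in `[a, +oo[) (rho x)%:E = \int[mu]_(x in `]a, +oo[) (dickman_ext rho x)%:E)%E.
  rewrite -integral_itv_obnd_cbnd; last exact/measurable_EFinP.
  by apply: eq_integral => x xa; rewrite rr.
have := hD mI; rewrite setIidl// => E.
transitivity (distribution P D `[a, +oo[%classic).
  by congr (P _); apply/seteqP; split => w /=; rewrite in_itv/= andbT.
rewrite E -integral_itv_obnd_cbnd; last first.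
  by apply/measurable_EFinP; exact: measurable_funM.
rewrite (eq_integral (fun x : measurableTypeR R => (c%:E * (dickman_ext rho x)%:E)%E)); last first.
  by move=> x xa; rewrite rr.
rewrite ge0_integralZl.
- by rewrite Ir.
- by [].
- exact/measurable_EFinP.
- by move=> x _; rewrite lee_fin ltW// dickman_ext_gt0.
- by rewrite lee_fin ltW.
Qed.
Let tail (a : R) : R := fine (P [set w | (a <= D w)%R]).
(** The density of D is at most c. *)
Lemma dickman_tail_lip (a b : R) : a <= b -> tail b <= tail a <= tail b + c * (b - a).
Proof.
move=> ab; have mt := measurable_tail mD.
have mI : measurable (`[a, b[%classic : set R) by [].
have Pab : (P (D @^-1` `[a, b[%classic) <= (c * (b - a))%:E)%E.
  have := hD mI; rewrite (integral_dickman_pdf hrho mI) => E.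
  rewrite [leLHS](_ : _ = distribution P D `[a, b[%classic)// E.
  apply: (@le_trans _ _ (\int[mu]_(x in `[a, b[) (cst c%:E x))%E).
    apply: ge0_le_integral => //.
    - by move=> x _; rewrite lee_fin dickman_pdf_ge0.
    - apply/measurable_EFinP; apply: measurable_funTS; exact: measurable_dickman_pdf.
    - move=> x _; rewrite lee_fin /dickman_pdf; case: ifP => _; last exact: ltW.
      by rewrite ler_piMr ?(ltW c0)// dickman_ext_le1.
  rewrite integral_cst//= lebesgue_measure_itv/= lte_fin.
  case: ifP => _; first by rewrite -EFinD -EFinM.
  by rewrite mule0 lee_fin mulr_ge0 ?(ltW c0)// subr_ge0.
have setE : [set w | (a <= D w)%R] = [set w | (b <= D w)%R] `|` D @^-1` `[a, b[%classic.
  apply/seteqP; split => w /=; rewrite in_itv/=.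
    by move=> aw; have [bw|bw] := leP b (D w); [left|right; rewrite aw].
  by move=> [|/andP[]//]; exact: le_trans.
have mab : measurable (D @^-1` `[a, b[%classic) by rewrite -[X in measurable X]setTI; exact: mD.
have U : (P [set w | (a <= D w)%R] = P [set w | (b <= D w)%R] + P (D @^-1` `[a, b[%classic))%E.
  have disj : [set w | (b <= D w)%R] `&` D @^-1` `[a, b[%classic = set0.
    by apply/seteqP; split => // w /= []; rewrite in_itv/= => bw /andP[_]; rewrite ltNge bw.
  rewrite setE; exact: (measureU P (mt b) mab disj).
have fin A : measurable A -> P A \is a fin_num by move=> mA; exact: fin_num_measure.
have -> : tail a = tail b + fine (P (D @^-1` `[a, b[%classic)).
  by rewrite /tail U fineD// fin//; exact: mt.
rewrite lerDl fine_ge0//= lerD2l -lee_fin fineK//; exact: fin.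
Qed.
Let clipE (a : R) : 0 < a -> fine (P [set w | (a <= Y w)%R]) = tail (a - 1).
Proof.
move=> a0; congr (fine (P _)); apply/seteqP; split => w /=; rewrite /Y le_max lerBlDr.
  by move=> /orP[//|]; rewrite leNgt a0.
by move=> ->.
Qed.
(** The indicator of [s, +oo[ lies between two ramps of width dl, whose
    expectations converge; by dickman_tail_lip they differ from the tail by at most
    c dl in the limit. *)
Lemma cvg_log_ratio_tail (k : nat) (s : R) : k != 1%N -> 1 <= s ->
  fine (law k N [set n | s <= log_ratio R n]) @[N --> \oo] -->
  fine (P [set w | (s - 1 <= D w)%R]).
Proof.
move=> k1 s1; rewrite -/(tail (s - 1)); apply/cvgrPdist_le => e e0.
have [dl [dl0 dl1 dle]] : exists dl, [/\ 0 < dl, dl < 1 & c * dl <= e / 2].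
  exists (Num.min (2^-1) (e / (2 * c))); split.
  - by rewrite lt_min invr_gt0 ltr0n/= divr_gt0// mulr_gt0.
  - by rewrite gt_min invf_lt1 ?ltr1n.
  - apply: (@le_trans _ _ (c * (e / (2 * c)))).
      by rewrite ler_pM2l// ge_min lexx orbT.
    by rewrite le_eqVlt; apply/orP; left; apply/eqP; field; rewrite gt_eqF.
have e2 : 0 < e / 2 by rewrite divr_gt0.
have mlr : measurable_fun setT (log_ratio R) by [].
have bl := bounded_continuous_ramp s dl.
have bu := bounded_continuous_ramp (s - dl) dl.
have /cvgrPdist_le /(_ _ e2) Hl := cvg_log_ratio_expectation hrho hD k1 bl.
have /cvgrPdist_le /(_ _ e2) Hu := cvg_log_ratio_expectation hrho hD k1 bu.
have lo : tail (s - 1) - e / 2 <= (\int[P]_w ramp s dl (Y w))%R.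
  apply: (@le_trans _ _ (fine (P [set w | (s + dl <= Y w)%R]))).
    rewrite clipE; last by lra.
    have /andP[_] := @dickman_tail_lip (s - 1) (s + dl - 1) (ltac:(lra)).
    by rewrite (_ : s + dl - 1 - (s - 1) = dl); lra.
  apply: tail_le_expectation => // x; first by have /andP[] := ramp_bounds s dl x.
  by move=> sx; rewrite ramp_eq1.
have hi : (\int[P]_w ramp (s - dl) dl (Y w))%R <= tail (s - 1) + e / 2.
  apply: (@le_trans _ _ (fine (P [set w | (s - dl <= Y w)%R]))).
    apply: expectation_le_tail => // x; first by have /andP[] := ramp_bounds (s - dl) dl x.
    by move=> sx; rewrite ramp_eq0// ltW.
  rewrite clipE; last by lra.
  have /andP[_] := @dickman_tail_lip (s - dl - 1) (s - 1) (ltac:(lra)).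
  by rewrite (_ : s - 1 - (s - dl - 1) = dl); lra.
near=> N.
have lN : (\int[law k N]_n ramp s dl (log_ratio R n))%R <= fine (law k N [set n | s <= log_ratio R n]).
  apply: expectation_le_tail => // x; first by have /andP[] := ramp_bounds s dl x.
  by move=> sx; rewrite ramp_eq0// ltW.
have uN : fine (law k N [set n | s <= log_ratio R n]) <= (\int[law k N]_n ramp (s - dl) dl (log_ratio R n))%R.
  apply: tail_le_expectation => // x; first by have /andP[] := ramp_bounds (s - dl) dl x.
  by move=> sx; rewrite ramp_eq1// subrK.
have hl : `|(\int[P]_w ramp s dl (Y w))%R - (\int[law k N]_n ramp s dl (log_ratio R n))%R| <= e / 2.
  by near: N; exact: Hl.
have hu : `|(\int[P]_w ramp (s - dl) dl (Y w))%R - (\int[law k N]_n ramp (s - dl) dl (log_ratio R n))%R| <= e / 2.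
  by near: N; exact: Hu.
move: hl hu; rewrite !ler_norml; lra.
Unshelve. all: by end_near. Qed.
End Tail.

(** * Densities *)

Section Densities.
Context {R : realType}.
Lemma euler_prod_free (k N : nat) : euler_prod k.+1 (0 : R) N =
  euler_prod 0 0 N * \prod_(i < N) (1 - (nth_prime i.+1)%:R ^- k.+1).
Proof.
rewrite /euler_prod -big_split/=; apply: eq_bigr => i _.
by rewrite !tilted0 /euler_factor mulrC exprVn.
Qed.
Lemma nth_primeS_ge (i : nat) : (i.+2 <= nth_prime i.+1)%N.
Proof.
elim: i => [|i IH]; first exact: prime_gt1 (prime_nth_prime 0).
exact: leq_trans (nth_prime_ltS i.+1).
Qed.
Lemma free_factor (k i : nat) : (2 <= k)%N ->
  1 - (i.+2%:R ^+ 2)^-1 <= (1 - (nth_prime i.+1)%:R ^- k : R) <= 1.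
Proof.
move=> k2; have p0 : 0 < (nth_prime i.+1)%:R :> R by rewrite ltr0n prime_gt0// prime_nth_prime.
rewrite gerBl invr_ge0 exprn_ge0 ?ler0n// andbT lerD2l lerN2.
rewrite lef_pV2 ?posrE ?exprn_gt0 ?p0 ?ltr0n//.
apply: (@le_trans _ _ ((nth_prime i.+1)%:R ^+ 2)).
  by rewrite lerXn2r ?nnegrE ?ler0n// ler_nat nth_primeS_ge.
by rewrite ler_weXn2l// ler1n prime_gt0// prime_nth_prime.
Qed.
(** The ratio is the product of the 1 - p ^ (- k), which decreases and stays above
    the telescoping product of the 1 - 1 / (i + 2) ^ 2, hence above 1 / 2. *)
Lemma cvg_free_density (k : nat) : (2 <= k)%N -> exists2 l : R, l != 0 &
  euler_prod k 0 N / euler_prod 0 0 N @[N --> \oo] --> l.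
Proof.
case: k => [//|k] k2.
pose u (N : nat) : R := \prod_(i < N) (1 - (nth_prime i.+1)%:R ^- k.+1).
have E N : euler_prod k.+1 0 N / euler_prod 0 0 N = u N.
  by rewrite euler_prod_free mulrAC divff ?mul1r// gt_eqF// euler_prod_gt0.
have f1 i := @free_factor k.+1 i k2.
have g0 i : 0 < 1 - (i.+2%:R ^+ 2)^-1 :> R.
  by rewrite subr_gt0 invf_lt1 ?exprn_gt0// exprn_egt1// ltr1n.
have f0 i : 0 < 1 - (nth_prime i.+1)%:R ^- k.+1 :> R.
  by have /andP[h _] := f1 i; exact: lt_le_trans h.
have half N : (N.+2%:R / (2 * N.+1%:R) : R) <= u N.
  elim: N => [|N IH]; first by rewrite /u big_ord0 mulr1 divff.
  rewrite /u big_ord_recr/= -/(u N).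
  have /andP[h _] := f1 N; apply: le_trans (ler_pM _ _ IH h); last 2 first.
  - by rewrite divr_ge0.
  - exact: ltW.
  rewrite le_eqVlt; apply/orP; left; apply/eqP.
  rewrite -!natr1; have n0 : 0 <= N%:R :> R by [].
  by field; rewrite !gt_eqF//; lra.
have u_half N : 2^-1 <= u N.
  apply: le_trans (half N); rewrite ler_pdivlMr ?mulr_gt0// mulrA mulVf ?mul1r ?ler_nat//.
have nincr : nonincreasing_seq u.
  apply/nonincreasing_seqP => N; rewrite {1}/u big_ord_recr/= -/(u N).
  have /andP[_ h] := f1 N; rewrite ler_piMr//; exact: le_trans (u_half N).
have cu : cvgn u.
  apply: nonincreasing_is_cvgn => //; exists 2^-1 => _ [N _ <-]; exact: u_half.
exists (limn u).
  have : 2^-1 <= limn u by apply: limr_ge => //; apply: nearW.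
  by move=> h; rewrite gt_eqF//; apply: lt_le_trans h; rewrite invr_gt0.
by under eq_cvg do rewrite E.
Qed.
(** This converts the law on k-free integers into the conditional densities of the
    theorem. *)
Lemma law_allowed (k N : nat) (A : set nat) :
  fine (law 0 N (A `&` allowed k `&` Omega N)) =
  fine (law k N A) * (euler_prod k 0 N / euler_prod 0 0 N) :> R.
Proof.
have p0 m := euler_prod_gt0 m N (lexx (0 : R)).
rewrite !lawE.
have -> : A `&` allowed k `&` Omega N `&` Omega_free 0 N = A `&` Omega_free k N.
  rewrite /Omega_free setIT -setIA setIid -setIA; congr (_ `&` _); exact: setIC.
have fin : (\esum_(n in A `&` Omega_free k N) (n%:R^-1 : R)%:E)%E \is a fin_num.
  rewrite ge0_fin_numE; last by apply: esum_ge0 => n _; rewrite lee_fin.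
  apply: le_lt_trans (ltry (euler_prod k 0 N)); rewrite -esum_Omega_free0.
  rewrite [leLHS]esum_mkcondl; apply: le_esum => n _.
  by case: ifP => _; rewrite lee_fin ?invr_ge0.
rewrite -(fineK fin) -!EFinM/=; field.
by rewrite !gt_eqF.
Qed.
Lemma smooth_log_ratio (n : nat) (s : R) : 0 < s -> (1 < n)%N ->
  ((max_pdiv n)%:R <= n%:R `^ (1 / s)) = (s <= log_ratio R n).
Proof.
move=> s0 n1; have q1 := prime_gt1 (max_pdiv_prime n1).
have n0 : 0 < n%:R :> R by rewrite ltr0n ltnW.
have lq : 0 < ln (max_pdiv n)%:R :> R by rewrite ln_gt0// ltr1n.
rewrite -[LHS]ler_ln ?posrE ?powR_gt0 ?ltr0n ?max_pdiv_gt0 ?(ltnW n1)// ln_powR mul1r mulrC.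
by rewrite ler_pdivlMr// /log_ratio ler_pdivlMr// mulrC.
Qed.
(** At n = 1 the ratio is 0 by convention, whereas 1 is smooth. *)
Lemma smooth_setE (s : R) : 0 < s -> smooth_set s = [set 1%N] `|` log_ratio_ge s.
Proof.
move=> s0; apply/seteqP; split => n /=.
  move=> [n0 sn]; have [->|n1] := eqVneq n 1%N; [by left|right; split => //].
  by rewrite -smooth_log_ratio// ltn_neqAle eq_sym n1.
move=> [->|[n0 sn]]; first by split => //; rewrite powR1.
split => //; rewrite smooth_log_ratio// ltn_neqAle n0 andbT.
by apply: contraTneq sn => <-; rewrite /log_ratio ln1 mul0r -ltNge.
Qed.
Lemma cvg_law1 (k : nat) : k != 1%N -> fine (law k N [set 1%N]) @[N --> \oo] --> (0 : R).
Proof.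
move=> k1; have E N : fine (law k N [set 1%N]) = (euler_prod k 0 N)^-1 :> R.
  rewrite law_set1 ifT ?invr1 ?mul1r// inE.
  have : Omega_free k 0 1%N by rewrite Omega_free0E.
  by elim: N => // N IH /IH [nO nk]; split => //; exact: OmegaS.
under eq_cvg do rewrite E.
apply/gtr0_cvgV0; last exact: cvg_euler_prod_oo.
by apply: nearW => N; exact: euler_prod_gt0.
Qed.
Variables (rho : R -> R) (hrho : is_dickman_function rho).
Lemma tail_densities (k : nat) (s : R) : k != 1%N -> 1 <= s -> exists l : R,
  [/\ fine (law k N (smooth_set s)) @[N --> \oo] --> l,
      fine (law k N (log_ratio_ge s)) @[N --> \oo] --> l &
      l%:E = ((expR (- euler_gamma R))%:E *
         \int[lebesgue_measure]_(x in `[(s - 1)%R, +oo[) (rho x)%:E)%E].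
Proof.
move=> k1 s1; have [D hD] := dickman_rv_exists hrho.
pose P : probability _ R := dickman_prob hrho.
have s0 : 0 < s by exact: lt_le_trans s1.
have geE : log_ratio_ge s = [set n | s <= log_ratio R n].
  apply/seteqP; split => [n []//|n /= sn]; split => //.
  by case: n sn => // sn; move: s0; rewrite ltNge (le_trans sn)// /log_ratio ln0 ?mul0r.
have cge : fine (law k N (log_ratio_ge s)) @[N --> \oo] --> fine (P [set w | (s - 1 <= D w)%R]).
  by rewrite geE; exact: (cvg_log_ratio_tail hrho hD k1 s1).
exists (fine (P [set w | (s - 1 <= D w)%R])); split => //.
- have E N : fine (law k N (smooth_set s)) = fine (law k N [set 1%N]) + fine (law k N (log_ratio_ge s)).
    have disj : [set 1%N] `&` log_ratio_ge s = set0.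
      apply/seteqP; split => // n [/= ->] [_].
      by rewrite /log_ratio ln1 mul0r leNgt s0.
    rewrite smooth_setE//.
    rewrite (measureU (law k N) (measurable_nat _) (measurable_nat _) disj).
    by rewrite fineD// fin_num_measure.
  under eq_cvg do rewrite E.
  set l := fine (P _) in cge *; rewrite -[l]add0r.
  by apply: cvgD => //; exact: cvg_law1.
- rewrite fineK; last by apply: fin_num_measure; apply: measurable_tail; exact: measurable_funPT.
  by apply: (dickman_tail hrho hD); rewrite subr_ge0.
Qed.
End Densities.
Unset Implicit Arguments.

Theorem theorem2 (R : realType) (rho : R -> R) (hrho : is_dickman_function rho) :
  (forall (d : measure_display) (T : measurableType d) (P : probability T R)
      (D : {RV P >-> R}), has_dickman_distribution rho D ->
    weak_cvg (fun N => distribution (P_ R N) (log_ratio R))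
             (distribution P (D \+ cst 1))
    /\ forall k : nat, (2 <= k)%N ->
       weak_cvg (fun N => distribution (P_free R k N) (log_ratio R))
                (distribution P (D \+ cst 1)))
  /\ (forall s : R, 1 <= s ->
       [/\ cvg_log_indep_density R (smooth_set s),
           cvg_log_indep_density R (log_ratio_ge s),
           log_indep_density R (smooth_set s) =
             log_indep_density R (log_ratio_ge s) &
           (log_indep_density R (log_ratio_ge s))%:E =
             ((expR (- euler_gamma R))%:E *
               \int[lebesgue_measure]_(x in `[(s - 1)%R, +oo[) (rho x)%:E)%E])
  /\ (forall (k : nat) (s : R), (2 <= k)%N -> 1 <= s ->
       [/\ cvg_log_indep_density_cond R (smooth_set s) (kfree k),
           cvg_log_indep_density_cond R (log_ratio_ge s) (kfree k),
           log_indep_density_cond R (smooth_set s) (kfree k) =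
             log_indep_density_cond R (log_ratio_ge s) (kfree k) &
           (log_indep_density_cond R (log_ratio_ge s) (kfree k))%:E =
             ((expR (- euler_gamma R))%:E *
               \int[lebesgue_measure]_(x in `[(s - 1)%R, +oo[) (rho x)%:E)%E]).
Proof.
split; [move=> d T P D hD; split => [|[|[|k]] // _]|split => [s s1|[|[|k]] s // _ s1]].
- exact: (weak_cvg_log_ratio hrho hD (isT : 0%N != 1%N)).
- exact: (weak_cvg_log_ratio hrho hD (isT : k.+2 != 1%N)).
- have [l [c1 c2 lE]] := tail_densities hrho (isT : 0%N != 1%N) s1.
  have E (A : set nat) N : fine (P_ R N (A `&` Omega N)) = fine (law 0 N A).
    have p0 : euler_prod 0 (0 : R) N != 0 by rewrite gt_eqF// euler_prod_gt0.
    have := law_allowed 0 N A; rewrite (_ : A `&` allowed 0 = A); last exact: setIT.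
    by move=> ->; rewrite divff// mulr1.
  have {}c1 : fine (P_ R N (smooth_set s `&` Omega N)) @[N --> \oo] --> l.
    by under eq_cvg do rewrite E.
  have {}c2 : fine (P_ R N (log_ratio_ge s `&` Omega N)) @[N --> \oo] --> l.
    by under eq_cvg do rewrite E.
  rewrite /log_indep_density (cvg_lim _ c1)// (cvg_lim _ c2)//.
  by split => //; [apply/cvg_ex; exists l|apply/cvg_ex; exists l].
- have [l [c1 c2 lE]] := tail_densities hrho (isT : k.+2 != 1%N) s1.
  have [m m0 cm] := @cvg_free_density R k.+2 isT.
  have E (A : set nat) N : fine (P_ R N (A `&` kfree k.+2 `&` Omega N)) =
      fine (law k.+2 N A) * (euler_prod k.+2 0 N / euler_prod 0 0 N).
    exact (law_allowed k.+2 N A).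
  have cA (A : set nat) : fine (law k.+2 N A) @[N --> \oo] --> l ->
      fine (P_ R N (A `&` kfree k.+2 `&` Omega N)) @[N --> \oo] --> l * m.
    by move=> cA; under eq_cvg do rewrite E; exact: cvgM.
  have cS : fine (P_ R N (kfree k.+2 `&` Omega N)) @[N --> \oo] --> m.
    have ES N : fine (P_ R N (kfree k.+2 `&` Omega N)) =
        euler_prod k.+2 0 N / euler_prod 0 0 N.
      have := E setT N; rewrite setTI => ->.
      by rewrite (congr1 fine (probability_setT (law k.+2 N))) mul1r.
    by under eq_cvg do rewrite ES.
  have {}c1 := cA _ c1; have {}c2 := cA _ c2.
  rewrite /log_indep_density_cond /cvg_log_indep_density_cond /cvg_log_indep_density.
  rewrite /log_indep_density (cvg_lim _ c1)// (cvg_lim _ c2)// (cvg_lim _ cS)// mulfK//.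
Qed.
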